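(* For every integer $r\geq 2$ and all reals $\gamma,\beta>0$ there exist $D_0$ and $\alpha_0>0$ such that for all $D\geq D_0$ and $0<\alpha\leq\alpha_0$ the following holds. Let $G$ be an $r$-uniform (multi-)hypergraph which is the edge-disjoint union of $G_1$ and $G_2$, where $G_2=(A,B)$ is a bipartite hypergraph and $G_1$ is a hypergraph with $V(G_1)\cap V(G_2)=A$. Suppose $G$ has codegrees at most $D^{1-\beta}$, every vertex of $B$ has degree at most $D$ in $G_2$, every vertex of $A$ has degree at least $D^{1-\alpha}$ in $G_2$, every vertex of $G_1$ has degree at most $D$ in $G_1$, and every vertex of $A$ has degree at least $D(1-D^{-\beta})$ in $G_1$. Then there exists a probability distribution on $A$-perfect matchings $M$ of $G$ such that $\mathbb{P}[S\subseteq M]\leq\left(D^{-(1-\gamma)}\right)^{|S|}$ for every $S\subseteq E(G)$.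
   Context: A hypergraph $G=(A,B)$ is bipartite with parts $A$ and $B$ if $V(G)=A\cup B$ and every edge of $G$ contains exactly one vertex of $A$. A matching of a hypergraph is a set of pairwise vertex-disjoint edges; a matching is $A$-perfect if every vertex of $A$ lies in an edge of the matching. The codegree of two distinct vertices is the number of edges containing both; the degree of a vertex is the number of edges containing it (counted with multiplicity in multi-hypergraphs). *)

(* Defs.v *)
From HB Require Import structures.
From mathcomp Require Import all_boot all_order all_algebra.
From mathcomp Require Import all_classical all_reals all_analysis.

Set Implicit Arguments.
Unset Strict Implicit.
Unset Printing Implicit Defensive.

Import Order.TTheory GRing.Theory Num.Theory.

(* Finite multi-hypergraphs: edges are labels in [E] and [inc] gives the set of
   vertices of an edge; it need not be injective, so that parallel edges are
   distinct labels. The value of [inc] outside [eset] is irrelevant. *)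
Record hypergraph (V E : finType) := Hypergraph {
  vset : {set V};
  eset : {set E};
  inc : E -> {set V};
  inc_sub : forall e, e \in eset -> inc e \subset vset
}.

Section Hypergraph.
Variables V E : finType.
Implicit Types (G : hypergraph V E) (A B : {set V}) (M : {set E}).

Definition uniform (r : nat) G : Prop :=
  forall e, e \in eset G -> #|inc G e| = r.

Definition deg G (v : V) : nat := #|[set e in eset G | v \in inc G e]|.

Definition codeg G (u v : V) : nat :=
  #|[set e in eset G | (u \in inc G e) && (v \in inc G e)]|.

Definition edge_disjoint_union G G1 G2 : Prop :=
  [/\ vset G = vset G1 :|: vset G2,
      eset G = eset G1 :|: eset G2,
      [disjoint eset G1 & eset G2],
      forall e, e \in eset G1 -> inc G e = inc G1 e &
      forall e, e \in eset G2 -> inc G e = inc G2 e].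

Definition bipartite G A B : Prop :=
  [/\ vset G = A :|: B, [disjoint A & B] &
      forall e, e \in eset G -> #|inc G e :&: A| = 1].

Definition matching G M : Prop :=
  M \subset eset G /\
  forall e f, e \in M -> f \in M -> e != f -> [disjoint inc G e & inc G f].

Definition perfect_matching_on G A M : Prop :=
  matching G M /\
  forall a, a \in A -> exists2 e, e \in M & a \in inc G e.

End Hypergraph.

Local Open Scope ring_scope.

(* [p] is the probability mass function of a random element of [T] that
   satisfies [P] with probability 1. *)
Definition distribution_on (R : realType) (T : finType) (P : T -> Prop)
    (p : T -> R) : Prop :=
  [/\ forall x, 0 <= p x, \sum_x p x = 1 & forall x, p x != 0 -> P x].

Definition prob (R : realType) (T : finType) (p : T -> R) (Q : pred T) : R :=
  \sum_(x | Q x) p x.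

(* Main.v *)
(** The spread distribution is the law of a random procedure with three stages,
    each of which is a product measure conditioned by the Lovasz local lemma.
    Conditioning costs at most a factor [2] per chosen edge, so every stage
    selects a given set [S] of edges with probability at most [rate ^ #|S|];
    rates add up over consecutive stages and multiply under sparsification.

    With [x] a small power of [D], first keep every edge of [G1] with
    probability [d / D], where [d] is a fixed power of [x]; this makes the
    codegrees at most [x ^ 2]. Then run a nibble in [G1]: in each round every
    edge is selected with probability [theta / u], [u] being the current maximum
    degree, and every vertex is moreover killed by a coin of its own, biased so
    that all vertices survive with probability exactly [1 - theta]. Selected
    edges that meet no other selected edge join the matching, and all touched
    vertices are discarded. A vertex of [A] is wasted (discarded but unmatched)
    with probability [O(theta ^ 2)] per round, so after the
    [O(log (1 / theta) / theta)] rounds needed to leave a [theta] fraction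
    alive, every [b] in [B] sees only [O(theta * D)] edges of [G2] towards
    unmatched vertices of [A]. As [d] is tiny compared to [D], these sums
    concentrate even with crude worst-case Lipschitz constants. Finally the
    unmatched vertices of [A] are matched inside [G2], choosing each edge with
    probability [x ^ 2 / D]. Since the number of rounds and
    the total loss of degree are bounded by fixed powers of [x], the rates add
    up to a fixed power of [x] divided by [D]. *)

Require Import Defs.
From HB Require Import structures.
From mathcomp Require Import all_boot all_order all_algebra.
From mathcomp Require Import all_classical all_reals all_analysis.
(* Reimported because [all_classical] shadows set lemmas of the same names. *)
From mathcomp Require Import fintype finset.
From mathcomp Require Import ring lra zify.

Set Implicit Arguments.
Unset Strict Implicit.
Unset Printing Implicit Defensive.

Import Order.TTheory GRing.Theory Num.Theory.
Local Open Scope ring_scope.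

(** * Expectation over independent coins and concentration *)

(** The number of vertices is not bounded in terms of [D], so no union bound over vertices is
    available. This forces the local lemma in every stage, and with it the need that each bad event
    read few coins and each coin influence few bad events. Trimming serves the same end: degrees of
    [A] in [G2] are bounded only from below, so a set of between [D / x] and [2 * D / x] edges is
    fixed at each vertex of [A] beforehand. The concentration bound for the load on [b] loses about
    the cube of the current degree in [G1]. At degree [D] no codegree bound [D ^ (1 - beta)] could
    pay for that; at degree [d] it can. In the rate, sparsification is almost free: an edge survives
    with probability [d / D] and is selected with probability [theta / u], where [u] is at least
    [d / y], so [d] cancels. Near-regularity is required only on [A]: it makes the kill coin of such
    a vertex of order [theta ^ 2]. Other vertices of [G1] may have small degree and are then killed
    more often, which is harmless because they need not be matched. All parameters are powers of
    [x = D ^ (1 / N)], and [beta] and [gamma] enter only through [N]. *)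

Lemma set_ind (T : finType) (P : {set T} -> Prop) : P set0 ->
  (forall x (A : {set T}), x \notin A -> P A -> P (x |: A)) -> forall A, P A.
Proof.
move=> P0 PU A; have [n] := ubnP #|A|; elim: n A => // n IH A.
have [->//|[x xA]] := set_0Vmem A.
rewrite (cardsD1 x) xA => An; rewrite -(setD1K xA).
by apply: PU; [rewrite !inE eqxx | apply: IH].
Qed.

Section Bernoulli.
Variables (R : realType) (I : finType) (p : I -> R).
Hypothesis p01 : forall i, 0 <= p i <= 1.
Implicit Types (i j : I) (l : seq I) (s t X Y S : {set I}) (F G : {set I} -> R).

(* The product measure is never built: expectations are iterated averages over
   one coin at a time, so their properties follow by induction on the coins. *)
Definition average i F X : R := p i * F (i |: X) + (1 - p i) * F (X :\ i).
Definition averages l F : {set I} -> R := foldr average F l.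
Definition expect F : R := averages (enum I) F set0.

Lemma ge0_p i : 0 <= p i. Proof. by case/andP: (p01 i). Qed.
Lemma ge0_1p i : 0 <= 1 - p i. Proof. by rewrite subr_ge0; case/andP: (p01 i). Qed.

Lemma le_averages l F G : (forall X, F X <= G X) ->
  forall X, averages l F X <= averages l G X.
Proof.
move=> FG; elim: l => [|i l IH] X //=.
by rewrite /average lerD // ler_wpM2l ?ge0_p ?ge0_1p.
Qed.

Lemma eq_averages l F G : F =1 G -> averages l F =1 averages l G.
Proof.
by move=> FG; elim: l => [|i l IH] X //=; rewrite /average !IH.
Qed.

Lemma averagesD l F G X :
  averages l (fun Y => F Y + G Y) X = averages l F X + averages l G X.
Proof. by elim: l X => [|i l IH] X //=; rewrite /average !IH; ring. Qed.

Lemma averagesZ l (a : R) F X :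
  averages l (fun Y => a * F Y) X = a * averages l F X.
Proof. by elim: l X => [|i l IH] X //=; rewrite /average !IH; ring. Qed.

Lemma averages_cst l (a : R) X : averages l (fun=> a) X = a.
Proof. by elim: l X => [|i l IH] X //=; rewrite /average !IH; ring. Qed.

Lemma averages_sum l (K : Type) (r : seq K) (P : pred K) (F : K -> {set I} -> R) X :
  averages l (fun Y => \sum_(k <- r | P k) F k Y) X =
  \sum_(k <- r | P k) averages l (F k) X.
Proof.
elim: r => [|k r IH].
  rewrite big_nil -[RHS](averages_cst l 0 X).
  by apply: eq_averages => Y; rewrite big_nil.
rewrite big_cons -IH; case: ifP => Pk.
  by rewrite -averagesD; apply: eq_averages => Y; rewrite big_cons Pk.
by apply: eq_averages => Y; rewrite big_cons Pk.
Qed.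

Definition depends (T : Type) s (F : {set I} -> T) := forall X Y, X :&: s = Y :&: s -> F X = F Y.

Lemma depends_sub (T : Type) s t (F : {set I} -> T) : s \subset t -> depends s F -> depends t F.
Proof.
move=> st dF X Y XY; apply: dF.
by rewrite -(setIidPr st) !setIA XY.
Qed.

Lemma depends_average s F i : depends s F -> depends s (average i F).
Proof.
move=> dF X Y XY; rewrite /average.
have e1 : F (i |: X) = F (i |: Y) by apply: dF; rewrite !setIUl XY.
have e2 : F (X :\ i) = F (Y :\ i) by apply: dF; rewrite !setDE -setIAC XY setIAC.
by rewrite e1 e2.
Qed.

Lemma average_notin s F i : depends s F -> i \notin s -> average i F =1 F.
Proof.
move=> dF is_ X; rewrite /average.
have -> : F (i |: X) = F X.
  apply: dF; rewrite setIUl; suff -> : [set i] :&: s = set0 by rewrite set0U.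
  by apply/setP => j; rewrite !inE; case: eqP => // ->; rewrite (negbTE is_).
have -> : F (X :\ i) = F X.
  by apply: dF; apply/setP => j; rewrite !inE; case: eqP => // ->; rewrite (negbTE is_) !andbF.
ring.
Qed.

(** Each coin lies in [s] or in its complement, so one of the two factors, already averaged over the
    later coins, does not see it and can be pulled out of the average. *)
Lemma averages_indep l s F G : depends s F -> depends (~: s) G ->
  forall X, averages l (fun Y => F Y * G Y) X = averages l F X * averages l G X.
Proof.
move=> dF dG; have dl (H : {set I} -> R) t : depends t H -> depends t (averages l H).
  by move=> dH; elim: l => [|i l IH] //=; apply: depends_average.
elim: l dl => [|i l IH] dl X //=.
have dl' (H : {set I} -> R) t : depends t H -> depends t (averages l H).
  by move=> dH; elim: (l) => [|k l' IH'] //=; apply: depends_average.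
rewrite /average !(IH dl').
have [is_|is_] := boolP (i \in s).
  have := @average_notin (~: s) (averages l G) i (dl' _ _ dG).
  rewrite inE is_ => /(_ isT) aG.
  have dG' : forall Y Z, Y :\ i = Z :\ i -> averages l G Y = averages l G Z.
    move=> Y Z YZ; apply: dl' dG _ _ _; apply/setP => j; rewrite !inE.
    have [->|ji] := eqVneq j i; first by rewrite is_ !andbF.
    by move/setP: YZ => /(_ j); rewrite !inE ji /= => ->.
  have -> : averages l G (i |: X) = averages l G X.
    by apply: dG'; apply/setP => j; rewrite !inE; case: eqP.
  have -> : averages l G (X :\ i) = averages l G X.
    by apply: dG'; apply/setP => j; rewrite !inE; case: eqP.
  ring.
have dF' : forall Y Z, Y :\ i = Z :\ i -> averages l F Y = averages l F Z.
  move=> Y Z YZ; apply: dl' dF _ _ _; apply/setP => j; rewrite !inE.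
  have [->|ji] := eqVneq j i; first by rewrite (negbTE is_) !andbF.
  by move/setP: YZ => /(_ j); rewrite !inE ji /= => ->.
have -> : averages l F (i |: X) = averages l F X.
  by apply: dF'; apply/setP => j; rewrite !inE; case: eqP.
have -> : averages l F (X :\ i) = averages l F X.
  by apply: dF'; apply/setP => j; rewrite !inE; case: eqP.
ring.
Qed.

Lemma le_expect F G : (forall X, F X <= G X) -> expect F <= expect G.
Proof. by move=> FG; apply: le_averages. Qed.

Lemma eq_expect F G : F =1 G -> expect F = expect G.
Proof. by move=> FG; apply: eq_averages. Qed.

Lemma expectD F G : expect (fun Y => F Y + G Y) = expect F + expect G.
Proof. exact: averagesD. Qed.

Lemma expectZ (a : R) F : expect (fun Y => a * F Y) = a * expect F.
Proof. exact: averagesZ. Qed.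

Lemma expectN F : expect (fun Y => - F Y) = - expect F.
Proof. by rewrite -mulN1r -expectZ; apply: eq_expect => X; rewrite mulN1r. Qed.

Lemma expect_cst (a : R) : expect (fun=> a) = a.
Proof. exact: averages_cst. Qed.

Lemma expect_ge0 F : (forall X, 0 <= F X) -> 0 <= expect F.
Proof. by move=> F0; rewrite -(expect_cst 0); apply: le_expect. Qed.

Lemma expect_sum (K : Type) (r : seq K) (P : pred K) (F : K -> {set I} -> R) :
  expect (fun Y => \sum_(k <- r | P k) F k Y) = \sum_(k <- r | P k) expect (F k).
Proof. exact: averages_sum. Qed.

Lemma expect_indep s F G : depends s F -> depends (~: s) G ->
  expect (fun Y => F Y * G Y) = expect F * expect G.
Proof. by move=> dF dG; rewrite /expect (averages_indep _ dF dG). Qed.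

Lemma expect_mem (g : bool -> R) i :
  expect (fun X => g (i \in X)) = p i * g true + (1 - p i) * g false.
Proof.
rewrite /expect; have : i \in enum I by rewrite mem_enum.
move: set0; elim: (enum I) => [//|j l IH] X; rewrite inE.
(* A later average over [i] overwrites the earlier value, so only the last occurrence of [i] matters
   and no duplicate-freeness is used. *)
have [ij|ij] := boolP (i \in l).
  by move=> _ /=; rewrite /average !IH //; ring.
rewrite orbF => /eqP <- /=.
have al Y : averages l (fun X => g (i \in X)) Y = g (i \in Y).
  elim: l ij {IH} Y => [|k l IH] //=; rewrite inE negb_or => /andP[ik il] Y.
  by rewrite /average !IH // !inE (negbTE ik) /=; ring.
by rewrite /average !al !inE eqxx.
Qed.

Lemma depends_mem (g : bool -> R) i : depends [set i] (fun X => g (i \in X)).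
Proof. by move=> X Y /setP/(_ i); rewrite !inE eqxx !andbT => ->. Qed.

Lemma depends_subset S : depends S (fun X => S \subset X).
Proof. by move=> X Y XY; apply/setIidPr/setIidPr; rewrite XY. Qed.

Lemma depends_prod (K : finType) (P : pred K) (f : K -> {set I} -> R) s :
  (forall k, P k -> depends s (f k)) -> depends s (fun X => \prod_(k | P k) f k X).
Proof. by move=> df X Y XY; apply: eq_bigr => k Pk; apply: df XY. Qed.

Lemma expect_prod (g : I -> bool -> R) S :
  expect (fun X => \prod_(i in S) g i (i \in X)) =
  \prod_(i in S) (p i * g i true + (1 - p i) * g i false).
Proof.
elim/set_ind: S => [|i S iS IH].
  rewrite big_set0 -[RHS](expect_cst 1).
  by apply: eq_expect => X; rewrite big_set0.
rewrite big_setU1 //= -IH -expect_mem.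
rewrite -(@expect_indep [set i]); last 2 first.
- exact: depends_mem.
- apply: depends_prod => j jS; apply: (@depends_sub _ [set j]).
    by rewrite sub1set !inE; apply: contraNneq iS => <-.
  exact: depends_mem.
by apply: eq_expect => X; rewrite big_setU1.
Qed.

Lemma expect_subset S : expect (fun X => (S \subset X)%:R) = \prod_(i in S) p i.
Proof.
transitivity (\prod_(i in S) (p i * true%:R + (1 - p i) * false%:R)).
  rewrite -(expect_prod (fun _ b => b%:R)); apply: eq_expect => X.
  have [/fintype.subsetP SX|/subsetPn[i iS iX]] := boolP (S \subset X).
    by rewrite big1 // => i /SX ->.
  by rewrite (bigD1 i) //= (negbTE iX) mul0r.
by apply: eq_bigr => i _; rewrite mulr1 mulr0 addr0.
Qed.

Lemma expect_disjoint S :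
  expect (fun X => [disjoint S & X]%:R) = \prod_(i in S) (1 - p i).
Proof.
transitivity (\prod_(i in S) (p i * (~~ true)%:R + (1 - p i) * (~~ false)%:R)).
  rewrite -(expect_prod (fun _ b => (~~ b)%:R)); apply: eq_expect => X.
  have [SX|] := boolP [disjoint S & X].
    by rewrite big1 // => i iS; rewrite (disjointFr SX iS).
  by move=> /pred0Pn[i /= /andP[iS iX]]; rewrite (bigD1 i) //= iX mul0r.
by apply: eq_bigr => i _; rewrite mulr1 mulr0 add0r.
Qed.

(** From [1 - z <= expR (- z)] one gets [(1 - z) * expR z <= 1], while [(1 - z) * (1 + z + 2 * z ^+
    2) = 1 + z ^+ 2 * (1 - 2 * z)] is at least 1. *)
Lemma expR_quadratic (z : R) : z <= 1 / 2 -> expR z <= 1 + z + 2 * z ^+ 2.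
Proof.
move=> z2; have := expR_ge1Dx (- z); rewrite expRN => h.
have e0 : 0 < expR z by apply: expR_gt0.
have h1 : (1 - z) * expR z <= 1.
  by have := ler_wpM2r (ltW e0) h; rewrite mulVf ?lt0r_neq0.
have h2 : 0 < 1 - z by lra.
rewrite -(ler_pM2l h2); apply: (le_trans h1); nra.
Qed.

(** With [z = lam * (x - y)], factoring out [expR (lam * y)] leaves [1 + P * (expR z - 1)], to which
    the quadratic bound and [1 + t <= expR t] apply. Keeping the factor [P] in the variance term is
    what later gives a Bernstein tail, where rare coins cost little. *)
Lemma average_expR_le (lam c P x y : R) : 0 <= lam -> 0 <= c -> 2 * lam * c <= 1 ->
  0 <= P <= 1 -> `|x - y| <= c ->
  P * expR (lam * x) + (1 - P) * expR (lam * y) <=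
  expR (lam * (P * x + (1 - P) * y) + 2 * lam ^+ 2 * (P * c ^+ 2)).
Proof.
move=> l0 c0 lc /andP[P0 P1] xy.
have xyc : x - y <= c by apply: le_trans (ler_norm _) xy.
set z := lam * (x - y).
have z2 : z <= 1 / 2.
  by have : z <= lam * c by [rewrite ler_wpM2l]; lra.
have -> : expR (lam * x) = expR (lam * y) * expR z.
  by rewrite -expRD; congr expR; rewrite /z; ring.
have -> : lam * (P * x + (1 - P) * y) + 2 * lam ^+ 2 * (P * c ^+ 2) =
  lam * y + (P * z + 2 * lam ^+ 2 * (P * c ^+ 2)) by rewrite /z; ring.
rewrite expRD.
have -> : P * (expR (lam * y) * expR z) + (1 - P) * expR (lam * y) =
  expR (lam * y) * (1 + P * (expR z - 1)) by ring.
rewrite ler_wpM2l ?expR_ge0 //; apply: le_trans (expR_ge1Dx _).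
rewrite lerD2l.
have zz : z ^+ 2 <= lam ^+ 2 * c ^+ 2.
  rewrite /z exprMn ler_wpM2l ?sqr_ge0 //.
  by rewrite -(ger0_norm (sqr_ge0 (x - y))) normrX lerXn2r ?nnegrE.
have := expR_quadratic z2 => ez.
have : P * (expR z - 1) <= P * (z + 2 * (lam ^+ 2 * c ^+ 2)).
  by rewrite ler_wpM2l //; lra.
by move=> h; apply: (le_trans h); rewrite mulrDr lerD2l; lra.
Qed.

Definition lipschitz (c : I -> R) F :=
  forall i X, `|F (i |: X) - F (X :\ i)| <= c i.

Lemma lipschitz_averages (c : I -> R) F l :
  (forall i, 0 <= c i) -> lipschitz c F -> lipschitz c (averages l F).
Proof.
move=> c0 cF; elim: l => [//|j l IH] i X /=; rewrite /average.
have [->|ij] := eqVneq j i.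
  have -> : i |: (i |: X) = i |: X by apply/setP => k; rewrite !inE orbA orbb.
  have -> : (i |: X) :\ i = X :\ i by apply/setP => k; rewrite !inE; case: eqP.
  have -> : i |: X :\ i = i |: X by apply/setP => k; rewrite !inE; case: eqP.
  have -> : X :\ i :\ i = X :\ i by apply/setP => k; rewrite !inE; case: eqP.
  by rewrite subrr normr0.
have -> : j |: (i |: X) = i |: (j |: X).
  by apply/setP => k; rewrite !inE orbCA.
have -> : (i |: X) :\ j = i |: (X :\ j).
  by apply/setP => k; rewrite !inE; have [->|] := eqVneq k i; rewrite //= eq_sym ij.
have -> : j |: X :\ i = (j |: X) :\ i.
  by apply/setP => k; rewrite !inE; have [->|] := eqVneq k j; rewrite //= ij.
have -> : X :\ i :\ j = X :\ j :\ i.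
  by apply/setP => k; rewrite !inE andbCA.
set a := averages l F; rewrite -[a _]/(a (i |: (j |: X))).
have := IH i (j |: X); have := IH i (X :\ j); rewrite -/a => h1 h2.
have -> : forall u v w t : R, p j * u + (1 - p j) * v - (p j * w + (1 - p j) * t) =
  p j * (u - w) + (1 - p j) * (v - t) by move=> *; ring.
apply: (le_trans (ler_normD _ _)); rewrite !normrM.
rewrite (ger0_norm (ge0_p j)) (ger0_norm (ge0_1p j)).
have -> : c i = p j * c i + (1 - p j) * c i by ring.
by rewrite lerD // ler_wpM2l ?ge0_p ?ge0_1p.
Qed.

(** The exponential moment of the Doob martingale that reveals one coin at a time: partial averages
    stay Lipschitz, so each coin contributes one term [p i * c i ^+ 2]. *)
Lemma averages_expR_le (lam : R) (c : I -> R) F l X : 0 <= lam ->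
  (forall i, 0 <= c i) -> (forall i, 2 * lam * c i <= 1) -> lipschitz c F ->
  averages l (fun Y => expR (lam * F Y)) X <=
  expR (lam * averages l F X + 2 * lam ^+ 2 * \sum_(i <- l) p i * c i ^+ 2).
Proof.
move=> l0 c0 lc cF; elim: l X => [|i l IH] X.
  by rewrite big_nil mulr0 addr0.
rewrite big_cons /=; set w := \sum_(_ <- _) _.
apply: (@le_trans _ _ ((p i * expR (lam * averages l F (i |: X)) +
  (1 - p i) * expR (lam * averages l F (X :\ i))) * expR (2 * lam ^+ 2 * w))).
  have IH' Y : averages l (fun Z => expR (lam * F Z)) Y <=
      expR (lam * averages l F Y) * expR (2 * lam ^+ 2 * w) by rewrite -expRD.
  rewrite /average [X in _ <= X]mulrDl -[X in _ <= X + _]mulrA -[X in _ <= _ + X]mulrA.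
  by rewrite lerD // ler_wpM2l ?ge0_p ?ge0_1p.
rewrite [_ * (_ + w)]mulrDr addrA expRD ler_wpM2r ?expR_ge0 //.
by apply: average_expR_le => //; apply: lipschitz_averages.
Qed.

Lemma expect_tail (lam m : R) (c : I -> R) F (v t : R) : 0 <= lam ->
  (forall i, 0 <= c i) -> (forall i, 2 * lam * c i <= 1) -> lipschitz c F ->
  \sum_i p i * c i ^+ 2 <= v -> expect F <= m ->
  expect (fun X => (m + t < F X)%R%:R) <= expR (2 * lam ^+ 2 * v - lam * t).
Proof.
move=> l0 c0 lc cF cv Fm.
apply: (@le_trans _ _ (expect (fun X => expR (- (lam * (m + t))) * expR (lam * F X)))).
  apply: le_expect => X; case: ltP => // h; last by rewrite mulr_ge0 ?expR_ge0.
  rewrite -expRD; apply: le_trans (expR_ge1Dx _); rewrite lerDl addrC -mulrBr.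
  by rewrite mulr_ge0 // subr_ge0 ltW.
rewrite expectZ; apply: (@le_trans _ _ (expR (- (lam * (m + t))) *
   expR (lam * m + 2 * lam ^+ 2 * v))).
  rewrite ler_wpM2l ?expR_ge0 //.
  apply: (le_trans (averages_expR_le _ _ l0 c0 lc cF)); rewrite ler_expR lerD //.
    by rewrite ler_wpM2l.
  by rewrite ler_wpM2l ?mulr_ge0 ?sqr_ge0 // big_enum.
by rewrite -expRD ler_expR; lra.
Qed.

(* Bernstein-type tails: [cm] bounds the effect of a single coin on [F], and
   [cm * V] is the variance proxy of the exponential moment. *)
Section WeightedSum.
Variables (K : finType) (P : pred K) (w : K -> R) (f : K -> {set I} -> R).
Variables (s : K -> {set I}) (B cm V lam t : R).
Hypothesis w0 : forall k, P k -> 0 <= w k.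
Hypothesis B0 : 0 <= B.
Hypothesis f0B : forall k X, P k -> 0 <= f k X <= B.
Hypothesis ds : forall k, P k -> depends (s k) (f k).
Hypothesis hcm : forall i, \sum_(k | P k && (i \in s k)) B * w k <= cm.
Hypothesis hV : \sum_(k | P k) B * w k * \sum_(i in s k) p i <= V.
Hypothesis cm0 : 0 <= cm.
Hypothesis lam0 : 0 <= lam.
Hypothesis lamcm : 2 * lam * cm <= 1.

Let c i := \sum_(k | P k && (i \in s k)) B * w k.
Let F X := \sum_(k | P k) w k * f k X.

Let c0 i : 0 <= c i.
Proof. by apply: sumr_ge0 => k /andP[Pk _]; rewrite mulr_ge0 ?w0. Qed.

Let lamc i : 2 * lam * c i <= 1.
Proof. by apply: le_trans lamcm; apply: ler_wpM2l (hcm i); rewrite mulr_ge0. Qed.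

Let lipF : lipschitz c F.
Proof.
move=> i X; rewrite /F -sumrB /c big_mkcondr /=.
apply: (le_trans (ler_norm_sum _ _ _)); apply: ler_sum => k Pk.
rewrite -mulrBr normrM ger0_norm ?w0 //; case: ifPn => ik.
  rewrite mulrC ler_wpM2r ?w0 //.
  have /andP[a1 a2] := f0B (i |: X) Pk; have /andP[b1 b2] := f0B (X :\ i) Pk.
  rewrite ler_norml; apply/andP; split; lra.
rewrite (ds Pk (Y := X :\ i)) ?subrr ?normr0 ?mulr0 //.
by apply/setP => j; rewrite !inE; case: eqP => // ->; rewrite (negbTE ik).
Qed.

(** One factor [c i] is bounded by [cm]. Exchanging sums turns the remaining [\sum_i p i * c i] into
    the left-hand side of [hV]. *)
Let varF : \sum_i p i * c i ^+ 2 <= cm * V.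
Proof.
rewrite mulrC; apply: (@le_trans _ _ (\sum_i (p i * c i) * cm)).
  apply: ler_sum => i _; rewrite expr2 mulrA ler_wpM2l ?hcm //.
  by rewrite mulr_ge0 ?ge0_p.
rewrite -mulr_suml ler_wpM2r //; apply: le_trans hV.
under eq_bigr do rewrite /c big_mkcondr mulr_sumr /=.
rewrite exchange_big /=; apply: ler_sum => k Pk.
rewrite mulr_sumr [X in _ <= X]big_mkcond /=; apply: ler_sum => i _.
by case: ifP => _; rewrite ?mulr0 // mulrC.
Qed.

Lemma weighted_sum_upper_tail (m : R) : expect F <= m ->
  expect (fun X => (m + t < F X)%R%:R) <= expR (2 * lam ^+ 2 * (cm * V) - lam * t).
Proof. exact: (expect_tail _ lam0 c0 lamc lipF varF). Qed.

Lemma weighted_sum_lower_tail (m : R) : m <= expect F ->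
  expect (fun X => (F X < m - t)%R%:R) <= expR (2 * lam ^+ 2 * (cm * V) - lam * t).
Proof.
move=> mF.
have lipN : lipschitz c (fun X => - F X).
  by move=> i X; rewrite -opprD normrN; apply: lipF.
have := @expect_tail lam (- m) c _ _ t lam0 c0 lamc lipN varF.
rewrite expectN lerN2 => /(_ mF); apply: le_trans.
apply: le_expect => X.
by rewrite [- m + t]addrC -[t - m]opprB ltrN2.
Qed.

End WeightedSum.

End Bernoulli.

(** * The local lemma *)

Section LocalLemma.
Variables (R : realType) (I : finType) (p : I -> R).
Hypothesis p01 : forall i, 0 <= p i <= 1.
Variables (J : finType) (s : J -> {set I}) (A : J -> {set I} -> bool).
Variables (Delta sigma : R).
Let Pr (Q : {set I} -> bool) : R := expect p (fun X => (Q X)%:R).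
Hypothesis dA : forall j, depends (s j) (A j).
Hypothesis s_le : forall j, #|s j|%:R <= Delta.
Hypothesis PA_sum : forall i, \sum_(j | i \in s j) Pr (A j) <= sigma.
Hypothesis PA_le : forall j, Pr (A j) <= 1 / 4.
Hypothesis sigma0 : 0 <= sigma.
Hypothesis sigma_le : sigma <= 1 / 4.
Hypothesis Delta_sigma : Delta * sigma <= 1 / 4.

Let avoid (F : {set J}) X := [forall j in F, ~~ A j X].
Let near (t : {set I}) := [set k | ~~ [disjoint s k & t]].

Let le_Pr (Q Q' : {set I} -> bool) : (forall X, Q X -> Q' X) -> Pr Q <= Pr Q'.
Proof.
move=> QQ; apply: le_expect => // X; case: (boolP (Q X)) => [/QQ ->//|_].
exact: ler0n.
Qed.

Let Pr_ge0 Q : 0 <= Pr Q.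
Proof. by apply: expect_ge0 => // X; apply: ler0n. Qed.

(** An event near [t] shares a coin with [t] and is paid for at that coin. Counting per coin in this
    way replaces the dependency graph. *)
Let sum_near (t : {set I}) (b : R) : #|t|%:R * sigma <= b -> \sum_(k in near t) Pr (A k) <= b.
Proof.
apply: le_trans; apply: (@le_trans _ _ (\sum_(i in t) \sum_(k | i \in s k) Pr (A k))).
  under [X in _ <= X]eq_bigr do rewrite big_mkcond /=.
  rewrite exchange_big /= big_mkcond /=; apply: ler_sum => k _.
  case: ifPn => [|_]; last by apply: sumr_ge0 => i _; case: ifP.
  rewrite inE => /pred0Pn[i /= /andP[ik it]].
  by rewrite (bigD1 i) //= ik lerDl; apply: sumr_ge0 => j _; case: ifP.
rewrite mulr_natl -sumr_const; apply: ler_sum => i _; exact: PA_sum.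
Qed.

Let depends_avoid (t : {set I}) (F : {set J}) : depends (~: t) (avoid (F :\: near t)).
Proof.
move=> X Y XY; apply: eq_forallb_in => j; rewrite !inE negbK => /andP[jt _].
congr (~~ _); apply: dA; apply/setP => i; move/setP: XY => /(_ i); rewrite !inE.
have [ij|//] := boolP (i \in s j); last by rewrite !andbF.
by rewrite (disjointFr jt ij) !andbT.
Qed.

(** If the far events are avoided but some event of [F] occurs, it is a near one. By hypothesis this
    costs at most [2 * (1 / 4)] of the probability of avoiding the far events, so at least half of
    it remains. *)
Let avoid_far (t : {set I}) (F : {set J}) : #|t|%:R * sigma <= 1 / 4 ->
  (forall k, k \in F -> k \in near t ->
     Pr (fun X => A k X && avoid (F :\: near t) X) <=
     2 * Pr (A k) * Pr (avoid (F :\: near t))) ->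
  Pr (avoid (F :\: near t)) <= 2 * Pr (avoid F).
Proof.
move=> /sum_near nt h; set F0 := F :\: near t.
have : Pr (avoid F0) <= Pr (avoid F) +
   \sum_(k in F :&: near t) Pr (fun X => A k X && avoid F0 X).
  rewrite /Pr -expect_sum -expectD; apply: le_expect => // X.
  have [F0X|_] := boolP (avoid F0 X); last first.
    by apply: addr_ge0; rewrite ?ler0n // sumr_ge0 // => k _; rewrite ler0n.
  have [FX|] := boolP (avoid F X).
    by rewrite lerDl sumr_ge0 // => k _; rewrite ler0n.
  rewrite negb_forall_in => /exists_inP[k kF]; rewrite negbK => AkX.
  have kt : k \in F :&: near t.
    rewrite inE kF; apply/negPn/negP => kt; move/forall_inP: F0X => /(_ k).
    by rewrite inE kF kt AkX => /(_ isT).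
  by rewrite add0r (bigD1 k) //= AkX lerDl sumr_ge0 // => j _; rewrite ler0n.
have : \sum_(k in F :&: near t) Pr (fun X => A k X && avoid F0 X) <=
   \sum_(k in F :&: near t) 2 * Pr (A k) * Pr (avoid F0).
  by apply: ler_sum => k; rewrite inE => /andP[]; apply: h.
rewrite -mulr_suml -mulr_sumr.
have : \sum_(k in F :&: near t) Pr (A k) <= 1 / 4.
  apply: le_trans nt; rewrite big_mkcond [X in _ <= X]big_mkcond.
  apply: ler_sum => k _; rewrite !inE; case: (k \in F) => //=.
  by case: ifP.
have := Pr_ge0 (avoid F0); have := Pr_ge0 (avoid F).
by move: (Pr (avoid F0)) (\sum_(_ in _) _) (\sum_(_ in _) _) => a b c; nra.
Qed.

(** The local lemma induction: conditioning on avoiding [F] at most doubles the probability of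
    [A j]. Events of [F] near [s j] are dropped, which makes the rest independent of [A j], and
    restored by [avoid_far]. The induction hypothesis is used only when some event was dropped, so
    the set has shrunk. *)
Let avoid_cond (F : {set J}) j : j \notin F ->
  Pr (fun X => A j X && avoid F X) <= 2 * Pr (A j) * Pr (avoid F).
Proof.
have [n] := ubnP #|F|; elim: n F j => // n IH F j Fn jF.
set F0 := F :\: near (s j).
apply: (@le_trans _ _ (Pr (fun X => A j X && avoid F0 X))).
  apply: le_Pr => X /andP[-> /forall_inP h] /=; apply/forall_inP => k.
  by rewrite inE => /andP[_ kF]; apply: h.
have -> : Pr (fun X => A j X && avoid F0 X) = Pr (A j) * Pr (avoid F0).
  rewrite /Pr -(@expect_indep _ _ _ (s j)); last 2 first.
  - by move=> X Y /dA ->.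
  - by move=> X Y /depends_avoid ->.
  by apply: eq_expect => X; rewrite -natrM mulnb.
rewrite mulrAC mulrC; apply: ler_wpM2r; first exact: Pr_ge0.
apply: avoid_far.
  by apply: le_trans Delta_sigma; apply: ler_wpM2r.
move=> k kF kj; apply: IH; last by rewrite !inE; move: kj; rewrite inE => ->.
rewrite -ltnS; apply: leq_trans Fn; rewrite ltnS; apply: proper_card.
apply/properP; split; first exact: subsetDl.
by exists k => //; rewrite inE kj.
Qed.

(** By [avoid_cond] and [PA_le], each further event takes away at most half of the remaining
    probability. *)
Let avoid_gt0 (F : {set J}) : 0 < Pr (avoid F).
Proof.
elim/set_ind: F => [|j F jF IH].
  suff -> : Pr (avoid set0) = 1 by [].
  rewrite -[RHS](expect_cst p 1).
  apply: eq_expect => X; rewrite (_ : avoid _ _ = true) //.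
  by apply/forall_inP => k; rewrite inE.
have : Pr (avoid F) <= Pr (avoid (j |: F)) + Pr (fun X => A j X && avoid F X).
  rewrite /Pr -expectD; apply: le_expect => // X; rewrite -natrD ler_nat.
  have [FX|//] := boolP (avoid F X); have [AX|AX] := boolP (A j X).
    by rewrite addn1.
  rewrite (_ : avoid (j |: F) X = true) //; apply/forall_inP => k.
  by rewrite !inE => /orP[/eqP ->//|]; move/forall_inP: FX; apply.
have := avoid_cond jF; have := PA_le j; have := Pr_ge0 (A j).
by move: (Pr (fun X => _)) (Pr (avoid (_ |: _))) (Pr (A j)) IH => a b c; nra.
Qed.

(* Dropping the events near one more coin costs a factor at most 2, whence the
   factor [2 ^ #|S|] in the spreadness of the conditioned measure. *)
Let avoid_far_total (S : {set I}) :
  Pr (avoid (~: near S)) <= 2 ^+ #|S| * Pr (avoid setT).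
Proof.
elim/set_ind: S => [|i S iS IH].
  rewrite cards0 expr0 mul1r (_ : ~: near set0 = setT) //.
  by apply/setP => k; rewrite !inE negbK disjoints_subset finset.setC0 finset.subsetT.
rewrite cardsU1 iS add1n exprS -mulrA.
apply: (@le_trans _ _ (2 * Pr (avoid (~: near S)))); last by rewrite ler_pM2l.
have -> : ~: near (i |: S) = ~: near S :\: near [set i].
  apply/setP => k; rewrite !inE !negbK !disjoints_subset -subsetI.
  by rewrite -setCU.
apply: avoid_far; first by rewrite cards1 [_ * sigma]mul1r.
by move=> k _ ki; apply: avoid_cond; rewrite inE ki.
Qed.

(** The law is the product measure conditioned on avoiding all events. To bound the probability of
    containing [S], the events near [S] are dropped: what remains is independent of the coins in
    [S], and dropping them costs [2 ^+ #|S|]. *)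
Lemma local_lemma_distribution : exists mu : {set I} -> R,
  distribution_on (fun X => forall j, ~~ A j X) mu /\
  forall S : {set I}, prob mu (fun X => S \subset X) <= \prod_(i in S) (2 * p i).
Proof.
set Z := Pr (avoid setT); have Z0 : 0 < Z by exact: avoid_gt0.
pose mu (X : {set I}) := Pr (fun Y => (Y == X) && avoid setT Y) / Z.
have prob_mu (Q : {set I} -> bool) : prob mu Q = Pr (fun Y => Q Y && avoid setT Y) / Z.
  rewrite /prob -mulr_suml; congr (_ / _); rewrite /Pr -expect_sum.
  apply: eq_expect => Y.
  have [QY|QY] := boolP (Q Y).
    rewrite (bigD1 Y) //= eqxx big1 ?addr0 // => X /andP[_ XY].
    by rewrite eq_sym (negbTE XY).
  by rewrite big1 // => X QX; case: eqP => // YX; rewrite YX QX in QY.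
exists mu; split; first split.
- by move=> X; rewrite divr_ge0 ?Pr_ge0 // ltW.
- have := prob_mu xpredT; rewrite /prob => ->; rewrite divff //.
  exact: lt0r_neq0.
- move=> X; apply: contra_neqP => nA; rewrite /mu.
  rewrite (_ : Pr _ = 0) ?mul0r // /Pr -[RHS](expect_cst p 0).
  apply: eq_expect => Y; case: eqP => //= ->.
  case: (boolP (avoid setT X)) => // /forall_inP aX; case: nA => j.
  by apply: aX; rewrite inE.
move=> S; rewrite prob_mu ler_pdivrMr //.
apply: (@le_trans _ _ (Pr (fun X => (S \subset X) && avoid (~: near S) X))).
  apply: le_Pr => X /andP[-> /forall_inP h] /=; apply/forall_inP => k _.
  by apply: h; rewrite inE.
have -> : Pr (fun X => (S \subset X) && avoid (~: near S) X) =
    \prod_(i in S) p i * Pr (avoid (~: near S)).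
  have dS : depends (~: S) (avoid (~: near S)).
    by rewrite -[~: near S]setTD; apply: depends_avoid.
  rewrite /Pr -(expect_subset p S) -(@expect_indep _ _ _ S); last 2 first.
  - by move=> X Y /depends_subset ->.
  - by move=> X Y /dS ->.
  by apply: eq_expect => X; rewrite -natrM mulnb.
rewrite big_split /= prodr_const -/Z.
rewrite [X in _ <= X]mulrAC mulrC; apply: ler_wpM2r.
  by apply: prodr_ge0 => i _; case/andP: (p01 i).
exact: avoid_far_total.
Qed.

End LocalLemma.

(** * Spread distributions *)

Definition spread (R : realType) (E : finType) (Q : {set E} -> Prop) (q : R) : Prop :=
  exists p : {set E} -> R, distribution_on Q p /\
    forall S : {set E}, prob p (fun M : {set E} => S \subset M) <= q ^+ #|S|.

Lemma spread_weaken (R : realType) (E : finType) (Q Q' : {set E} -> Prop) (q q' : R) :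
  0 <= q -> q <= q' -> (forall M, Q M -> Q' M) -> spread Q q -> spread Q' q'.
Proof.
move=> q0 qq QQ [p [[p0 p1 pQ] pq]]; exists p; split.
  by split=> // M /pQ /QQ.
move=> S; apply: (le_trans (pq S)); apply: lerXn2r => //; rewrite nnegrE //.
exact: le_trans qq.
Qed.

(** The point mass at [set0]; rate 0 is correct because [0 ^+ 0 = 1]. Through [spread_union] it lets
    a deterministic choice follow a random stage without changing the rate. *)
Lemma spread_set0 (R : realType) (E : finType) (Q : {set E} -> Prop) :
  Q set0 -> spread Q (0 : R).
Proof.
move=> Q0; exists (fun M => (M == set0)%:R); split; first split.
- by move=> M; rewrite ler0n.
- by rewrite (bigD1 set0) //= eqxx big1 ?addr0 // => M M0; rewrite (negbTE M0).
- by move=> M; have [->//|_] := eqVneq M set0; rewrite mulr0n eqxx.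
move=> S; rewrite /prob big_mkcond (bigD1 set0) //= big1 ?addr0.
  rewrite eqxx finset.subset0; case: eqP => [->|_]; first by rewrite cards0 expr0.
  by rewrite expr0n; apply: ler0n.
by move=> M M0; rewrite (negbTE M0); case: ifP.
Qed.

(** The binomial theorem, indexed by which part of [S] comes from the first of two stages. *)
Lemma sum_subsets_exp (R : comPzRingType) (T : finType) (S : {set T}) (a b : R) :
  \sum_(A : {set T} | A \subset S) a ^+ #|A| * b ^+ #|S :\: A| = (a + b) ^+ #|S|.
Proof.
rewrite addrC exprDn.
rewrite (partition_big (fun A : {set T} => inord #|A| : 'I_(#|S|.+1)) predT) //=.
apply: eq_bigr => k _.
transitivity (\sum_(A in [set A : {set T} | A \subset S & #|A| == k])
  b ^+ (#|S| - k) * a ^+ k).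
  rewrite [RHS](eq_bigl (fun A : {set T} => (A \subset S) && (inord #|A| == k :> 'I_(#|S|.+1)))).
    apply: eq_bigr => A /andP[AS /eqP <-].
    by rewrite inordK ?ltnS ?subset_leq_card // cardsDS // mulrC.
  move=> A; rewrite inE; case: (boolP (A \subset S)) => //= AS.
  by rewrite -val_eqE /= inordK // ltnS subset_leq_card.
by rewrite sumr_const cards_draws.
Qed.

(** The law of [c w t] when [w] follows [mu] and then [t] follows [nu w]. The sum is restricted to
    [mu w != 0] since [nu w] is known to be a distribution only where [QW w] holds. *)
Lemma distribution_bind (R : realType) (W T U : finType) (QW : W -> Prop) (mu : W -> R)
    (QT : W -> T -> Prop) (nu : W -> T -> R) (c : W -> T -> U) (Q : U -> Prop) :
  distribution_on QW mu -> (forall w, QW w -> distribution_on (QT w) (nu w)) ->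
  (forall w t, QW w -> QT w t -> Q (c w t)) ->
  exists p : U -> R, distribution_on Q p /\
    forall e : pred U, prob p e = \sum_(w | mu w != 0) mu w * prob (nu w) (fun t => e (c w t)).
Proof.
move=> [mu0 mu1 muQ] nuP QP.
pose p u := \sum_(w | mu w != 0) mu w * prob (nu w) (fun t => c w t == u).
have pE (e : pred U) : prob p e =
    \sum_(w | mu w != 0) mu w * prob (nu w) (fun t => e (c w t)).
  rewrite /prob /p exchange_big /=; apply: eq_bigr => w _; rewrite -mulr_sumr.
  congr (_ * _); rewrite [RHS](partition_big (c w) e) //=.
  apply: eq_bigr => u eu; apply: eq_bigl => t.
  by case: eqP => [->|]; rewrite ?eu ?andbF.
have nu1 w : mu w != 0 -> \sum_t nu w t = 1 by move=> /muQ /nuP[].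
exists p; split=> //; split.
- move=> u; apply: sumr_ge0 => w w0; rewrite mulr_ge0 // sumr_ge0 // => t _.
  by case: (nuP w (muQ _ w0)).
- have := pE predT; rewrite /prob => ->.
  rewrite -mu1 [RHS](bigID (fun w => mu w != 0)) /= [X in _ = _ + X]big1 ?addr0.
    by apply: eq_bigr => w w0; rewrite nu1 ?mulr1.
  by move=> w /negPn/eqP.
- move=> u; apply: contra_neqP => nQ; rewrite /p big1 // => w w0.
  rewrite [prob _ _]big1 ?mulr0 // => t /eqP ct; apply: contra_notP nQ => /eqP nu0.
  by rewrite -ct; apply: QP; [exact: muQ | case: (nuP w (muQ _ w0)) => _ _; apply].
Qed.

Section Bind.
Variables (R : realType) (E W : finType) (QW : W -> Prop) (mu : W -> R).
Variables (m : W -> {set E}) (q1 q2 : R).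
Hypothesis muP : distribution_on QW mu.
Hypothesis mu_q1 : forall S : {set E}, prob mu (fun w => S \subset m w) <= q1 ^+ #|S|.
Hypothesis q2_ge0 : 0 <= q2.

Let sum_mu (F : W -> R) : \sum_(w | mu w != 0) mu w * F w = \sum_w mu w * F w.
Proof.
rewrite big_mkcond; apply: eq_bigr => w _.
by case: eqP => //= ->; rewrite mul0r.
Qed.

Let prob_mu (e : pred W) : prob mu e = \sum_w mu w * (e w)%:R.
Proof.
rewrite /prob big_mkcond; apply: eq_bigr => w _.
by case: (e w); rewrite ?mulr1 ?mulr0.
Qed.

Let choose_kernel (QT : W -> {set E} -> Prop) :
  (forall w, QW w -> spread (QT w) q2) -> exists nu : W -> {set E} -> R,
  forall w, QW w -> distribution_on (QT w) (nu w) /\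
     forall S : {set E}, prob (nu w) (fun M : {set E} => S \subset M) <= q2 ^+ #|S|.
Proof.
move=> h.
suff /choice[nu nuP] : forall w, exists nu : {set E} -> R, QW w ->
    distribution_on (QT w) nu /\
    forall S : {set E}, prob nu (fun M : {set E} => S \subset M) <= q2 ^+ #|S|.
  by exists nu.
move=> w; have [Qw|nQw] := pselect (QW w); last by exists (fun=> 0) => /nQw.
by have [nu nuP] := h w Qw; exists nu.
Qed.

(** If [S] lies in the union, the first stage supplies some [A \subset S] and the second must supply
    [S :\: A]. Summing [q1 ^+ #|A| * q2 ^+ #|S :\: A|] over [A] gives the power of [q1 + q2]. *)
Lemma spread_union (Q : {set E} -> Prop) :
  (forall w, QW w -> spread (fun M => Q (m w :|: M)) q2) -> spread Q (q1 + q2).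
Proof.
move=> /choose_kernel[nu nuP].
have [p [pQ pE]] := @distribution_bind _ _ _ _ QW mu _ nu (fun w M => m w :|: M) Q muP
  (fun w Qw => (nuP w Qw).1) (fun w M Qw QM => QM).
exists p; split=> // S; rewrite pE -sum_subsets_exp.
case: muP => mu0 _ muQ.
apply: (@le_trans _ _ (\sum_w mu w * \sum_(A : {set E} | A \subset S)
    (A \subset m w)%:R * q2 ^+ #|S :\: A|)).
  rewrite sum_mu; apply: ler_sum => w _.
  have [->|w0] := eqVneq (mu w) 0; first by rewrite !mul0r.
  (* For a given [w] only the term [A = S :&: m w] is kept: the second stage has to contain exactly
     the rest of [S]. *)
  apply: ler_wpM2l => //; rewrite (bigD1 (S :&: m w)) ?finset.subsetIl //=.
  rewrite finset.subsetIr mul1r -[X in X <= _]addr0; apply: lerD; last first.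
    by apply: sumr_ge0 => A _; rewrite mulr_ge0 ?ler0n ?exprn_ge0.
  rewrite setDIr finset.setDv finset.set0U.
  apply: le_trans ((nuP w (muQ _ w0)).2 _).
  rewrite le_eqVlt; apply/orP; left; apply/eqP; apply: eq_bigl => M.
  by rewrite subDset.
under eq_bigr do rewrite mulr_sumr.
rewrite exchange_big /=; apply: ler_sum => A _.
under eq_bigr do rewrite mulrA.
by rewrite -mulr_suml -prob_mu ler_wpM2r ?exprn_ge0.
Qed.

(** Since the second stage chooses inside [m w], containing [S] forces [S \subset m w] as well, so
    the two bounds multiply. *)
Lemma spread_restrict (Q : {set E} -> Prop) :
  (forall w, QW w -> spread (fun M => M \subset m w /\ Q M) q2) -> spread Q (q1 * q2).
Proof.
move=> /choose_kernel[nu nuP].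
have [p [pQ pE]] := @distribution_bind _ _ _ _ QW mu _ nu (fun w M => M) Q muP
  (fun w Qw => (nuP w Qw).1) (fun w M Qw QM => QM.2).
exists p; split=> // S; rewrite pE exprMn.
case: muP => mu0 _ muQ.
apply: (@le_trans _ _ (\sum_w mu w * ((S \subset m w)%:R * q2 ^+ #|S|))).
  rewrite sum_mu; apply: ler_sum => w _.
  have [->|w0] := eqVneq (mu w) 0; first by rewrite !mul0r.
  apply: ler_wpM2l => //; have [Sm|Sm] := boolP (S \subset m w).
    by rewrite mul1r; apply: (nuP w (muQ _ w0)).2.
  rewrite mul0r [prob _ _]big1 // => M SM; apply: contraNeq Sm => nuM.
  have [_ _ /(_ M nuM) [Mm _]] := (nuP w (muQ _ w0)).1.
  exact: fintype.subset_trans Mm.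
under eq_bigr do rewrite mulrA.
by rewrite -mulr_suml -prob_mu ler_wpM2r ?exprn_ge0.
Qed.
End Bind.

(** * Products over unions of sets *)

Lemma card_bigcup_le (I T : finType) (P : pred I) (F : I -> {set T}) :
  (#|\bigcup_(i | P i) F i| <= \sum_(i | P i) #|F i|)%N.
Proof.
elim/big_rec2: _ => [|i n A _ IH]; first by rewrite cards0.
by rewrite (leq_trans (leq_card_setU _ _)) // leq_add2l.
Qed.

Lemma card_bigcup_le_mul (R : realType) (I T : finType) (P : {set I})
    (F : I -> {set T}) (c n : R) : 0 <= c -> #|P|%:R <= n ->
  (forall i, i \in P -> #|F i|%:R <= c) ->
  #|\bigcup_(i in P) F i|%:R <= n * c.
Proof.
move=> c0 Pn Fc; apply: (@le_trans _ _ (#|P|%:R * c)); last by rewrite ler_wpM2r.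
apply: (@le_trans _ _ (\sum_(i in P) #|F i|)%:R); first by rewrite ler_nat card_bigcup_le.
by rewrite natr_sum mulr_natl -sumr_const ler_sum.
Qed.

Lemma bernoulli_ge (R : realType) (y : R) n : 0 <= y <= 1 ->
  1 - n%:R * y <= (1 - y) ^+ n.
Proof.
move=> /andP[y0 y1]; elim: n => [|n IH]; first by rewrite mul0r subr0 expr0.
rewrite exprS; have : (1 - y) * (1 - n%:R * y) <= (1 - y) * (1 - y) ^+ n.
  by rewrite ler_wpM2l // subr_ge0.
apply: le_trans; rewrite -natr1.
have n0 : 0 <= n%:R * y ^+ 2 by rewrite mulr_ge0 ?sqr_ge0.
lra.
Qed.

Lemma one_add_mul_le_exp (R : realType) (y : R) n : 0 <= y -> 1 + n%:R * y <= (1 + y) ^+ n.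
Proof.
move=> y0; elim: n => [|n IH]; first by rewrite mul0r addr0 expr0.
rewrite exprS; have : (1 + y) * (1 + n%:R * y) <= (1 + y) * (1 + y) ^+ n.
  by rewrite ler_wpM2l // addr_ge0.
apply: le_trans; rewrite -natr1.
have n0 : 0 <= n%:R * y ^+ 2 by rewrite mulr_ge0 ?sqr_ge0.
lra.
Qed.

Section ProdBigcup.
Variables (R : realType) (I V : finType) (q : I -> R) (t : V -> {set I}) (c eps : R).
Hypothesis q01 : forall i, 0 < q i <= 1.
Hypothesis eps0 : 0 <= eps.

Let q0 i : 0 < q i. Proof. by case/andP: (q01 i). Qed.
Let q1 i : q i <= 1. Proof. by case/andP: (q01 i). Qed.

Lemma prod_gt0_set (S : {set I}) : 0 < \prod_(i in S) q i.
Proof. exact: prodr_gt0. Qed.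

Lemma prod_le1_set (S : {set I}) : \prod_(i in S) q i <= 1.
Proof. by apply: prodr_ile1 => i; rewrite ltW ?q0 ?q1. Qed.

Lemma prod_setID (S T : {set I}) :
  \prod_(i in S) q i = \prod_(i in S :&: T) q i * \prod_(i in S :\: T) q i.
Proof. exact: big_setID. Qed.

Lemma prod_setU (S T : {set I}) :
  \prod_(i in S :|: T) q i = \prod_(i in T) q i * \prod_(i in S :\: T) q i.
Proof.
rewrite (prod_setID _ T) finset.setIUl finset.setIid (setUidPr _) ?finset.subsetIr //.
by rewrite setDUl finset.setDv finset.setU0.
Qed.

Lemma prod_ge_1sum (S : {set I}) : 1 - \sum_(i in S) (1 - q i) <= \prod_(i in S) q i.
Proof.
elim/set_ind: S => [|i S iS IH]; first by rewrite !big_set0 subr0.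
rewrite !big_setU1 //=.
have := prod_le1_set S; have := q0 i; have := q1 i; move: IH.
move: (\sum_(_ in S) _) (\prod_(_ in S) _) (q i) => a b z; nra.
Qed.

(** Almost independence of nearly disjoint zones. A union counts shared factors once, which gives
    the lower bound. For the upper bound, adding a zone multiplies by [c] divided by the product
    over its overlap with the earlier zones, and that product is at least [1 - n%:R * eps]. *)
Lemma prod_bigcup_bounds (W : {set V}) n : (#|W| <= n)%N -> n%:R * eps <= 1 ->
  (forall w, w \in W -> \prod_(i in t w) q i = c) ->
  (forall w w', w \in W -> w' \in W -> w != w' ->
     \sum_(i in t w :&: t w') (1 - q i) <= eps) ->
  c ^+ #|W| <= \prod_(i in \bigcup_(w in W) t w) q i /\
  \prod_(i in \bigcup_(w in W) t w) q i * (1 - n%:R * eps) ^+ #|W| <= c ^+ #|W|.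
Proof.
elim/set_ind: W => [|w W wW IH] Wn ne tc te.
  by rewrite cards0 !expr0 big_set0 big_set0 mulr1.
have [|//|||h1 h2] := IH.
- by apply: leq_trans Wn; rewrite cardsU1 wW leq_addl.
- by move=> w' w'W; apply: tc; rewrite !inE w'W orbT.
- by move=> w1 w2 h1 h2; apply: te; rewrite !inE ?h1 ?h2 orbT.
rewrite bigcup_setU big_set1 prod_setU cardsU1 wW add1n !exprS.
set T := \bigcup_(w in W) t w.
have tw : \prod_(i in t w) q i = c by apply: tc; rewrite !inE eqxx.
have c0 : 0 < c by rewrite -tw prod_gt0_set.
have p0 := prod_gt0_set T.
have pD := prod_gt0_set (t w :\: T).
have eq_c : c = \prod_(i in t w :&: T) q i * \prod_(i in t w :\: T) q i.
  by rewrite -prod_setID.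
have lo : c <= \prod_(i in t w :\: T) q i.
  by rewrite eq_c ler_piMl ?prod_le1_set // ltW.
split.
  by rewrite mulrC; apply: ler_pM => //; rewrite ?exprn_ge0 ?ltW.
have hi : 1 - n%:R * eps <= \prod_(i in t w :&: T) q i.
  apply: le_trans (prod_ge_1sum _); rewrite lerD2l lerN2.
  have sub : \sum_(i in t w :&: T) (1 - q i) <=
      \sum_(w' in W) \sum_(i in t w :&: t w') (1 - q i).
    under [X in _ <= X]eq_bigr do rewrite big_mkcond /=.
    rewrite exchange_big /= big_mkcond /=; apply: ler_sum => i _.
    have nn : forall b : bool, 0 <= (if b then 1 - q i else 0).
      by case=> //; rewrite subr_ge0 q1.
    case: ifPn => [|_]; last by apply: sumr_ge0.
    rewrite inE => /andP[iw /bigcupP[w' w'W iw']].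
    by rewrite (bigD1 w') //= inE iw iw' /= lerDl; apply: sumr_ge0.
  apply: (le_trans sub); apply: (@le_trans _ _ (\sum_(w' in W) eps)).
    apply: ler_sum => w' w'W; apply: te; rewrite ?inE ?eqxx ?w'W ?orbT //.
    by apply: contraNneq wW => ->.
  rewrite sumr_const -[eps *+ _]mulr_natl ler_wpM2r // ler_nat.
  by apply: leq_trans Wn; rewrite cardsU1 wW leq_addl.
have ne0 : 0 <= 1 - n%:R * eps by rewrite subr_ge0.
have step : \prod_(i in t w :\: T) q i * (1 - n%:R * eps) <= c.
  by rewrite eq_c mulrC ler_wpM2r // ltW.
rewrite [X in X * _]mulrC mulrACA; apply: ler_pM => //.
- by rewrite mulr_ge0 // ltW.
- by rewrite mulr_ge0 ?exprn_ge0 // ltW.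
Qed.
End ProdBigcup.

(** * One round of the nibble *)

Definition star (V E : finType) (inc : E -> {set V}) (H : {set E}) (v : V) : {set E} :=
  [set e in H | v \in inc e].

Definition cover_set (V E : finType) (inc : E -> {set V}) (M : {set E}) : {set V} :=
  \bigcup_(e in M) inc e.

Section Round.
Variables (R : realType) (V E W : finType) (inc : E -> {set V}) (r : nat).
Variables (H : {set E}) (A U : {set V}) (m : W -> V -> R).
Variables (u l theta K C DD DB : R).
Hypothesis r_gt0 : (0 < r)%N.
Hypothesis unifH : forall e, e \in H -> #|inc e| = r.
Hypothesis incU : forall e, e \in H -> inc e \subset U.
Hypothesis star_le : forall v, #|star inc H v|%:R <= u.
Hypothesis star_ge : forall a, a \in A :&: U -> l <= #|star inc H a|%:R.
Hypothesis codeg_le : forall v w, v != w -> #|star inc H v :&: star inc H w|%:R <= K.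
Hypothesis m_ge0 : forall b a, 0 <= m b a.
Hypothesis m_le : forall b a, m b a <= C.
Hypothesis m_sum : forall b, \sum_(a in A) m b a <= DD.
Hypothesis m_card : forall b, #|[set a in A | m b a != 0]|%:R <= DD.
Hypothesis m_cardW : forall a, a \in A -> #|[set b | m b a != 0]|%:R <= DB.
Hypothesis theta01 : 0 < theta < 1.
Hypothesis u_ge1 : 1 <= u.
Hypothesis K_ge0 : 0 <= K.
Hypothesis C_ge0 : 0 <= C.
Hypothesis DD_ge1 : 1 <= DD.
Hypothesis DB_ge0 : 0 <= DB.

Let st := star inc H.
Let rR : R := r%:R.
Let p0 : R := theta / u.
(* Given that no edge at [v] is selected, the coin of [v] kills it with the
   probability that makes [v] survive with probability exactly [1 - theta]. *)
Let coin (v : V) : R := 1 - (1 - theta) / (1 - p0) ^+ #|st v|.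
Let p (i : E + V) : R := match i with inl _ => p0 | inr v => coin v end.
Let zone (v : V) : {set E + V} := inr v |: [set inl e | e in st v].

Let u_gt0 : 0 < u. Proof. exact: lt_le_trans u_ge1. Qed.
Let theta0 : 0 < theta. Proof. by case/andP: theta01. Qed.
Let theta1 : theta < 1. Proof. by case/andP: theta01. Qed.
Let p0_gt0 : 0 < p0. Proof. exact: divr_gt0. Qed.
Let p0_le : p0 <= theta.
Proof. by rewrite /p0 ler_pdivrMr // ler_peMr // ltW. Qed.
Let p0_lt1 : p0 < 1. Proof. exact: le_lt_trans p0_le theta1. Qed.
Let rR_ge1 : 1 <= rR. Proof. by rewrite ler1n. Qed.

Let p0_card v : #|st v|%:R * p0 <= theta.
Proof. by rewrite mulrC /p0 mulrAC ler_pdivrMr // ler_wpM2l // ltW. Qed.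

(** Bernoulli's inequality with at most [u] edges at [v]. It is what makes the bias [coin v]
    nonnegative. *)
Let keep_pow v : 1 - theta <= (1 - p0) ^+ #|st v|.
Proof.
apply: (@le_trans _ _ (1 - #|st v|%:R * p0)); first by rewrite lerD2l lerN2.
by apply: bernoulli_ge; rewrite !ltW.
Qed.

Let pow_gt0 v : 0 < (1 - p0) ^+ #|st v|.
Proof. by rewrite exprn_gt0 // subr_gt0. Qed.

Let pow_le1 v : (1 - p0) ^+ #|st v| <= 1.
Proof. by rewrite exprn_ile1 ?gerBl ?subr_ge0 ?(ltW p0_gt0) ?(ltW p0_lt1). Qed.

Let coin_ge0 v : 0 <= coin v.
Proof. by rewrite /coin subr_ge0 ler_pdivrMr // mul1r. Qed.

Let coin_le v : coin v <= theta.
Proof.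
rewrite /coin lerBlDr -lerBlDl ler_pdivlMr //.
by rewrite ler_piMr // subr_ge0 ltW.
Qed.

Let p01 i : 0 <= p i <= 1.
Proof.
case: i => [e|v] /=; first by rewrite !ltW.
by rewrite coin_ge0 (le_trans (coin_le v)) // ltW.
Qed.

Let q01 i : 0 < 1 - p i <= 1.
Proof.
have /andP[h0 h1] := p01 i; rewrite gerBl h0 andbT subr_gt0.
by case: i {h0 h1} => [e|v] //=; apply: le_lt_trans (coin_le v) theta1.
Qed.

Let card_zone v : #|zone v|%:R <= 1 + u.
Proof.
rewrite cardsU1 natrD lerD //; first by rewrite (ler_nat _ _ 1) leq_b1.
apply: le_trans (star_le v); rewrite ler_nat; exact: leq_imset_card.
Qed.

Let big_zone (T : Type) (idx : T) (op : Monoid.com_law idx) (F : E + V -> T) v :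
  \big[op/idx]_(i in zone v) F i = op (F (inr v)) (\big[op/idx]_(e in st v) F (inl e)).
Proof.
rewrite /zone big_setU1 /=; last by apply/negP => /imsetP[].
by congr (op _ _); rewrite big_imset //= => e f _ _ [].
Qed.

Let sum_zone v : \sum_(i in zone v) p i <= 2 * theta.
Proof.
rewrite big_zone /= sumr_const -[p0 *+ _]mulr_natl (_ : 2 * theta = theta + theta); last by ring.
rewrite lerD //.
Qed.

Let prod_zone v : \prod_(i in zone v) (1 - p i) = 1 - theta.
Proof.
rewrite big_zone /= prodr_const /coin opprB addrCA subrr addr0.
by rewrite mulfVK // lt0r_neq0.
Qed.

Let zone_inl e v : (inl e \in zone v) = (e \in st v).
Proof.
rewrite !inE /=; apply/imsetP/idP => [[f fv [->]]|ev]; first by rewrite inE in fv.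
by exists e => //; rewrite inE.
Qed.

Let zone_inr w v : (inr w \in zone v) = (w == v).
Proof.
rewrite !inE; apply/orP/eqP => [[/eqP[]//|/imsetP[]//]|->]; by left.
Qed.

Let card_zone_of i : #|[set w | i \in zone w]|%:R <= rR.
Proof.
case: i => [e|v].
  have [eH|eH] := boolP (e \in H).
    rewrite /rR -(unifH eH) ler_nat; apply/subset_leq_card/fintype.subsetP => w.
    by rewrite inE zone_inl inE => /andP[].
  rewrite (_ : [set _ | _] = set0) ?cards0 ?ler0n //; apply/setP => w.
  by rewrite inE zone_inl !inE (negbTE eH).
apply: le_trans rR_ge1; rewrite (_ : [set _ | _] = [set v]) ?cards1 //.
by apply/setP => w; rewrite inE zone_inr inE eq_sym.
Qed.

(* The status of v (alive, matched or wasted) is determined by the coordinates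
   in [scope v]. *)
Let scope (v : V) : {set E + V} :=
  zone v :|: \bigcup_(e in st v) \bigcup_(w in inc e) zone w.

Let st_card_inc v e : e \in st v -> #|inc e|%:R <= rR.
Proof. by rewrite inE => /andP[eH _]; rewrite (unifH eH). Qed.

Let scope_size := (1 + u) * (1 + u * rR).

Let card_scope v : #|scope v|%:R <= scope_size.
Proof.
apply: (@le_trans _ _ (#|zone v|%:R + #|\bigcup_(e in st v) \bigcup_(w in inc e) zone w|%:R)).
  by rewrite -natrD ler_nat leq_card_setU.
have -> : scope_size = (1 + u) + u * (rR * (1 + u)) by rewrite /scope_size; ring.
have u1 : 0 <= 1 + u by rewrite addr_ge0 // ltW.
apply: lerD (card_zone v) _.
apply: card_bigcup_le_mul (star_le v) _; first by rewrite mulr_ge0 ?ler0n.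
move=> e ev; apply: card_bigcup_le_mul u1 (st_card_inc ev) _ => w _.
exact: card_zone.
Qed.

Let reach := rR * (1 + u * rR).

(** A coin lies in at most [r] zones, and the zone of [w] belongs to the scopes of [w] itself and of
    the at most [u * r] vertices on edges at [w]. *)
Let card_scope_of i : #|[set v | i \in scope v]|%:R <= reach.
Proof.
apply: (@le_trans _ _ #|\bigcup_(w in [set w | i \in zone w])
   (w |: \bigcup_(e in st w) inc e)|%:R).
  rewrite ler_nat; apply/subset_leq_card/fintype.subsetP => v; rewrite inE in_setU.
  case/orP => [iv|/bigcupP[e ev /bigcupP[w we iw]]].
    by apply/bigcupP; exists v; [rewrite inE | rewrite setU11].
  apply/bigcupP; exists w; first by rewrite inE.
  rewrite !inE; apply/orP; right; apply/bigcupP; exists e.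
    by move: ev; rewrite !inE we andbT => /andP[].
  by move: ev; rewrite inE => /andP[].
have ur0 : 0 <= u * rR by rewrite mulr_ge0 ?ler0n // ltW.
apply: card_bigcup_le_mul (card_zone_of i) _; first by rewrite addr_ge0.
move=> w _; apply: (@le_trans _ _ (1 + #|\bigcup_(e in st w) inc e|%:R)).
  by rewrite -(natrD _ 1) ler_nat cardsU1 leq_add2r leq_b1.
rewrite lerD2l; apply: card_bigcup_le_mul (ler0n _ _) (star_le w) _ => e.
exact: st_card_inc.
Qed.

Definition untouched (X : {set E + V}) v := [disjoint zone v & X].
Definition round_alive (X : {set E + V}) := [set v in U | untouched X v].
Definition round_edges (X : {set E + V}) := [set e in H | inc e \subset round_alive X].
Definition round_matching (X : {set E + V}) :=
  [set e in H | (inl e \in X) &&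
    [forall w in inc e, forall f in st w, (inl f \in X) ==> (f == e)]].

Lemma round_matching_disjoint X e f : e \in round_matching X ->
  f \in round_matching X -> e != f -> [disjoint inc e & inc f].
Proof.
rewrite !inE => /and3P[eH eX /forall_inP he] /and3P[fH fX _] ef.
apply/pred0P => w /=; apply: contraNF ef => /andP[we wf].
have /forall_inP/(_ f) := he w we; rewrite inE fH wf => /(_ isT).
by rewrite fX eq_sym.
Qed.

Lemma round_matching_touched X e v : e \in round_matching X -> v \in inc e ->
  v \notin round_alive X.
Proof.
rewrite !inE => /and3P[eH eX _] ve; apply/negP => /andP[_ /pred0P/(_ (inl e))] /=.
by rewrite zone_inl inE eH ve eX.
Qed.

(** * Degrees after one round *)

Let rho : R := (1 - theta) ^+ r.-1.
Let y : R := rR ^+ 2 * (p0 * K).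
Variables (u' l' eta_d mu_d tau : R).
Hypothesis y_lt1 : y < 1.
Hypothesis u'_ge : u * rho / (1 - y) + eta_d <= u'.
Hypothesis l'_le : l' <= l * rho - eta_d.
Hypothesis mu_d_ge0 : 0 <= mu_d.
Hypothesis mu_d_le : 2 * mu_d * (rR * K) <= 1.
Hypothesis tau_d : expR (2 * mu_d ^+ 2 * (rR * K * (u * (rR * (2 * theta)))) -
  mu_d * eta_d) <= tau.

Let others v e : {set E + V} := \bigcup_(w in inc e :\ v) zone w.
(** The zone of [v] itself is left out. For an alive [v] this is its new degree, since [zone v] is
    then missed anyway; for other [v] it is still defined. Survival of [v] is thus never conditioned
    on, and the mean is about [rho] times the degree. *)
Let degree_stat v (X : {set E + V}) : R := \sum_(e in st v) 1 * [disjoint others v e & X]%:R.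

Let card_others v e : e \in st v -> #|inc e :\ v| = r.-1.
Proof.
rewrite inE => /andP[eH ve]; rewrite -(unifH eH) (cardsD1 v (inc e)) ve.
by rewrite add1n.
Qed.

(** The [r - 1] zones of the other vertices each survive with probability [1 - theta] and overlap
    pairwise in at most [K] edges; [y] bounds the relative error caused by the overlaps. *)
Let expect_others v e : e \in st v ->
  rho <= expect p (fun X => [disjoint others v e & X]%:R) <= rho / (1 - y).
Proof.
move=> ev; rewrite expect_disjoint //.
have pK : 0 <= p0 * K by rewrite mulr_ge0 // ltW.
have rpK : 0 <= rR * (p0 * K) <= 1.
  rewrite mulr_ge0 //=; apply: le_trans (ltW y_lt1).
  by rewrite /y expr2 -mulrA ler_peMl // mulr_ge0.
have rpK1 : rR * (p0 * K) <= 1 by case/andP: rpK.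
have [|w _|w w' _ _ ww'|] := @prod_bigcup_bounds _ _ V (fun i => 1 - p i) zone
  (1 - theta) (p0 * K) q01 pK (inc e :\ v) r _ rpK1.
- by rewrite card_others // leq_pred.
- exact: prod_zone.
(* Zones of distinct vertices share only edge coins, namely those of edges through both vertices. *)
- under eq_bigr do rewrite opprB addrCA subrr addr0.
  apply: (@le_trans _ _ (\sum_(i in [set inl f | f in st w :&: st w'] : {set E + V}) p0)).
    rewrite big_mkcond [X in _ <= X]big_mkcond; apply: ler_sum => i _ /=.
    rewrite inE; case: i => [f|x].
      rewrite !zone_inl; case: ifPn => [/andP[fw fw']|_].
        by rewrite (_ : _ \in _ = true) //; apply/imset_f; rewrite inE fw.
      by case: ifP => // _; apply: ltW.
    rewrite !zone_inr; case: eqP => [->|_] /=; last by case: ifP => // _; apply: ltW.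
    by rewrite (negbTE ww'); case: ifP => // _; apply: ltW.
  rewrite sumr_const -[p0 *+ _]mulr_natl mulrC ler_wpM2l ?(ltW p0_gt0) //.
  apply: le_trans (codeg_le ww'); rewrite ler_nat; exact: leq_imset_card.
rewrite card_others // -/rho => -> h /=.
rewrite ler_pdivlMr ?subr_gt0 //; apply: le_trans h; rewrite -/(others v e).
apply: ler_wpM2l; first by rewrite ltW // prod_gt0_set.
apply: le_trans (bernoulli_ge _ rpK); rewrite lerD2l lerN2 /y expr2 -mulrA.
case/andP: rpK => rpK0 _; apply: (ler_wpM2r rpK0).
by rewrite /rR ler_nat leq_pred.
Qed.

Let expect_degree_le v : expect p (degree_stat v) <= u * rho / (1 - y).
Proof.
rewrite expect_sum -mulrA; apply: (@le_trans _ _ (\sum_(e in st v) rho / (1 - y))).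
  by apply: ler_sum => e /expect_others/andP[_]; rewrite expectZ mul1r.
rewrite sumr_const -[_ *+ _]mulr_natl ler_wpM2r // divr_ge0 ?subr_ge0 ?(ltW y_lt1) //.
by rewrite exprn_ge0 // subr_ge0 ltW.
Qed.

Let expect_degree_ge a : a \in A :&: U -> l * rho <= expect p (degree_stat a).
Proof.
move=> aAU; rewrite expect_sum; apply: (@le_trans _ _ (\sum_(e in st a) rho)).
  rewrite sumr_const -[_ *+ _]mulr_natl ler_wpM2r ?star_ge //.
  by rewrite exprn_ge0 // subr_ge0 ltW.
by apply: ler_sum => e /expect_others/andP[h _]; rewrite expectZ mul1r.
Qed.

(** The coin [i] lies in the zones of at most [r] vertices [w], and at most [K] edges at [v] pass
    through each [w != v]. The Lipschitz constant of a degree is therefore governed by codegrees and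
    not by [u]. *)
Let others_hit v i : #|[set e in st v | i \in others v e]|%:R <= rR * K.
Proof.
apply: (@le_trans _ _ #|\bigcup_(w in [set w in [set w | i \in zone w] | w != v])
   (st v :&: st w)|%:R).
  rewrite ler_nat; apply/subset_leq_card/fintype.subsetP => e; rewrite inE.
  case/andP => ev /bigcupP[w]; rewrite !inE => /andP[wv we] iw.
  apply/bigcupP; exists w; first by rewrite !inE wv iw.
  by move: ev; rewrite !inE => /andP[-> ->].
apply: card_bigcup_le_mul => //.
  apply: le_trans (card_zone_of i); rewrite ler_nat.
  by apply/subset_leq_card/fintype.subsetP => w; rewrite inE => /andP[].
by move=> w; rewrite inE eq_sym => /andP[_]; apply: codeg_le.
Qed.

Let sum_others v e : e \in st v -> \sum_(i in others v e) p i <= rR * (2 * theta).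
Proof.
move=> ev; apply: (@le_trans _ _ (\sum_(w in inc e :\ v) \sum_(i in zone w) p i)).
  under [X in _ <= X]eq_bigr do rewrite big_mkcond /=.
  rewrite exchange_big /= big_mkcond /=; apply: ler_sum => i _.
  have nn : forall b : bool, 0 <= (if b then p i else 0).
    by case=> //; case/andP: (p01 i).
  case: ifPn => [/bigcupP[w we iw]|_]; last by apply: sumr_ge0.
  by rewrite (bigD1 w) //= iw lerDl sumr_ge0.
apply: (@le_trans _ _ (\sum_(w in inc e :\ v) 2 * theta)).
  by apply: ler_sum => w _; apply: sum_zone.
rewrite sumr_const -[_ *+ _]mulr_natl ler_wpM2r ?(mulr_ge0 _ (ltW theta0)) //.
by rewrite card_others // /rR ler_nat leq_pred.
Qed.

Let rK_ge0 : 0 <= rR * K. Proof. by rewrite mulr_ge0 ?ler0n. Qed.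

Let disjoint01 (S X : {set E + V}) : 0 <= ([disjoint S & X]%:R : R) <= 1.
Proof. by rewrite ler0n lern1 leq_b1. Qed.

Let depends_disjoint (S : {set E + V}) (T : Type) (g : bool -> T) :
  depends S (fun X => g [disjoint S & X]).
Proof.
move=> X Y XY; congr (g _); rewrite ![[disjoint S & _]]disjoint_sym -!setI_eq0.
by rewrite XY.
Qed.

Let others_hit1 v i : \sum_(e in st v | i \in others v e) 1 * 1 <= rR * K.
Proof.
apply: le_trans (others_hit v i).
rewrite (eq_bigl (fun e => e \in [set e in st v | i \in others v e])).
  by rewrite sumr_const mulr1.
by move=> e; rewrite inE.
Qed.

Let others_var v :
  \sum_(e in st v) 1 * 1 * \sum_(i in others v e) p i <= u * (rR * (2 * theta)).
Proof.
apply: (@le_trans _ _ (\sum_(e in st v) rR * (2 * theta))).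
  by apply: ler_sum => e ev; rewrite !mul1r; apply: sum_others.
rewrite sumr_const -[_ *+ _]mulr_natl ler_wpM2r ?star_le //.
by rewrite !mulr_ge0 ?ler0n // ltW.
Qed.

Let degree_upper_tail v : expect p (fun X => (u' < degree_stat v X)%R%:R) <= tau.
Proof.
apply: le_trans tau_d.
have dd e : e \in st v -> depends (others v e) (fun X => [disjoint others v e & X]%:R : R).
  by move=> _ X Y XY; rewrite (depends_disjoint id XY).
have := @weighted_sum_upper_tail _ _ p p01 E (mem (st v)) (fun=> 1)
  (fun e X => [disjoint others v e & X]%:R) (others v) 1 (rR * K) (u * (rR * (2 * theta))) mu_d
  eta_d (fun _ _ => ler01) ler01 (fun e X _ => disjoint01 _ X) dd (others_hit1 v) (others_var v)
  rK_ge0 mu_d_ge0 mu_d_le _ (expect_degree_le v).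
apply: le_trans; apply: le_expect => // X; rewrite ler_nat.
case: (ltP u') => // h; rewrite (_ : (_ < _) = true) //.
exact: le_lt_trans u'_ge h.
Qed.

Let degree_lower_tail a : a \in A :&: U ->
  expect p (fun X => (degree_stat a X < l')%R%:R) <= tau.
Proof.
move=> aAU; apply: le_trans tau_d.
have dd e : e \in st a -> depends (others a e) (fun X => [disjoint others a e & X]%:R : R).
  by move=> _ X Y XY; rewrite (depends_disjoint id XY).
have := @weighted_sum_lower_tail _ _ p p01 E (mem (st a)) (fun=> 1)
  (fun e X => [disjoint others a e & X]%:R) (others a) 1 (rR * K) (u * (rR * (2 * theta))) mu_d
  eta_d (fun _ _ => ler01) ler01 (fun e X _ => disjoint01 _ X) dd (others_hit1 a) (others_var a)
  rK_ge0 mu_d_ge0 mu_d_le _ (expect_degree_ge aAU).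
apply: le_trans; apply: le_expect => // X; rewrite ler_nat.
case: (ltP _ l') => // h; rewrite (_ : (_ < _) = true) //.
exact: lt_le_trans h l'_le.
Qed.

(** * Wasted vertices and the load around [b] *)

Variables (lam lam' eta_b mu_b : R).
Hypothesis lam'_ge0 : 0 <= lam'.
Hypothesis lam'_le2 : lam' <= 2.
Hypothesis lam_ge : (rR + 2) * theta ^+ 2 + lam' * (1 - theta) <= lam.
Hypothesis l_ge : u - l <= theta * u.
Hypothesis mu_b_ge0 : 0 <= mu_b.
Hypothesis mu_b_le : 2 * mu_b * (2 * C * reach) <= 1.
Hypothesis tau_b : expR (2 * mu_b ^+ 2 * (2 * C * reach * (2 * DD * scope_size)) -
  mu_b * eta_b) <= tau.

(* A wasted vertex is charged [1] and a surviving one [lam'], the expected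
   charge it will still cause in the later rounds. *)
Let wasted X a := ~~ untouched X a && (a \notin cover_set inc (round_matching X)).
Let fate a X : R := (wasted X a)%:R + lam' * (untouched X a)%:R.

Let mem_eq (S X Y : {set E + V}) i : X :&: S = Y :&: S -> i \in S -> (i \in X) = (i \in Y).
Proof. by move=> /setP/(_ i) + iS; rewrite !inE iS !andbT. Qed.

Let zone_scope v : zone v \subset scope v. Proof. exact: finset.subsetUl. Qed.

Let depends_untouched v : depends (scope v) (fun X => untouched X v).
Proof.
apply: (depends_sub (zone_scope v)); exact: (depends_disjoint id).
Qed.

Let covered_sub a X Y : X :&: scope a = Y :&: scope a ->
  a \in cover_set inc (round_matching X) -> a \in cover_set inc (round_matching Y).
Proof.
move=> XY /bigcupP[e]; rewrite inE => /and3P[eH eX /forall_inP he] ae.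
have ea : e \in st a by rewrite inE eH.
have ia f w : w \in inc e -> f \in st w -> (inl f \in X) = (inl f \in Y).
  move=> we fw; apply: (mem_eq XY); rewrite /scope in_setU; apply/orP; right.
  by apply/bigcupP; exists e => //; apply/bigcupP; exists w => //; rewrite zone_inl.
apply/bigcupP; exists e => //; rewrite inE eH -(ia e a) // eX /=.
apply/forall_inP => w we; apply/forall_inP => f fw; rewrite -(ia f w) //.
by have /forall_inP/(_ f fw) := he w we.
Qed.

Let depends_fate a : depends (scope a) (fate a).
Proof.
move=> X Y XY; rewrite /fate /wasted (depends_untouched XY).
congr ((_ && ~~ _)%:R + _); apply/idP/idP; apply: covered_sub => //.
Qed.

Let fate02 a X : 0 <= fate a X <= 2.
Proof.
rewrite /fate /wasted; case: (untouched X a) => /=.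
  by rewrite add0r mulr1 lam'_ge0.
by rewrite mulr0 addr0 ler0n; case: (a \notin _) => //=; rewrite ler_nat.
Qed.

(** A vertex of [A] has degree at least [(1 - theta) * u], so its edges alone nearly produce the
    touching probability [theta]. Indeed [(1 - p0) ^- d >= 1 + d * p0 >= 1 + theta * (1 - theta)],
    which leaves [2 * theta ^+ 2 - theta ^+ 3] for the coin. *)
Let coin_le_sq a : a \in A :&: U -> coin a <= 2 * theta ^+ 2.
Proof.
move=> aAU; set d := #|st a|%:R : R.
have dp : theta * (1 - theta) <= d * p0.
  rewrite /p0 mulrA ler_pdivlMr // mulrAC -mulrA (mulrC d).
  rewrite ler_wpM2l ?(ltW theta0) //.
  have : l <= d by apply: star_ge.
  by move=> ld; have := l_ge; lra.
have inv : 1 + d * p0 <= ((1 - p0) ^+ #|st a|)^-1.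
  rewrite -[X in _ <= X]mul1r ler_pdivlMr //.
  have h : 1 + d * p0 <= (1 + p0) ^+ #|st a|.
    exact/one_add_mul_le_exp/ltW.
  apply: (@le_trans _ _ ((1 + p0) ^+ #|st a| * (1 - p0) ^+ #|st a|)).
    by rewrite ler_wpM2r ?(ltW (pow_gt0 a)).
  rewrite -exprMn; apply: exprn_ile1.
    by rewrite mulr_ge0 ?subr_ge0 ?(ltW p0_lt1) ?addr_ge0 ?(ltW p0_gt0).
  by have := sqr_ge0 p0; rewrite expr2; lra.
rewrite /coin; have : (1 - theta) * (1 + d * p0) <= (1 - theta) / (1 - p0) ^+ #|st a|.
  by rewrite ler_wpM2l // subr_ge0 ltW.
have : (1 - theta) * (1 + theta * (1 - theta)) <= (1 - theta) * (1 + d * p0).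
  by rewrite ler_wpM2l ?lerD2l // subr_ge0 ltW.
have := exprn_gt0 3 theta0.
have -> : (1 - theta) * (1 + theta * (1 - theta)) = 1 - 2 * theta ^+ 2 + theta ^+ 3 by ring.
lra.
Qed.

(** A wasted vertex was killed by its own coin, or lies on a selected edge [e] that did not join the
    matching because another selected edge [f] meets [e] at some [w]. *)
Let wasted_le X a : (wasted X a)%:R <= (inr a \in X)%:R +
  \sum_(e in st a) \sum_(w in inc e) \sum_(f in st w | f != e)
    ([set inl e; inl f] \subset X)%:R :> R.
Proof.
have s0 (T : Type) (s : seq T) (P : pred T) (g : T -> bool) :
    0 <= \sum_(i <- s | P i) (g i)%:R :> R.
  by apply: sumr_ge0 => i _; apply: ler0n.
have s1 (e : E) (w : V) :
    0 <= \sum_(f in st w | f != e) ([set inl e; inl f] \subset X)%:R :> R.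
  exact: s0.
have s2 (e : E) : 0 <= \sum_(w in inc e)
    \sum_(f in st w | f != e) ([set inl e; inl f] \subset X)%:R :> R.
  by apply: sumr_ge0 => w _; apply: s1.
have [/andP[/pred0Pn[i /= /andP[ia iX]] na]|_] := boolP (wasted X a); last first.
  by rewrite addr_ge0 ?ler0n // sumr_ge0 // => e _; apply: s2.
case: i ia iX => [e|v]; last first.
  by rewrite zone_inr => /eqP -> ->; rewrite lerDl sumr_ge0 // => e _; apply: s2.
rewrite zone_inl => ea eX.
have eH : e \in H by move: ea; rewrite inE => /andP[].
have : e \notin round_matching X.
  apply: contraNN na => eM; apply/bigcupP; exists e => //.
  by move: ea; rewrite inE => /andP[].
rewrite inE eH eX /= negb_forall_in => /exists_inP[w we].
rewrite negb_forall_in => /exists_inP[f fw]; rewrite negb_imply => /andP[fX fe].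
rewrite (bigD1 e) //= (bigD1 w) //= (bigD1 f) /=; last by rewrite fw fe.
rewrite (_ : [set inl e; inl f] \subset X = true); last first.
  by apply/fintype.subsetP => i; rewrite !inE => /orP[]/eqP->.
rewrite addrCA -!addrA lerDl.
rewrite !addr_ge0 ?ler0n //; last by apply: sumr_ge0 => e' _; apply: s2.
by apply: sumr_ge0 => w' _; apply: s1.
Qed.

(** At most [u * r * u] clashing pairs, each selected with probability [p0 ^+ 2], give
    [r * theta ^+ 2] as [u * p0 = theta]; the kill coin gives the other [2 * theta ^+ 2]. *)
Let expect_wasted a : a \in A :&: U ->
  expect p (fun X => (wasted X a)%:R) <= (rR + 2) * theta ^+ 2.
Proof.
move=> aAU; apply: le_trans (le_expect p01 (fun X => wasted_le X a)) _.
rewrite expectD (expect_mem p (fun b => b%:R)) /= mulr1 mulr0 addr0.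
have -> : (rR + 2) * theta ^+ 2 = 2 * theta ^+ 2 + rR * theta ^+ 2 by ring.
apply: lerD (coin_le_sq aAU) _.
have e2 e f : f != e -> expect p (fun X => ([set inl e; inl f] \subset X)%:R) = p0 ^+ 2.
  move=> fe; rewrite expect_subset big_setU1 /= ?big_set1 //.
  by rewrite in_set1; apply: contraNN fe => /eqP[] ->.
have p2 : 0 <= p0 ^+ 2 by apply: sqr_ge0.
apply: (@le_trans _ _ (\sum_(e in st a) rR * (u * p0 ^+ 2))).
  rewrite expect_sum; apply: ler_sum => e ea; rewrite expect_sum.
  apply: (@le_trans _ _ (\sum_(w in inc e) u * p0 ^+ 2)).
    apply: ler_sum => w we; rewrite expect_sum.
    rewrite (eq_bigr (fun=> p0 ^+ 2)); last by move=> f /andP[_ /e2].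
    apply: (@le_trans _ _ (\sum_(f in st w) p0 ^+ 2)).
      by rewrite big_mkcondr; apply: ler_sum => f _; case: ifP.
    by rewrite sumr_const -[_ *+ _]mulr_natl ler_wpM2r ?star_le.
  rewrite sumr_const -[_ *+ #|_|]mulr_natl ler_wpM2r ?(st_card_inc ea) //.
  by rewrite mulr_ge0 // ltW.
rewrite sumr_const -[_ *+ #|_|]mulr_natl.
apply: (@le_trans _ _ (u * (rR * (u * p0 ^+ 2)))).
  by apply: (ler_wpM2r _ (star_le a)); rewrite mulr_ge0 ?ler0n // mulr_ge0 // ltW.
have up : u * p0 = theta by rewrite /p0 mulrCA mulfV ?mulr1 // lt0r_neq0.
have -> : u * (rR * (u * p0 ^+ 2)) = rR * (u * p0) ^+ 2 by ring.
by rewrite up.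
Qed.

Let expect_fate a : a \in A :&: U -> expect p (fate a) <= lam.
Proof.
move=> aAU; apply: le_trans lam_ge; rewrite expectD expectZ.
apply: lerD (expect_wasted aAU) _; apply: ler_wpM2l => //.
by rewrite expect_disjoint prod_zone.
Qed.

Let charge b X : R := \sum_(a in A :&: U) m b a * fate a X.
Let load b : R := \sum_(a in A :&: U) m b a.

(** A coin influences the fate of at most [reach] vertices, each of weight at most [C] and fate at
    most 2. The variance proxy bounds the total coin probability in a scope crudely by the size of
    the scope. *)
Let charge_tail b :
  expect p (fun X => (lam * load b + eta_b < charge b X)%R%:R) <= tau.
Proof.
apply: le_trans tau_b.
have hc i : \sum_(a in A :&: U | i \in scope a) 2 * m b a <= 2 * C * reach.
  rewrite (eq_bigl (fun a => a \in [set a in A :&: U | i \in scope a])); last first.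
    by move=> a; rewrite inE.
  apply: (@le_trans _ _ (\sum_(a in [set a in A :&: U | i \in scope a]) 2 * C)).
    by apply: ler_sum => a _; rewrite ler_wpM2l.
  rewrite sumr_const -[_ *+ #|_|]mulr_natl mulrC ler_wpM2l ?mulr_ge0 //.
  apply: le_trans (card_scope_of i); rewrite ler_nat.
  by apply/subset_leq_card/fintype.subsetP => a; rewrite !inE => /andP[_ ->].
have ss0 : 0 <= scope_size.
  by rewrite /scope_size mulr_ge0 ?addr_ge0 ?mulr_ge0 ?ler0n // ltW.
have rc0 : 0 <= reach by rewrite /reach mulr_ge0 ?addr_ge0 ?mulr_ge0 ?ler0n // ltW.
have hv : \sum_(a in A :&: U) 2 * m b a * \sum_(i in scope a) p i <= 2 * DD * scope_size.
  apply: (@le_trans _ _ (\sum_(a in A :&: U) 2 * m b a * scope_size)).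
    apply: ler_sum => a _; apply: ler_wpM2l; first by rewrite mulr_ge0.
    apply: le_trans (card_scope a); rewrite -sum1_card natr_sum.
    by apply: ler_sum => i _; case/andP: (p01 i).
  rewrite -mulr_suml -mulr_sumr ler_wpM2r // ler_wpM2l //.
  apply: le_trans (m_sum b); rewrite [X in X <= _]big_mkcond [X in _ <= X]big_mkcond /=.
  apply: ler_sum => a _; rewrite inE; case: (a \in A) => //=.
  by case: ifP.
have Fm : expect p (charge b) <= lam * load b.
  rewrite expect_sum /load mulr_sumr; apply: ler_sum => a aAU.
  by rewrite expectZ mulrC ler_wpM2r ?expect_fate.
apply: (@weighted_sum_upper_tail _ _ p p01 V (mem (A :&: U)) (m b) fate scope 2
  (2 * C * reach) (2 * DD * scope_size) mu_b eta_b) => //.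
by apply: (mulr_ge0 _ rc0); apply: mulr_ge0.
Qed.

(** * The bad events of a round *)

Hypothesis DB_tau : DD * scope_size * (reach * (1 + DB) * (2 * tau)) <= 1 / 4.

Let event (j : V + W) X : bool :=
  match j with
  | inl v => (u' < degree_stat v X) || (v \in A :&: U) && (degree_stat v X < l')
  | inr b => lam * load b + eta_b < charge b X
  end.

(** For [b] only vertices of nonzero weight are read, so the scope is bounded through [m_card]
    whatever the size of [A]. *)
Let event_scope (j : V + W) : {set E + V} :=
  match j with
  | inl v => scope v
  | inr b => \bigcup_(a in [set a in A :&: U | m b a != 0]) scope a
  end.

Hypothesis u'_ge0 : 0 <= u'.

Let depends_degree v : depends (scope v) (degree_stat v).
Proof.
move=> X Y XY; apply: eq_bigr => e ev; congr (_ * _%:R); congr nat_of_bool.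
have sub : others v e \subset scope v.
  apply: fintype.subset_trans (finset.subsetUr _ _).
  apply: fintype.subset_trans (bigcup_sup e ev); apply/bigcupsP => w.
  by rewrite !inE => /andP[_ we]; apply: (bigcup_sup w we).
have d := @depends_sub _ _ _ _ _ sub (@depends_disjoint (others v e) _ id).
exact: d XY.
Qed.

Let depends_event j : depends (event_scope j) (event j).
Proof.
case: j => [v|b] X Y XY /=; first by rewrite (depends_degree XY).
congr (_ < _); apply: eq_bigr => a aAU.
have [->|mba] := eqVneq (m b a) 0; first by rewrite !mul0r.
have sub : scope a \subset event_scope (inr b).
  by apply: (bigcup_sup a); rewrite inE aAU.
by rewrite (depends_sub sub (@depends_fate a) XY).
Qed.

Let tau_ge0 : 0 <= tau. Proof. exact: le_trans (expR_ge0 _) tau_d. Qed.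

Let event_le j : expect p (fun X => (event j X)%:R) <= 2 * tau.
Proof.
case: j => [v|b] /=; last first.
  by apply: le_trans (charge_tail b) _; rewrite ler_peMl // ler1n.
have [vAU|vAU] := boolP (v \in A :&: U); last first.
  apply: (@le_trans _ _ tau); last by rewrite ler_peMl // ler1n.
  apply: le_trans (degree_upper_tail v); apply: le_expect => // X.
  by rewrite /= orbF.
have -> : 2 * tau = tau + tau by ring.
apply: le_trans (lerD (degree_upper_tail v) (degree_lower_tail vAU)).
rewrite -expectD; apply: le_expect => // X; rewrite /= -natrD ler_nat.
by case: (_ < _); case: (_ < _).
Qed.

Let scope_size_ge1 : 1 <= scope_size.
Proof.
rewrite /scope_size; apply: mulr_ege1; first by rewrite lerDl ltW.
by rewrite lerDl mulr_ge0 ?ler0n // ltW.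
Qed.

Let card_event_scope j : #|event_scope j|%:R <= DD * scope_size.
Proof.
case: j => [v|b] /=.
  by apply: le_trans (card_scope v) _; rewrite ler_peMl // (le_trans ler01).
apply: card_bigcup_le_mul.
- exact: le_trans scope_size_ge1.
- apply: le_trans (m_card b); rewrite ler_nat; apply/subset_leq_card/fintype.subsetP => a.
  by rewrite !inE => /andP[/andP[-> _]].
- by move=> a _; apply: card_scope.
Qed.

(** The coin [i] lies in the scopes of at most [reach] vertices; each of them gives one degree event
    and, if it is in [A], at most [DB] load events. *)
Let event_sum i :
  \sum_(j | i \in event_scope j) expect p (fun X => (event j X)%:R) <=
  reach * (1 + DB) * (2 * tau).
Proof.
apply: (@le_trans _ _ (\sum_(j in [set j | i \in event_scope j]) 2 * tau)).
  rewrite [X in _ <= X](eq_bigl (fun j => i \in event_scope j)); last first.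
    by move=> j; rewrite inE.
  by apply: ler_sum => j _; apply: event_le.
rewrite sumr_const -[_ *+ #|_|]mulr_natl ler_wpM2r ?mulr_ge0 //.
set S := [set v | i \in scope v].
pose T := \bigcup_(a in S :&: A) [set b | m b a != 0].
apply: (@le_trans _ _ (#|[set (inl v : V + W) | v in S]|%:R +
    #|[set (inr b : V + W) | b in T]|%:R)).
  rewrite -natrD ler_nat; apply: leq_trans (leq_card_setU _ _).
  apply/subset_leq_card/fintype.subsetP => j; rewrite !inE; case: j => [v|b] /=.
    by move=> iv; apply/orP; left; apply/imset_f; rewrite inE.
  move=> /bigcupP[a]; rewrite !inE => /andP[/andP[aA _] mba] ia.
  apply/orP; right; apply/imset_f; apply/bigcupP; exists a; last by rewrite inE.
  by rewrite !inE ia.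
rewrite mulrDr mulr1 lerD //.
  by apply: le_trans (card_scope_of i); rewrite ler_nat leq_imset_card.
apply: (@le_trans _ _ #|T|%:R); first by rewrite ler_nat leq_imset_card.
apply: card_bigcup_le_mul => //.
  apply: le_trans (card_scope_of i); rewrite ler_nat.
  by apply/subset_leq_card/finset.subsetIl.
by move=> a; rewrite inE => /andP[_ aA]; apply: m_cardW.
Qed.

(** The local lemma applied to the degree and load events. For the rate only the edge coins count,
    because every edge of the round's matching was selected. *)
Lemma nibble_round : exists mu : {set E + V} -> R,
  distribution_on (fun X =>
    [/\ forall v, #|star inc (round_edges X) v|%:R <= u',
        forall a, a \in A :&: round_alive X -> l' <= #|star inc (round_edges X) a|%:R
      & forall b, \sum_(a in (A :&: U) :\:
            (round_alive X :|: cover_set inc (round_matching X))) m b a +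
          lam' * \sum_(a in A :&: round_alive X) m b a <=
          lam * \sum_(a in A :&: U) m b a + eta_b]) mu /\
  forall S : {set E}, prob mu (fun X => S \subset round_matching X) <=
    (2 * (theta / u)) ^+ #|S|.
Proof.
have Dsigma := DB_tau.
set sigma := reach * (1 + DB) * (2 * tau) in Dsigma.
have tau2 : 0 <= 2 * tau by rewrite mulr_ge0.
have reach1 : 1 <= reach.
  rewrite /reach; apply: mulr_ege1 => //.
  by rewrite lerDl mulr_ge0 ?ler0n // ltW.
have sigma0 : 0 <= sigma.
  by rewrite /sigma mulr_ge0 // mulr_ge0 ?addr_ge0 // (le_trans ler01).
have sigma4 : sigma <= 1 / 4.
  apply: le_trans Dsigma; rewrite ler_peMl //; exact: mulr_ege1.
have PA4 j : expect p (fun X => (event j X)%:R) <= 1 / 4.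
  apply: le_trans (event_le j) _; apply: le_trans sigma4.
  by rewrite /sigma ler_peMl // mulr_ege1 // lerDl.
have [mu [[mu0 mu1 muP] muS]] := local_lemma_distribution p01 depends_event
  card_event_scope event_sum PA4 sigma0 sigma4 Dsigma.
exists mu; split; last first.
  move=> S; apply: (@le_trans _ _
    (prob mu (fun X : {set E + V} => [set inl e | e in S] \subset X))).
    rewrite /prob [X in X <= _]big_mkcond [X in _ <= X]big_mkcond /=.
    apply: ler_sum => X _; case: ifPn => [/fintype.subsetP SX|_]; last by case: ifP.
    rewrite ifT //; apply/fintype.subsetP => _ /imsetP[e eS ->].
    by have := SX e eS; rewrite inE => /and3P[].
  apply: le_trans (muS _) _; rewrite big_imset /=; last by move=> e f _ _ [].
  by rewrite prodr_const.
split=> // X /muP nX.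
(* For an alive [v], an edge at [v] survives exactly when the zones of its other vertices are
   missed. *)
have deg v : v \in round_alive X -> #|star inc (round_edges X) v|%:R = degree_stat v X.
  rewrite inE => /andP[vU vX].
  rewrite /degree_stat; under eq_bigr do rewrite mul1r.
  rewrite -natr_sum -big_mkcondr /= sum1_card; congr (_%:R); apply: eq_card => e.
  rewrite [RHS]unfold_in /= !inE.
  case: (boolP (e \in H)) => //= eH; case: (boolP (v \in inc e)) => ve; rewrite ?andbF //=.
  rewrite andbT; apply/idP/idP => [/fintype.subsetP h|h].
    apply/pred0P => i /=; apply/negP => /andP[/bigcupP[w]]; rewrite in_setD1 => /andP[_ we] iw iX.
    by have := h w we; rewrite inE => /andP[_ /disjointFr /(_ iw)]; rewrite iX.
  apply/fintype.subsetP => w we; rewrite inE (fintype.subsetP (incU eH)) //=.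
  have [->//|wv] := eqVneq w v.
  by apply: disjointWl h; apply: bigcup_sup; rewrite !inE wv.
split.
- move=> v; have [vX|vX] := boolP (v \in round_alive X).
    by rewrite deg //; have := nX (inl v); rewrite negb_or -leNgt => /andP[].
  rewrite (_ : star _ _ _ = set0) ?cards0 //; apply/setP => e; rewrite !inE.
  apply/negP => /andP[/andP[_ /fintype.subsetP h] /h]; exact/negP.
- move=> a; rewrite inE => /andP[aA aX]; rewrite deg //.
  have := nX (inl a); rewrite negb_or => /andP[_]; rewrite inE aA /=.
  by move: (aX); rewrite inE => /andP[-> _] /=; rewrite -leNgt.
- move=> b; have := nX (inr b); rewrite /= -leNgt; apply: le_trans.
  rewrite /charge /fate; under [X in _ <= X]eq_bigr do rewrite mulrDr.
  have mul01 (x : R) (c : bool) : x * c%:R = if c then x else 0.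
    by case: c; rewrite ?mulr1 ?mulr0.
  rewrite big_split /= lerD //.
    rewrite le_eqVlt; apply/orP; left; apply/eqP.
    rewrite big_mkcond [RHS]big_mkcond /=; apply: eq_bigr => a _.
    rewrite mul01 !inE /wasted; case: (boolP (a \in A)) => aA; rewrite ?andbF //=.
    case: (boolP (a \in U)) => aU; rewrite ?andbF //= andbT negb_or.
    by case: ifP.
  rewrite mulr_sumr le_eqVlt; apply/orP; left; apply/eqP.
  rewrite big_mkcond [RHS]big_mkcond /=; apply: eq_bigr => a _.
  rewrite mulrCA mul01 !inE; case: (boolP (a \in A)) => aA //=.
  by case: (boolP (a \in U)) => aU //=; case: ifP => //; rewrite mulr0.
Qed.
End Round.

(** * Iterating the nibble *)

Definition pairwise_disjoint (V E : finType) (inc : E -> {set V}) (M : {set E}) : Prop :=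
  forall e f, e \in M -> f \in M -> e != f -> [disjoint inc e & inc f].

Lemma cover_setU (V E : finType) (inc : E -> {set V}) (M N : {set E}) :
  cover_set inc (M :|: N) = cover_set inc M :|: cover_set inc N.
Proof. exact: bigcup_setU. Qed.

Lemma sum_subset_le (R : realType) (V : finType) (S T : {set V}) (f : V -> R) :
  (forall v, 0 <= f v) -> S \subset T -> \sum_(v in S) f v <= \sum_(v in T) f v.
Proof.
move=> f0 /fintype.subsetP ST; rewrite big_mkcond [X in _ <= X]big_mkcond /=.
by apply: ler_sum => v _; case: ifPn => [/ST ->//|_]; case: ifP.
Qed.

Lemma sum_setU_le (R : realType) (V : finType) (S T : {set V}) (f : V -> R) :
  (forall v, 0 <= f v) ->
  \sum_(v in S :|: T) f v <= \sum_(v in S) f v + \sum_(v in T) f v.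
Proof.
move=> f0; rewrite big_mkcond [X in _ <= X + _]big_mkcond [X in _ <= _ + X]big_mkcond /=.
rewrite -big_split; apply: ler_sum => v _ /=; rewrite in_setU.
by case: (v \in S); case: (v \in T); rewrite /= ?addr0 ?add0r // lerDl.
Qed.

Section Nibble.
Variables (R : realType) (V E W : finType) (inc : E -> {set V}) (r : nat).
Variables (A : {set V}) (m : W -> V -> R) (theta K C DD DB : R).
Variables (us ls lams : nat -> R) (eta_d mu_d eta_b mu_b tau q : R) (T : nat).
Let rR : R := r%:R.
Hypothesis r_gt0 : (0 < r)%N.
Hypothesis m_ge0 : forall b a, 0 <= m b a.
Hypothesis m_le : forall b a, m b a <= C.
Hypothesis m_sum : forall b, \sum_(a in A) m b a <= DD.
Hypothesis m_card : forall b, #|[set a in A | m b a != 0]|%:R <= DD.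
Hypothesis m_cardW : forall a, a \in A -> #|[set b | m b a != 0]|%:R <= DB.
Hypothesis theta01 : 0 < theta < 1.
Hypothesis K_ge0 : 0 <= K.
Hypothesis C_ge0 : 0 <= C.
Hypothesis DD_ge1 : 1 <= DD.
Hypothesis DB_ge0 : 0 <= DB.
Hypothesis us_ge1 : forall i, (i <= T)%N -> 1 <= us i.
Hypothesis us_K : forall i, (i < T)%N -> rR ^+ 2 * (theta / us i * K) < 1.
Hypothesis usS : forall i, (i < T)%N ->
  us i * (1 - theta) ^+ r.-1 / (1 - rR ^+ 2 * (theta / us i * K)) + eta_d <= us i.+1.
Hypothesis lsS : forall i, (i < T)%N -> ls i.+1 <= ls i * (1 - theta) ^+ r.-1 - eta_d.
Hypothesis ls_us : forall i, (i < T)%N -> us i - ls i <= theta * us i.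
Hypothesis mu_d_ge0 : 0 <= mu_d.
Hypothesis mu_d_le : 2 * mu_d * (rR * K) <= 1.
Hypothesis tau_d : forall i, (i < T)%N ->
  expR (2 * mu_d ^+ 2 * (rR * K * (us i * (rR * (2 * theta)))) - mu_d * eta_d) <= tau.
Hypothesis lams_ge0 : forall i, (i <= T)%N -> 0 <= lams i <= 2.
Hypothesis lamsS : forall i, (i < T)%N ->
  (rR + 2) * theta ^+ 2 + lams i.+1 * (1 - theta) <= lams i.
Hypothesis lamsT : 1 <= lams T.
Hypothesis mu_b_ge0 : 0 <= mu_b.
Hypothesis mu_b_le : forall i, (i < T)%N ->
  2 * mu_b * (2 * C * (rR * (1 + us i * rR))) <= 1.
Hypothesis tau_b : forall i, (i < T)%N ->
  expR (2 * mu_b ^+ 2 * (2 * C * (rR * (1 + us i * rR)) *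
    (2 * DD * ((1 + us i) * (1 + us i * rR)))) - mu_b * eta_b) <= tau.
Hypothesis DB_tau : forall i, (i < T)%N -> DD * ((1 + us i) * (1 + us i * rR)) *
  (rR * (1 + us i * rR) * (1 + DB) * (2 * tau)) <= 1 / 4.
Hypothesis q_ge0 : 0 <= q.
Hypothesis q_ge : forall i, (i < T)%N -> 2 * (theta / us i) <= q.

(* [budget b] accounts for the load already wasted around [b]: each round moves
   the realised waste out of it and adds the error term [eta_b]. *)
Lemma nibble n i (H : {set E}) (U : {set V}) (budget : W -> R) : (i + n)%N = T ->
  (forall e, e \in H -> #|inc e| = r) ->
  (forall e, e \in H -> inc e \subset U) ->
  (forall v, #|star inc H v|%:R <= us i) ->
  (forall a, a \in A :&: U -> ls i <= #|star inc H a|%:R) ->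
  (forall v w, v != w -> #|star inc H v :&: star inc H w|%:R <= K) ->
  (forall b, lams i * \sum_(a in A :&: U) m b a <= budget b) ->
  spread (fun M => [/\ M \subset H, pairwise_disjoint inc M &
    forall b, \sum_(a in (A :&: U) :\: cover_set inc M) m b a <=
      budget b + n%:R * eta_b]) (n%:R * q).
Proof.
elim: n i H U budget => [|n IH] i H U budget inT unifH incU st_le st_ge cod bud.
  rewrite addn0 in inT; have -> : 0%:R * q = 0 by rewrite mul0r.
  apply: spread_set0; split.
  - exact: finset.sub0set.
  - by move=> e f; rewrite inE.
  (* When the rounds are over, every vertex still alive counts as unmatched; [lamsT] ensures that
     the budget covers it in full. *)
  move=> b; rewrite mul0r addr0; apply: le_trans (bud b).
  rewrite inT; apply: (@le_trans _ _ (\sum_(a in A :&: U) m b a)).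
    by apply: sum_subset_le => //; apply: finset.subsetDl.
  by rewrite ler_peMl // sumr_ge0.
have iT : (i < T)%N by rewrite -inT -addSnnS leq_addr.
have iT' : (i <= T)%N by apply: ltnW.
have /andP[lam0 lam2] := lams_ge0 iT.
have u'0 : 0 <= us i.+1 by apply: le_trans ler01 (us_ge1 iT).
have [mu [muQ muS]] := nibble_round r_gt0 unifH incU st_le st_ge cod m_ge0 m_le m_sum
  m_card m_cardW theta01 (us_ge1 iT') K_ge0 C_ge0 DD_ge1 DB_ge0 (us_K iT) (usS iT)
  (lsS iT) mu_d_ge0 mu_d_le (tau_d iT) lam0 lam2 (lamsS iT) (ls_us iT) mu_b_ge0
  (mu_b_le iT) (tau_b iT) (DB_tau iT) u'0.
have -> : n.+1%:R * q = q + n%:R * q by rewrite -natr1; ring.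
apply: (spread_union muQ (m := round_matching inc H)).
- move=> S; apply: le_trans (muS S) _; apply: lerXn2r; rewrite ?nnegrE ?q_ge //.
  rewrite mulr_ge0 // divr_ge0 //; first by case/andP: theta01 => /ltW.
  exact: le_trans ler01 (us_ge1 iT').
- by rewrite mulr_ge0.
move=> X [du dl charge].
set U' := round_alive inc H U X; set M0 := round_matching inc H X.
set H' := round_edges inc H U X.
pose waste b := \sum_(a in (A :&: U) :\: (U' :|: cover_set inc M0)) m b a.
have HH' : H' \subset H by apply/fintype.subsetP => e; rewrite inE => /andP[].
have stH v : star inc H' v \subset star inc H v.
  by apply/fintype.subsetP => e; rewrite !inE => /andP[/andP[-> _] ->].
apply: (spread_weaken _ (lexx _)); last first.
- apply: (IH i.+1 H' U' (fun b => budget b + eta_b - waste b)).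
  + by rewrite addSnnS.
  + by move=> e /(fintype.subsetP HH'); apply: unifH.
  + by move=> e; rewrite inE => /andP[].
  + exact: du.
  + exact: dl.
  + move=> v w vw; apply: le_trans (cod v w vw); rewrite ler_nat.
    by apply/subset_leq_card/finset.setISS.
  + move=> b; have := charge b; have := bud b; rewrite -/(waste b); lra.
- move=> M [MH' Mdis Mb]; split.
  + rewrite finset.subUset (fintype.subset_trans MH' HH') andbT.
    by apply/fintype.subsetP => e; rewrite inE => /andP[].
  (* Edges matched in this round consist of touched vertices, while later edges live on the alive
     set. *)
  + have cross e f : e \in M0 -> f \in M -> [disjoint inc e & inc f].
      move=> eM0 /(fintype.subsetP MH'); rewrite inE => /andP[_ /fintype.subsetP fU].
      apply/pred0P => w /=; apply/negP => /andP[we /fU].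
      by apply/negP/(round_matching_touched U eM0 we).
    move=> e f; rewrite !in_setU => /orP[eM|eM] /orP[fM|fM] ef.
    * exact: round_matching_disjoint eM fM ef.
    * exact: cross.
    * by rewrite disjoint_sym; apply: cross.
    * exact: Mdis.
  + move=> b; have := Mb b; rewrite -natr1.
    suff : \sum_(a in (A :&: U) :\: cover_set inc (M0 :|: M)) m b a <=
      waste b + \sum_(a in (A :&: U') :\: cover_set inc M) m b a by lra.
    apply: le_trans (sum_setU_le _ _ _) => //; apply: sum_subset_le => //.
    apply/fintype.subsetP => a; rewrite cover_setU !in_setD !in_setU !in_setI !negb_or.
    rewrite !in_setD !in_setU !in_setI; case/andP => /andP[a1 a2] /andP[-> ->]; rewrite a2 /=.
    by rewrite andbT negb_or a1 andbT orNb.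
- by rewrite mulr_ge0.
Qed.
End Nibble.

(** * Covering the leftover vertices *)

Section BipartiteCover.
Variables (R : realType) (V E : finType) (inc : E -> {set V}) (r : nat).
Variables (F : {set E}) (A L : {set V}) (psi delta N Lam : R).
Hypothesis LA : L \subset A.
Hypothesis unifF : forall e, e \in F -> #|inc e| = r.
Hypothesis incA : forall e, e \in F -> #|inc e :&: A| = 1%N.
Hypothesis psi01 : 0 <= psi <= 1.
Hypothesis star_delta : forall a, a \in L -> (1 - psi) ^+ #|star inc F a| <= delta.
Hypothesis star_N : forall a, a \in L -> #|star inc F a|%:R <= N.

Let FL : {set E} := [set e in F | ~~ [disjoint inc e & L]].

Hypothesis star_Lam : forall b, b \notin A -> #|star inc FL b|%:R <= Lam.
Hypothesis N_ge2 : 2 <= N.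

Let rR : R := r%:R.
Let sigma := delta + 2 * (rR * Lam) * psi ^+ 2.
Hypothesis N_sigma : N * sigma <= 1 / 4.
Hypothesis delta_ge0 : 0 <= delta.
Hypothesis Lam_ge0 : 0 <= Lam.

Let p (e : E) : R := psi.
Let p01 (e : E) : 0 <= p e <= 1. Proof. exact: psi01. Qed.

(** Two edges with the same trace on [A] are not a clash: one of them is picked afterwards. A clash
    must then occur outside [A], where at most [Lam] edges of [FL] meet a vertex; counting edges at
    a common vertex of [A] would bring in the much larger [N]. *)
Let clash e f := [&& e \in FL, f \in FL, ~~ [disjoint inc e & inc f] &
  inc e :&: A != inc f :&: A].

Let event (j : V + E * E) (X : {set E}) : bool :=
  match j with
  | inl a => (a \in L) && [disjoint star inc F a & X]
  | inr (e, f) => clash e f && ([set e; f] \subset X)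
  end.

Let event_scope (j : V + E * E) : {set E} :=
  match j with
  | inl a => if a \in L then star inc F a else set0
  | inr (e, f) => [set e; f]
  end.

Let depends_event j : depends (event_scope j) (event j).
Proof.
case: j => [a|[e f]] X Y XY /=.
  move: XY; rewrite /=; case: ifP => //= _ XY.
  by rewrite ![[disjoint star _ _ _ & _]]disjoint_sym -!setI_eq0 XY.
by rewrite (depends_subset XY).
Qed.

Let card_event_scope j : #|event_scope j|%:R <= N.
Proof.
case: j => [a|[e f]] /=.
  case: ifP => [/star_N //|_]; rewrite cards0; apply: le_trans N_ge2.
  exact: ler0n.
apply: le_trans N_ge2; rewrite (ler_nat R _ 2) cards2.
by case: (e != f).
Qed.

Let P j := expect p (fun X => (event j X)%:R).

Let P_inl a : P (inl a) <= (a \in L)%:R * delta.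
Proof.
rewrite /P /=; case: (boolP (a \in L)) => aL; last first.
  by rewrite /= mul0r -[X in _ <= X](expect_cst p 0); apply: le_expect.
by rewrite mul1r /= expect_disjoint /p prodr_const; apply: star_delta.
Qed.

Let clash_neq e f : clash e f -> e != f.
Proof. by case/and4P => _ _ _; apply: contraNneq => ->. Qed.

Let P_inr e f : P (inr (e, f)) = (clash e f)%:R * psi ^+ 2.
Proof.
rewrite /P /=; case: (boolP (clash e f)) => ef; last first.
  by rewrite /= mul0r -[RHS](expect_cst p 0); apply: eq_expect.
rewrite /= expect_subset big_setU1 /= ?big_set1 ?mul1r //.
by rewrite inE clash_neq.
Qed.

Let incA1 e a a' : e \in F -> a \in inc e -> a \in A -> a' \in inc e -> a' \in A -> a = a'.
Proof.
move=> /incA/eqP/cards1P[x ex] ae aA ae' aA'.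
have : a \in inc e :&: A by rewrite inE ae.
have : a' \in inc e :&: A by rewrite inE ae'.
by rewrite ex !inE => /eqP-> /eqP->.
Qed.

Let clash_sym e f : clash e f = clash f e.
Proof. by rewrite /clash andbCA disjoint_sym [in RHS]eq_sym. Qed.

(** A common vertex in [A] would be the whole trace of both edges, so clashing edges share one of at
    most [r] vertices outside [A]. *)
Let card_clash e : #|[set f | clash e f]|%:R <= rR * Lam.
Proof.
have [eF|eF] := boolP (e \in FL); last first.
  rewrite (_ : [set f | _] = set0) ?cards0 ?mulr_ge0 ?ler0n //.
  by apply/setP => f; rewrite !inE /clash (negbTE eF).
have eF0 : e \in F by move: eF; rewrite inE => /andP[].
apply: (@le_trans _ _ #|\bigcup_(b in inc e :\: A) star inc FL b|%:R).
  rewrite ler_nat; apply/subset_leq_card/fintype.subsetP => f; rewrite inE.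
  case/and4P => _ fF /pred0Pn[b /= /andP[be bf]] ef; have fF0 : f \in F.
    by move: fF; rewrite inE => /andP[].
  apply/bigcupP; exists b; last by rewrite inE fF.
  rewrite inE be andbT; apply: contraNN ef => bA; apply/eqP/setP => x; rewrite !inE.
  case: (boolP (x \in A)) => xA; rewrite ?andbF // !andbT.
  by apply/idP/idP => xe; [rewrite (incA1 eF0 xe xA be bA) | rewrite (incA1 fF0 xe xA bf bA)].
apply: card_bigcup_le_mul => //; last by move=> b; rewrite inE => /andP[/star_Lam].
rewrite /rR -(unifF eF0) ler_nat; apply/subset_leq_card/finset.subsetDl.
Qed.

(** The edge [e] has a single vertex in [A], whence one [delta]; each clash of [e] is listed as two
    ordered pairs, whence the factor 2. *)
Let event_sum e : \sum_(j | e \in event_scope j) P j <= sigma.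
Proof.
rewrite big_sumType /= /sigma; apply: lerD.
  apply: (@le_trans _ _ (\sum_(a in [set a in inc e :&: A | e \in F]) delta)).
    rewrite big_mkcond [X in _ <= X]big_mkcond /=; apply: ler_sum => a _.
    have [aL|aL] := boolP (a \in L); last by rewrite in_set0; case: ifP.
    case: ifPn => [|_]; last by case: ifP.
    move=> ea; have /andP[eF ae] : (e \in F) && (a \in inc e) by move: ea; rewrite inE.
    rewrite !inE ae (fintype.subsetP LA _ aL) eF /=.
    by apply: le_trans (P_inl a) _; rewrite aL mul1r.
  rewrite sumr_const; have [eF|eF] := boolP (e \in F); last first.
    rewrite (_ : [set a in _ | _] = set0) ?cards0 ?mulr0n //.
    by apply/setP => a; rewrite !inE andbF.
  rewrite (_ : [set a in _ | _] = inc e :&: A) ?incA //.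
  by apply/setP => a; rewrite !inE andbT.
apply: (@le_trans _ _ (\sum_(j in [set (e, f) | f in [set f | clash e f]] :|:
    [set (f, e) | f in [set f | clash e f]]) psi ^+ 2)).
  rewrite big_mkcond [X in _ <= X]big_mkcond /=; apply: ler_sum => -[f g] _.
  rewrite P_inr !inE; case: (boolP (clash f g)) => fg; last first.
    by rewrite mul0r; do 2 case: ifP => _ //; apply: sqr_ge0.
  rewrite mul1r; case: ifPn => [/orP[]/eqP ee|_]; last by case: ifP => // _; apply: sqr_ge0.
    rewrite ifT //; apply/orP; left; apply/imsetP; exists g; rewrite ?inE ee //.
  rewrite ifT //; apply/orP; right; apply/imsetP; exists f; rewrite ?inE ee //.
  by rewrite clash_sym.
rewrite sumr_const -[_ *+ #|_|]mulr_natl ler_wpM2r ?sqr_ge0 //.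
apply: (@le_trans _ _ (#|[set f | clash e f]|%:R + #|[set f | clash e f]|%:R)).
  rewrite -natrD ler_nat; apply: leq_trans (leq_card_setU _ _) _.
  by apply: leq_add; apply: leq_imset_card.
by have := card_clash e; lra.
Qed.

(** The local lemma yields a clash-free random set [X] with an edge at every vertex of [L]. Keeping
    one edge per vertex is a deterministic thinning of [X], so the rate stays [2 * psi]. *)
Lemma bipartite_cover : spread (fun M => [/\ M \subset FL, pairwise_disjoint inc M &
  L \subset cover_set inc M]) (2 * psi).
Proof.
have N0 : 0 <= N by apply: le_trans N_ge2.
have psi0 : 0 <= psi by case/andP: psi01.
have sigma0 : 0 <= sigma.
  by rewrite /sigma addr_ge0 // !mulr_ge0 ?sqr_ge0 ?ler0n.
have sigma4 : sigma <= 1 / 4.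
  apply: le_trans N_sigma; rewrite ler_peMl //; apply: le_trans N_ge2.
  by rewrite (ler_nat R 1 2).
have P_ge0 j : 0 <= P j by apply: expect_ge0 => // X; apply: ler0n.
have P4 j : P j <= 1 / 4.
  apply: le_trans sigma4; case: j => [a|[e f]].
    apply: le_trans (P_inl a) _; apply: (@le_trans _ _ delta).
      by case: (a \in L); rewrite ?mul1r ?mul0r.
    by rewrite /sigma lerDl !mulr_ge0 ?sqr_ge0 ?ler0n.
  apply: le_trans (event_sum e); rewrite (bigD1 (inr (e, f))) /= ?inE ?eqxx //.
  by rewrite lerDl sumr_ge0.
have [mu [muQ muS]] := local_lemma_distribution p01 depends_event card_event_scope
  event_sum P4 sigma0 sigma4 N_sigma.
pose choice_of (X : {set E}) a := [pick e | (e \in star inc F a) && (e \in X)].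
pose M (X : {set E}) := [set e in X | [exists a in L, choice_of X a == Some e]].
rewrite -[2 * psi]addr0; apply: (spread_union muQ (m := M)) => //.
  move=> S; apply: le_trans (_ : prob mu (fun X => S \subset X) <= _); last first.
    by apply: le_trans (muS S) _; rewrite /p prodr_const.
  have [mu0 _ _] := muQ.
  rewrite /prob [X in X <= _]big_mkcond [X in _ <= X]big_mkcond /=.
  apply: ler_sum => X _; case: ifPn => [SX|_]; last by case: ifP.
  rewrite ifT //; apply: (fintype.subset_trans SX).
  by apply/fintype.subsetP => e; rewrite inE => /andP[].
move=> X nX; apply: spread_set0; rewrite finset.setU0.
have ME e : e \in M X -> exists a, [/\ a \in L, a \in inc e, e \in F, e \in X &
    choice_of X a = Some e].
  rewrite inE => /andP[eX /exists_inP[a aL /eqP ca]]; exists a.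
  move: (ca); rewrite /choice_of; case: pickP => // f /andP[fa fX] [fe].
  by move: fa; rewrite fe inE => /andP[].
split.
- apply/fintype.subsetP => e /ME[a [aL ae eF eX _]]; rewrite inE eF /=.
  by apply/pred0Pn; exists a; rewrite /= ae.
- move=> e f /ME[a [aL ae eF eX ca]] /ME[b [bL bf fF fX cb]] ef.
  apply: contraT => nd; have := nX (inr (e, f)).
  rewrite /= negb_and => /orP[]; last first.
    by case/negP; apply/fintype.subsetP => g; rewrite !inE => /orP[]/eqP->.
  case/negP; apply/and4P; split => //.
  + by rewrite inE eF; apply/pred0Pn; exists a; rewrite /= ae.
  + by rewrite inE fF; apply/pred0Pn; exists b; rewrite /= bf.
  (* Equal traces on [A] make [e] and [f] the picks of the same vertex, hence equal. *)
  + apply: contraNneq ef => eqA; have aA := fintype.subsetP LA _ aL.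
    have bA := fintype.subsetP LA _ bL.
    have : a \in inc f :&: A by rewrite -eqA inE ae.
    rewrite inE => /andP[af _]; have ab := incA1 fF af aA bf bA.
    by move: ca; rewrite ab cb => -[->].
- apply/fintype.subsetP => a aL; have := nX (inl a); rewrite /= aL /=.
  case/pred0Pn => e /= eaX.
  case ca : (choice_of X a) => [f|]; last first.
    by move: ca; rewrite /choice_of; case: pickP => // /(_ e); rewrite eaX.
  have /andP[fa fX] : (f \in star inc F a) && (f \in X).
    by move: ca; rewrite /choice_of; case: pickP => // g gP [<-].
  apply/bigcupP; exists f; last by move: fa; rewrite inE => /andP[].
  by rewrite inE fX; apply/exists_inP; exists a => //; rewrite ca.
Qed.
End BipartiteCover.

(** * Sparsification *)

Section Sparsify.
Variables (R : realType) (V E : finType) (inc : E -> {set V}) (r : nat).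
Variables (H : {set E}) (A : {set V}) (D l C s t_d t_K mu_d mu_K tau : R).
Hypothesis r_gt0 : (0 < r)%N.
Hypothesis unifH : forall e, e \in H -> #|inc e| = r.
Hypothesis star_le : forall v, #|star inc H v|%:R <= D.
Hypothesis star_ge : forall a, a \in A -> l <= #|star inc H a|%:R.
Hypothesis codeg_le : forall v w, v != w -> #|star inc H v :&: star inc H w|%:R <= C.
Hypothesis s01 : 0 <= s <= 1.
Hypothesis D_ge1 : 1 <= D.
Hypothesis mu_d01 : 0 <= mu_d <= 1 / 2.
Hypothesis mu_K01 : 0 <= mu_K <= 1 / 2.
Hypothesis tau_d : expR (2 * mu_d ^+ 2 * (D * s) - mu_d * t_d) <= tau.
Hypothesis tau_K : expR (2 * mu_K ^+ 2 * (C * s) - mu_K * t_K) <= tau.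
Let rR : R := r%:R.
Hypothesis D_tau : D * ((rR + rR ^+ 2) * (2 * tau)) <= 1 / 4.

Let p (e : E) : R := s.
Let p01 (e : E) : 0 <= p e <= 1. Proof. exact: s01. Qed.
Let s0 : 0 <= s. Proof. by case/andP: s01. Qed.

Let count (S X : {set E}) : R := \sum_(e in S) 1 * (e \in X)%:R.

Let countE (S X : {set E}) : count S X = #|S :&: X|%:R.
Proof.
rewrite /count -sum1_card natr_sum big_mkcond [RHS]big_mkcond /=.
apply: eq_bigr => e _; rewrite inE; case: (e \in S) => //=.
by case: (e \in X); rewrite ?mulr1 ?mulr0.
Qed.

Let expect_count (S : {set E}) : expect p (count S) = #|S|%:R * s.
Proof.
rewrite expect_sum mulr_natl -sumr_const; apply: eq_bigr => e _.
by rewrite expectZ mul1r (expect_mem p (fun b => b%:R)) mulr1 mulr0 addr0.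
Qed.

Let count_var (S : {set E}) (B : R) : #|S|%:R <= B ->
  \sum_(e in S) 1 * 1 * \sum_(i in [set e]) p i <= B * s.
Proof.
move=> SB; apply: (@le_trans _ _ (#|S|%:R * s)); last by rewrite ler_wpM2r.
by rewrite mulr_natl -sumr_const; apply: ler_sum => e _; rewrite !mul1r big_set1.
Qed.

Let count_hit (S : {set E}) i : \sum_(e in S | i \in [set e]) 1 * 1 <= 1 :> R.
Proof.
rewrite big_mkcondr /=; under eq_bigr do rewrite inE mul1r.
rewrite -big_mkcondr /=; have [iS|iS] := boolP (i \in S).
  by rewrite (bigD1 i) /= ?iS ?eqxx // big1 ?addr0 // => e /andP[/andP[_ /eqP ->]]; rewrite eqxx.
rewrite big1 ?ler01 // => e /andP[eS /eqP ie].
by rewrite -ie (negbTE iS) in eS.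
Qed.

Let mem01 (e : E) (X : {set E}) : 0 <= ((e \in X)%:R : R) <= 1.
Proof. by rewrite ler0n lern1 leq_b1. Qed.

Let count_upper (mu t B : R) (S : {set E}) : 0 <= mu <= 1 / 2 -> #|S|%:R <= B ->
  expect p (fun X => (B * s + t < count S X)%R%:R) <= expR (2 * mu ^+ 2 * (B * s) - mu * t).
Proof.
move=> /andP[mu0 mu2] SB.
have := @weighted_sum_upper_tail _ _ p p01 E (mem S) (fun=> 1)
  (fun e X => (e \in X)%:R) (fun e => [set e]) 1 1 (B * s) mu t
  (fun _ _ => ler01) ler01 (fun e X _ => mem01 e X)
  (fun e _ => depends_mem (fun b => b%:R) (i := e)) (count_hit S)
  (count_var SB) ler01 mu0 _ (B * s).
rewrite !mul1r; apply; first lra.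
by rewrite -/(count S) expect_count ler_wpM2r.
Qed.

Let count_lower (mu t B m : R) (S : {set E}) : 0 <= mu <= 1 / 2 -> #|S|%:R <= B ->
  m <= #|S|%:R * s ->
  expect p (fun X => (count S X < m - t)%R%:R) <= expR (2 * mu ^+ 2 * (B * s) - mu * t).
Proof.
move=> /andP[mu0 mu2] SB mS.
have := @weighted_sum_lower_tail _ _ p p01 E (mem S) (fun=> 1)
  (fun e X => (e \in X)%:R) (fun e => [set e]) 1 1 (B * s) mu t
  (fun _ _ => ler01) ler01 (fun e X _ => mem01 e X)
  (fun e _ => depends_mem (fun b => b%:R) (i := e)) (count_hit S)
  (count_var SB) ler01 mu0 _ m.
rewrite !mul1r; apply; first lra.
by rewrite -/(count S) expect_count.
Qed.

Let pair_star v w := star inc H v :&: star inc H w.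

Let event (j : V + V * V) (X : {set E}) : bool :=
  match j with
  | inl v => (D * s + t_d < count (star inc H v) X) ||
      (v \in A) && (count (star inc H v) X < l * s - t_d)
  | inr (v, w) => (v != w) && (C * s + t_K < count (pair_star v w) X)
  end.

Let event_scope (j : V + V * V) : {set E} :=
  match j with
  | inl v => star inc H v
  | inr (v, w) => pair_star v w
  end.

Let depends_count (S : {set E}) : depends S (count S).
Proof.
by move=> X Y XY; rewrite !countE ![S :&: _]finset.setIC XY.
Qed.

Let depends_event j : depends (event_scope j) (event j).
Proof. by case: j => [v|[v w]] X Y XY /=; rewrite (depends_count XY). Qed.

Let tau_ge0 : 0 <= tau. Proof. exact: le_trans (expR_ge0 _) tau_d. Qed.

Let event_le j : expect p (fun X => (event j X)%:R) <= 2 * tau.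
Proof.
case: j => [v|[v w]]; last first.
  apply: (@le_trans _ _ tau); last by rewrite ler_peMl // ler1n.
  have [->|vw] := eqVneq v w.
    apply: (@le_trans _ _ 0) => //; rewrite -(expect_cst p 0).
    by apply: le_expect => // X /=; rewrite eqxx.
  apply: le_trans tau_K; apply: le_trans (count_upper t_K mu_K01 (codeg_le vw)).
  by apply: le_expect => // X /=; rewrite vw.
have -> : 2 * tau = tau + tau by ring.
have h1 := le_trans (count_upper t_d mu_d01 (star_le v)) tau_d.
have [vA|vA] := boolP (v \in A); last first.
  apply: (@le_trans _ _ tau); last by rewrite lerDl.
  by apply: le_trans h1; apply: le_expect => // X /=; rewrite (negbTE vA) orbF.
have ls : l * s <= #|star inc H v|%:R * s by rewrite ler_wpM2r ?star_ge.
have h2 := le_trans (count_lower t_d mu_d01 (star_le v) ls) tau_d.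
apply: le_trans (lerD h1 h2); rewrite -expectD; apply: le_expect => // X.
by rewrite /= -natrD ler_nat; case: (_ < _); case: (_ < _); case: (_ \in _).
Qed.

Let card_event_scope j : #|event_scope j|%:R <= D.
Proof.
case: j => [v|[v w]] /=; first exact: star_le.
apply: le_trans (star_le v); rewrite ler_nat.
exact/subset_leq_card/finset.subsetIl.
Qed.

Let event_sum e :
  \sum_(j | e \in event_scope j) expect p (fun X => (event j X)%:R) <=
  (rR + rR ^+ 2) * (2 * tau).
Proof.
apply: (@le_trans _ _ (\sum_(j in [set j | e \in event_scope j]) 2 * tau)).
  rewrite [X in _ <= X](eq_bigl (fun j => e \in event_scope j)); last first.
    by move=> j; rewrite inE.
  by apply: ler_sum => j _; apply: event_le.
rewrite sumr_const -[_ *+ #|_|]mulr_natl ler_wpM2r ?mulr_ge0 //.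
have [eH|eH] := boolP (e \in H); last first.
  rewrite (_ : [set j | _] = set0) ?cards0 ?addr_ge0 ?exprn_ge0 ?ler0n //.
  by apply/setP => -[v|[v w]]; rewrite [RHS]inE [LHS]inE /= ?in_setI in_set (negbTE eH).
apply: (@le_trans _ _ (#|[set (inl v : V + V * V) | v in inc e]|%:R +
   #|[set (inr x : V + V * V) | x in finset.setX (inc e) (inc e)]|%:R)).
  rewrite -natrD ler_nat; apply: leq_trans (leq_card_setU _ _).
  apply/subset_leq_card/fintype.subsetP => -[v|[v w]];
    rewrite in_setU [_ \in [set j | _]]inE /= ?in_setI !in_set.
    by move=> /andP[_ ve]; apply/orP; left; apply/imset_f.
  move=> /andP[/andP[_ ve] /andP[_ we]]; apply/orP; right; apply/imset_f.
  by rewrite inE /= ve.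
apply: lerD.
  by rewrite /rR -(unifH eH) ler_nat leq_imset_card.
rewrite /rR -(unifH eH) expr2 -natrM ler_nat.
by rewrite -cardsX; apply: leq_imset_card.
Qed.

Lemma sparsify : exists mu : {set E} -> R,
  distribution_on (fun X =>
    [/\ forall v, #|star inc (H :&: X) v|%:R <= D * s + t_d,
        forall a, a \in A -> l * s - t_d <= #|star inc (H :&: X) a|%:R
      & forall v w, v != w ->
          #|star inc (H :&: X) v :&: star inc (H :&: X) w|%:R <= C * s + t_K]) mu /\
  forall S : {set E}, prob mu (fun X => S \subset H :&: X) <= (2 * s) ^+ #|S|.
Proof.
have Dsigma := D_tau; have esum := event_sum.
set sigma := (rR + rR ^+ 2) * (2 * tau) in Dsigma esum.
have rR1 : 1 <= rR by rewrite /rR ler1n.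
have sigma0 : 0 <= sigma.
  by rewrite /sigma mulr_ge0 ?mulr_ge0 // addr_ge0 ?exprn_ge0 // ler0n.
have sigma4 : sigma <= 1 / 4 by apply: le_trans Dsigma; rewrite ler_peMl.
have PA4 j : expect p (fun X => (event j X)%:R) <= 1 / 4.
  apply: le_trans (event_le j) _; apply: le_trans sigma4.
  by rewrite /sigma ler_peMl ?mulr_ge0 // ler_wpDr ?exprn_ge0 // ler0n.
have [mu [[mu0 mu1 muP] muS]] := local_lemma_distribution p01 depends_event
  card_event_scope esum PA4 sigma0 sigma4 Dsigma.
have star_count X v : #|star inc (H :&: X) v|%:R = count (star inc H v) X.
  rewrite countE; congr (_%:R); apply: eq_card => e; rewrite !inE.
  by rewrite andbAC.
exists mu; split; last first.
  move=> S; apply: (@le_trans _ _ (prob mu (fun X => S \subset X))).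
    rewrite /prob [X in X <= _]big_mkcond [X in _ <= X]big_mkcond /=.
    apply: ler_sum => X _; case: ifPn => [SX|_]; last by case: ifP.
    by rewrite ifT //; apply: fintype.subset_trans SX _; apply: finset.subsetIr.
  by apply: le_trans (muS S) _; rewrite /p prodr_const.
split=> // X /muP nX; split.
- by move=> v; have := nX (inl v); rewrite /= negb_or -leNgt star_count => /andP[].
- move=> a aA; have := nX (inl a); rewrite /= negb_or aA -!leNgt star_count.
  by case/andP.
- move=> v w vw; have := nX (inr (v, w)); rewrite /= vw -leNgt; apply: le_trans.
  rewrite countE ler_nat; apply/subset_leq_card/fintype.subsetP => e.
  by rewrite !inE => /andP[/andP[/andP[-> ->] ->] /andP[_ ->]].
Qed.
End Sparsify.

(** * Choice of parameters *)

(** [T] is the least exponent with [(1 - theta) ^+ T <= theta]; minimality gives the lower bound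
    [theta * (1 - theta)]. Since [(1 - theta) ^+ n * (1 + n%:R * theta) <= 1], any [n] above
    [theta ^- 2] qualifies. This polynomial bound avoids logarithms, and only powers of [x] matter
    later. *)
Lemma geometric_stop (R : realType) (theta : R) : 0 < theta -> theta <= 1 / 2 ->
  exists T : nat, [/\ T%:R <= theta ^- 2 + 1, (1 - theta) ^+ T <= theta &
    theta ^+ 2 <= (1 - theta) ^+ T].
Proof.
move=> t0 t2.
have bound n : (1 - theta) ^+ n * (1 + n%:R * theta) <= 1.
  apply: (@le_trans _ _ ((1 - theta) ^+ n * (1 + theta) ^+ n)).
    apply: ler_wpM2l; first by apply: exprn_ge0; lra.
    by apply: one_add_mul_le_exp; apply: ltW.
  rewrite -exprMn; apply: exprn_ile1.
    by apply: mulr_ge0; lra.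
  by have := sqr_ge0 theta; rewrite expr2; lra.
pose n := (Num.truncn (theta ^- 2)).+1.
have i0 : 0 <= theta ^- 2 by rewrite invr_ge0 sqr_ge0.
have nlo : theta ^- 2 < n%:R by apply: truncnS_gt.
have nhi : n%:R <= theta ^- 2 + 1.
  by rewrite /n -natr1 lerD2r truncn_le.
have Pn : (1 - theta) ^+ n <= theta.
  have h := bound n.
  have h1 : 1 <= theta * (1 + n%:R * theta).
    have : theta ^- 2 * theta ^+ 2 <= n%:R * theta ^+ 2.
      by rewrite ler_wpM2r ?sqr_ge0 // ltW.
    rewrite mulVf ?expf_neq0 ?lt0r_neq0 //; lra.
  have h2 : 0 < 1 + n%:R * theta by rewrite ltr_wpDr // mulr_ge0 // ltW.
  rewrite -(ler_pM2r h2); exact: le_trans h h1.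
have ex : exists n0, (1 - theta) ^+ n0 <= theta by exists n.
case: (ex_minnP ex) => T PT minT; exists T; split=> //.
  by apply: le_trans nhi; rewrite ler_nat; apply: minT.
case: T PT minT => [|T] PT minT; first by move: PT; rewrite expr0; lra.
have : theta < (1 - theta) ^+ T.
  by rewrite ltNge; apply/negP => /minT; rewrite ltnn.
rewrite [(1 - theta) ^+ T.+1]exprS => h.
have : theta * (1 - theta) <= (1 - theta) * (1 - theta) ^+ T.
  by rewrite mulrC ler_wpM2l ?ltW //; lra.
by move=> h2; apply: le_trans h2; rewrite expr2; nra.
Qed.

Section NumericalChoice.
Variables (R : realType) (r : nat) (x D : R).
Let rR : R := r%:R.
Hypothesis r_ge2 : (2 <= r)%N.
Hypothesis x_ge : 100 * rR ^+ 2 <= x.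

(* [par_y^-1] bounds from below the fraction of the degree that survives the
   whole nibble; [par_z ^ 2] is the degree after sparsification. *)
Definition par_y : R := x ^+ (8 * r.-1).
Definition par_z : R := par_y * x ^+ 20.
Let y := par_y.
Let z := par_z.
Hypothesis D_ge : z ^+ 6 * x ^+ 40 <= D.
Hypothesis D_tau : D ^+ 8 * expR (- x) <= 1.

Let w : R := x^-1.
Let v : R := y^-1.
(** The exponent 4 cancels the [x ^+ 4] that the squared covering probability [x ^+ 2 / D] brings
    into [cover_size]. The exponent 14 of [xi] leaves room for [x ^+ 8 + 2] error terms below
    [theta / 4]. *)
Let theta : R := w ^+ 4.
Let d : R := z ^+ 2.
Let xi : R := w ^+ 14.
Let tau : R := expR (- x).
Let rho : R := (1 - theta) ^+ r.-1.

Let rR2 : 2 <= rR. Proof. by rewrite (ler_nat R 2). Qed.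
Let x_big : 100 * rR <= x.
Proof. by apply: le_trans x_ge; rewrite expr2; have := rR2; nra. Qed.
Let x200 : 200 <= x. Proof. by have := rR2; have := x_big; lra. Qed.
Let x0 : 0 < x. Proof. by have := x200; lra. Qed.
Let xn0 n : 0 <= x ^+ n. Proof. exact/exprn_ge0/ltW. Qed.
Let xw : x * w = 1. Proof. by rewrite mulfV // lt0r_neq0. Qed.
Let w0 : 0 < w. Proof. by rewrite invr_gt0. Qed.
Let w1 : 200 * w <= 1. Proof. by have := x200; have := xw; have := w0; nra. Qed.
Let rw : 100 * rR ^+ 2 * w <= 1.
Proof. by rewrite -[X in _ <= X]xw ler_wpM2r // ltW. Qed.
Let y1 : 1 <= y. Proof. by apply: exprn_ege1; have := x200; lra. Qed.
Let y0 : 0 < y. Proof. exact: lt_le_trans y1. Qed.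
Let yv : y * v = 1. Proof. by rewrite mulfV // lt0r_neq0. Qed.
Let v0 : 0 < v. Proof. by rewrite invr_gt0. Qed.
Let theta0 : 0 < theta. Proof. exact: exprn_gt0. Qed.
Let theta_le n : (0 < n)%N -> 200 * w ^+ n <= 1.
Proof.
move=> n0; rewrite -(prednK n0) exprS.
have h : w ^+ n.-1 <= 1.
  by apply: exprn_ile1; [exact: ltW | have := w1; have := w0; lra].
have h1 := w1; apply: le_trans h1; rewrite mulrA.
apply: (ler_piMr _ h); apply: mulr_ge0; first exact: ler0n.
exact: ltW.
Qed.
Let theta_small : 200 * theta <= 1. Proof. exact: theta_le. Qed.
Let theta01 : 0 < theta < 1. Proof. by have := theta0; have := theta_small; lra. Qed.
Let xwn n : x ^+ n * w ^+ n = 1. Proof. by rewrite -exprMn xw expr1n. Qed.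

Variable T : nat.
Hypothesis T_le : T%:R <= theta ^- 2 + 1.
Hypothesis T_lo : (1 - theta) ^+ T <= theta.
Hypothesis T_hi : theta ^+ 2 <= (1 - theta) ^+ T.

Let T_x8 : T%:R <= x ^+ 8 + 1.
Proof.
apply: le_trans T_le _; rewrite lerD2r /theta -exprM /w exprVn invrK.
by [].
Qed.

Let rho_le1 i : rho ^+ i <= 1.
Proof.
rewrite /rho; apply: exprn_ile1; first by apply: exprn_ge0; have := theta01; lra.
by apply: exprn_ile1; have := theta01; lra.
Qed.

(** [rho ^+ T] is the [r.-1]-th power of [(1 - theta) ^+ T], which is at least
    [theta ^+ 2 = w ^+ 8]: the origin of the exponent in [par_y]. *)
Let rho_ge i : (i <= T)%N -> v <= rho ^+ i.
Proof.
move=> iT; have rho0 : 0 <= rho by apply: exprn_ge0; have := theta01; lra.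
have r1 : rho <= 1 by have := rho_le1 1; rewrite expr1.
apply: (@le_trans _ _ (rho ^+ T)); last first.
  rewrite -(subnK iT) exprD.
  by apply: ler_piMl; [exact: exprn_ge0 | exact: exprn_ile1].
have -> : v = (theta ^+ 2) ^+ r.-1.
  have -> : v = w ^+ (8 * r.-1) by rewrite /w exprVn.
  by rewrite (exprM _ 8) (exprM _ 4 2).
rewrite /rho [X in _ <= X]exprAC; apply: lerXn2r; rewrite ?nnegrE ?sqr_ge0 //.
by apply: exprn_ge0; have := theta01; lra.
Qed.

Let xi0 : 0 < xi. Proof. exact: exprn_gt0. Qed.

Let xi_T (i : nat) : (i <= T)%N -> 4 * (i.+1%:R * xi) <= theta.
Proof.
move=> iT; have h : i.+1%:R <= x ^+ 8 + 2 :> R.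
  by rewrite -natr1; have : i%:R <= T%:R :> R by [rewrite ler_nat]; have := T_x8; lra.
have : i.+1%:R * xi <= (x ^+ 8 + 2) * xi by rewrite ler_wpM2r // ltW.
have -> : (x ^+ 8 + 2) * xi = (x ^+ 8 * w ^+ 8) * w ^+ 6 + 2 * w ^+ 14 by rewrite /xi; ring.
rewrite xwn mul1r.
have -> : w ^+ 6 = theta * w ^+ 2 by rewrite /theta; ring.
have -> : w ^+ 14 = theta * w ^+ 10 by rewrite /theta; ring.
have := @theta_le 2 isT; have := @theta_le 10 isT; have := theta0.
by nra.
Qed.

(* Upper and lower degree bounds after [i] rounds, and the weight of a vertex
   alive after [i] rounds; the error [i.+1 * xi] stays below [theta / 4]. *)
Definition par_u i : R := d * rho ^+ i * (1 + i.+1%:R * xi).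
Definition par_l i : R := d * rho ^+ i * (1 - i.+1%:R * xi).
Definition par_lam i : R := (rR + 2) * theta + (1 - theta) ^+ (T - i).

Let z0 : 0 < z. Proof. by rewrite mulr_gt0 // exprn_gt0. Qed.
Let d0 : 0 < d. Proof. exact: exprn_gt0. Qed.
Let rhoi0 i : 0 < rho ^+ i.
Proof. by do 2 apply: exprn_gt0; have := theta01; lra. Qed.

Let u_ge i : (i <= T)%N -> d * v <= par_u i.
Proof.
move=> iT; rewrite /par_u -mulrA ler_wpM2l ?(ltW d0) //.
apply: le_trans (rho_ge iT) _; rewrite ler_peMr ?(ltW (rhoi0 i)) // lerDl.
by rewrite mulr_ge0 // ltW.
Qed.

Let u_le i : (i <= T)%N -> par_u i <= 2 * (d * rho ^+ i).
Proof.
move=> iT; have h : 1 + i.+1%:R * xi <= 2.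
  by have := xi_T iT; have := theta_small; have := theta0; move: (_ * xi) => t; lra.
rewrite [2 * _]mulrC; apply: ler_wpM2l h.
by apply: mulr_ge0; apply: ltW.
Qed.

Let u_le2d i : (i <= T)%N -> par_u i <= 2 * d.
Proof.
move=> iT; apply: le_trans (u_le iT) _; rewrite ler_wpM2l // ler_piMr ?(ltW d0) //.
Qed.

Let dv : d * v = y * x ^+ 40.
Proof.
have -> : d * v = (y * v) * y * x ^+ 40 by rewrite /d /z /par_z -/y; ring.
by rewrite yv mul1r.
Qed.

Let xn1 n : 1 <= x ^+ n. Proof. by apply: exprn_ege1; have := x200; lra. Qed.

Let u_ge1 i : (i <= T)%N -> 1 <= par_u i.
Proof. by move=> /u_ge; apply: le_trans; rewrite dv; apply: mulr_ege1. Qed.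

Let u_gt0 i : (i <= T)%N -> 0 < par_u i.
Proof. by move=> /u_ge1; apply: lt_le_trans. Qed.

Let yi i : R := rR ^+ 2 * (theta / par_u i * x ^+ 2).

Let yi_ge0 i : (i <= T)%N -> 0 <= yi i.
Proof.
move=> iT; rewrite /yi; apply: mulr_ge0; first exact: sqr_ge0.
by apply: mulr_ge0; [apply: divr_ge0; apply: ltW; rewrite ?u_gt0 | apply: ltW; apply: exprn_gt0].
Qed.

Let yi_le i : (i <= T)%N -> 8 * yi i <= xi.
Proof.
move=> iT; have u0 := u_gt0 iT.
have e : par_u i / par_u i = 1 by rewrite mulfV // lt0r_neq0.
rewrite -(ler_pM2r u0).
have -> : 8 * yi i * par_u i = 8 * rR ^+ 2 * theta * x ^+ 2 * (par_u i / par_u i).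
  by rewrite /yi; ring.
rewrite e mulr1; apply: (@le_trans _ _ (xi * (d * v))); last by rewrite ler_wpM2l ?(ltW xi0) ?u_ge.
rewrite dv.
have -> : xi * (y * x ^+ 40) = y * x ^+ 26 * (x ^+ 14 * w ^+ 14) by rewrite /xi; ring.
have -> : 8 * rR ^+ 2 * theta * x ^+ 2 =
    8 * rR ^+ 2 * (x ^+ 2 * w ^+ 2) * w ^+ 2 by rewrite /theta; ring.
rewrite !xwn !mulr1; apply: (@le_trans _ _ 1).
  have := rw; have := sqr_ge0 rR; have := @theta_le 1 isT; rewrite expr1 => h1 h2 h3.
  have -> : 8 * rR ^+ 2 * w ^+ 2 = 8 * (rR ^+ 2 * w) * w by ring.
  have := w0; nra.
by apply: mulr_ege1.
Qed.

(** The common form of the tail exponents: variance term at most 2 and linear term at least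
    [x ^+ 2], which leaves more than [x]. *)
Let tail_le (a b : R) : a <= 2 -> x ^+ 2 <= b -> expR (a - b) <= tau.
Proof.
move=> a1 b2; rewrite /tau ler_expR.
have : 200 * x <= x ^+ 2 by rewrite expr2 ler_wpM2r ?(ltW x0).
by have := x200; lra.
Qed.

(** Deviations and exponential parameters are paired so that both products [mu * eta] equal
    [x ^+ 2]. [par_eta_d] is [x ^+ 2] times the square root of [d], and [par_eta_b] sums to at most
    [theta * D] over all rounds. In [par_C], [z ^+ 6 = d ^+ 3] pays for the product of reach and
    scope size. *)
Definition par_eta_d : R := z * x ^+ 2.
Definition par_mu_d : R := z^-1.
Definition par_eta_b : R := D * w ^+ 13.
Definition par_mu_b : R := x ^+ 15 / D.
Definition par_C : R := D / (z ^+ 6 * x ^+ 40).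

Let zx : z = y * x ^+ 20. Proof. by []. Qed.

Let eta_d_le i : (i <= T)%N -> 2 * par_eta_d <= d * rho ^+ i * xi.
Proof.
move=> iT; apply: (@le_trans _ _ (d * v * xi)); last first.
  by rewrite ler_wpM2r ?(ltW xi0) // ler_wpM2l ?(ltW d0) ?rho_ge.
rewrite dv /par_eta_d zx.
have -> : y * x ^+ 40 * xi =
    y * x ^+ 20 * x ^+ 2 * x ^+ 4 * (x ^+ 14 * w ^+ 14) by rewrite /xi; ring.
rewrite xwn mulr1 mulrC; apply: ler_wpM2l.
  by apply: mulr_ge0 (xn0 2); apply: mulr_ge0 (xn0 20); apply: ltW.
by have := x200; have := xn1 3; rewrite [x ^+ 4]exprS; nra.
Qed.

Let rhoS i : d * rho ^+ i.+1 = d * rho ^+ i * rho. Proof. by rewrite exprSr mulrA. Qed.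

Let us_K i : (i < T)%N -> rR ^+ 2 * (theta / par_u i * x ^+ 2) < 1.
Proof.
move=> /ltnW /yi_le; rewrite -/(yi i) => h.
have : 200 * xi <= 1 by apply: theta_le.
lra.
Qed.

(** The extra [xi] of the next bound is split in two: half absorbs the deviation [par_eta_d], half
    the overlap error [1 / (1 - yi i)]. *)
Let usS i : (i < T)%N -> par_u i * (1 - theta) ^+ r.-1 /
  (1 - rR ^+ 2 * (theta / par_u i * x ^+ 2)) + par_eta_d <= par_u i.+1.
Proof.
move=> iT; have iT' := ltnW iT; rewrite -/(yi i) -/rho.
have y8 := yi_le iT'; have yy0 := yi_ge0 iT'; have xi1 : 200 * xi <= 1 by apply: theta_le.
have rho0 : 0 <= rho by have := rhoi0 1; rewrite expr1 => /ltW.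
have ur0 : 0 <= par_u i * rho by apply: mulr_ge0 rho0; apply/ltW/u_gt0.
have : par_u i * rho / (1 - yi i) <= par_u i * rho * (1 + 2 * yi i).
  apply: (ler_wpM2l ur0); rewrite -[X in X <= _]mul1r ler_pdivrMr; last by lra.
  by move: (yi i) y8 yy0 => t; nra.
have e1 := eta_d_le iT.
have : par_u i * rho * (2 * yi i) <= 2 * (d * rho ^+ i) * rho * (2 * yi i).
  apply: ler_wpM2r; first by apply: mulr_ge0.
  by apply: ler_wpM2r rho0 _ _ (u_le iT').
have -> : 2 * (d * rho ^+ i) * rho * (2 * yi i) =
    d * rho ^+ i.+1 * (4 * yi i) by rewrite rhoS; ring.
have : d * rho ^+ i.+1 * (4 * yi i) <= d * rho ^+ i.+1 * (xi / 2).
  apply: ler_wpM2l; last by lra.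
  by apply: mulr_ge0; apply: ltW.
have -> : par_u i * rho * (1 + 2 * yi i) = par_u i * rho + par_u i * rho * (2 * yi i) by ring.
have -> : par_u i * rho = d * rho ^+ i.+1 * (1 + i.+1%:R * xi) by rewrite rhoS /par_u; ring.
have -> : par_u i.+1 = d * rho ^+ i.+1 * (1 + i.+1%:R * xi) + d * rho ^+ i.+1 * xi.
  by rewrite /par_u -(natr1 i.+1); ring.
lra.
Qed.

Let lsS i : (i < T)%N -> par_l i.+1 <= par_l i * (1 - theta) ^+ r.-1 - par_eta_d.
Proof.
move=> iT; rewrite -/rho; have e1 := eta_d_le iT.
have -> : par_l i * rho = d * rho ^+ i.+1 * (1 - i.+1%:R * xi) by rewrite rhoS /par_l; ring.
have -> : par_l i.+1 = d * rho ^+ i.+1 * (1 - i.+1%:R * xi) - d * rho ^+ i.+1 * xi.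
  by rewrite /par_l -(natr1 i.+1); ring.
have : 0 <= par_eta_d by rewrite /par_eta_d mulr_ge0 ?(ltW z0) ?xn0.
lra.
Qed.

Let ls_us i : (i < T)%N -> par_u i - par_l i <= theta * par_u i.
Proof.
move=> iT; have := xi_T (ltnW iT) => h.
have dr : 0 < d * rho ^+ i by rewrite mulr_gt0.
have -> : par_u i - par_l i = d * rho ^+ i * (2 * (i.+1%:R * xi)) by rewrite /par_u /par_l; ring.
have -> : theta * par_u i = d * rho ^+ i * (theta * (1 + i.+1%:R * xi)) by rewrite /par_u; ring.
rewrite ler_wpM2l ?(ltW dr) //.
have xx0 : 0 <= i.+1%:R * xi := mulr_ge0 (ler0n _ _) (ltW xi0).
have := mulr_ge0 (ltW theta0) xx0; move: h xx0; move: (_ * xi) => t; lra.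
Qed.

Let z1 : 1 <= z. Proof. by rewrite zx mulr_ege1. Qed.
Let d1 : 1 <= d. Proof. exact: exprn_ege1. Qed.
Let D1 : 1 <= D.
Proof. by apply: le_trans D_ge; apply: mulr_ege1 => //; apply: exprn_ege1. Qed.
Let D0 : 0 < D. Proof. exact: lt_le_trans D1. Qed.
Let DV : D / D = 1. Proof. by rewrite mulfV // lt0r_neq0. Qed.
Let zV : z / z = 1. Proof. by rewrite mulfV // lt0r_neq0. Qed.
Let tau0 : 0 < tau. Proof. exact: expR_gt0. Qed.
Let Dn_tau n : (n <= 8)%N -> D ^+ n * tau <= 1.
Proof.
move=> n8; apply: le_trans D_tau; apply: ler_wpM2r; first exact: ltW.
by rewrite -(subnK n8) exprD ler_peMl ?exprn_ge0 ?exprn_ege1 // ltW.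
Qed.
Let x_le_D : x <= D.
Proof.
apply: le_trans D_ge; rewrite [x ^+ 40]exprS mulrCA ler_peMr ?(ltW x0) //.
by apply: mulr_ege1 => //; apply: exprn_ege1.
Qed.

Let mu_d_ge0 : 0 <= par_mu_d. Proof. by rewrite invr_ge0 ltW. Qed.

Let mu_d_eta : par_mu_d * par_eta_d = x ^+ 2.
Proof. by rewrite /par_mu_d /par_eta_d mulrA mulVf ?mul1r // lt0r_neq0. Qed.

Let z_big : 200 * rR * x ^+ 2 <= z.
Proof.
rewrite zx; apply: (@le_trans _ _ (x ^+ 20)); last by rewrite ler_peMl ?xn0.
have -> : x ^+ 20 = x ^+ 16 * x * x * x ^+ 2 by ring.
rewrite ler_wpM2r ?xn0 //.
have h := xn1 16; have : x * x <= x ^+ 16 * x * x.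
  by rewrite -mulrA; apply: ler_peMl h; apply: mulr_ge0; apply: ltW.
by have := x200; have := x_big; have := rR2; nra.
Qed.

Let mu_d_le : 2 * par_mu_d * (rR * x ^+ 2) <= 1.
Proof.
rewrite -[X in _ <= X]zV /par_mu_d.
have -> : 2 / z * (rR * x ^+ 2) = 2 * (rR * x ^+ 2) / z by ring.
rewrite ler_wpM2r ?invr_ge0 ?(ltW z0) //; apply: le_trans z_big.
have : 0 <= rR * x ^+ 2 by rewrite mulr_ge0 ?xn0.
lra.
Qed.

Let tau_d i : (i < T)%N ->
  expR (2 * par_mu_d ^+ 2 * (rR * x ^+ 2 * (par_u i * (rR * (2 * theta)))) -
    par_mu_d * par_eta_d) <= tau.
Proof.
move=> iT; apply: tail_le; last by rewrite mu_d_eta.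
apply: (@le_trans _ _ (2 * par_mu_d ^+ 2 * (rR * x ^+ 2 * (2 * d * (rR * (2 * theta)))))).
  apply: ler_wpM2l; first by apply: mulr_ge0 (ler0n _ _) (sqr_ge0 _).
  apply: ler_wpM2l; first exact: mulr_ge0 (ler0n _ _) (xn0 2).
  apply: ler_wpM2r; last exact/u_le2d/ltnW.
  by apply: mulr_ge0 (ler0n _ _) _; apply: mulr_ge0 (ler0n _ _) (ltW theta0).
have -> : 2 * par_mu_d ^+ 2 * (rR * x ^+ 2 * (2 * d * (rR * (2 * theta)))) =
  8 * (rR ^+ 2 * w) * w * (x ^+ 2 * w ^+ 2) * (z / z) ^+ 2.
  by rewrite /par_mu_d /d /theta; ring.
rewrite zV expr1n xwn !mulr1.
have h1 := rw; have h2 := w1; have h3 := w0.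
have : 0 <= rR ^+ 2 * w by rewrite mulr_ge0 ?sqr_ge0 // ltW.
move: h1; rewrite -mulrA; move: (rR ^+ 2 * w) => t; nra.
Qed.

Let r_theta : 100 * ((rR + 2) * theta) <= 1.
Proof.
have -> : (rR + 2) * theta = (rR + 2) * w * w ^+ 3 by rewrite /theta; ring.
have h := @theta_le 3 isT; have h3 : 0 <= w ^+ 3 by rewrite exprn_ge0 // ltW.
have h1 := rw; have : (rR + 2) * w <= rR ^+ 2 * w.
  by rewrite ler_wpM2r ?(ltW w0) //; have := rR2; rewrite expr2; nra.
have : 0 <= (rR + 2) * w by rewrite mulr_ge0 ?addr_ge0 ?(ltW w0).
move: h1; rewrite -mulrA; move: ((rR + 2) * w) (rR ^+ 2 * w) => a b; nra.
Qed.

Let r_theta0 : 0 <= (rR + 2) * theta.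
Proof. by rewrite mulr_ge0 ?addr_ge0 ?(ltW theta0). Qed.

Let lams_ge0 i : (i <= T)%N -> 0 <= par_lam i <= 2.
Proof.
move=> _; have t0 : 0 <= 1 - theta by have := theta01; lra.
have t1 : 1 - theta <= 1 by have := theta01; lra.
have h0 : 0 <= (1 - theta) ^+ (T - i) by apply: exprn_ge0.
have h1 : (1 - theta) ^+ (T - i) <= 1 by apply: exprn_ile1.
by have := r_theta; have := r_theta0; rewrite /par_lam; lra.
Qed.

(** [(rR + 2) * theta] is the fixed point of the recurrence and the power of [1 - theta] solves its
    homogeneous part, so equality holds. *)
Let lamsS i : (i < T)%N ->
  (rR + 2) * theta ^+ 2 + par_lam i.+1 * (1 - theta) <= par_lam i.
Proof.
move=> iT; rewrite /par_lam (_ : (T - i = (T - i.+1).+1)%N); last first.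
  by rewrite subnS prednK // subn_gt0.
by rewrite [(1 - theta) ^+ _.+1]exprSr le_eqVlt; apply/orP; left; apply/eqP; ring.
Qed.

Let lamsT : 1 <= par_lam T.
Proof. by rewrite /par_lam subnn expr0 lerDr. Qed.

Let zx_gt0 : 0 < z ^+ 6 * x ^+ 40. Proof. by rewrite mulr_gt0 ?exprn_gt0. Qed.

Let C_ge0 : 0 <= par_C. Proof. by rewrite divr_ge0 ?(ltW D0) ?(ltW zx_gt0). Qed.

Let reach_le i : (i <= T)%N -> 0 <= rR * (1 + par_u i * rR) <= x * d.
Proof.
move=> iT; have u2 := u_le2d iT; have u0 := u_gt0 iT; apply/andP; split.
  by rewrite mulr_ge0 // addr_ge0 // mulr_ge0 // ltW.
apply: (@le_trans _ _ (rR * (1 + 2 * d * rR))).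
  by rewrite ler_wpM2l // lerD2l ler_wpM2r.
apply: (@le_trans _ _ (3 * rR ^+ 2 * d)).
  have := d1; have := rR2; rewrite expr2; nra.
rewrite ler_wpM2r ?(ltW d0) //; have := x_ge; have := sqr_ge0 rR; lra.
Qed.

Let size_le i : (i <= T)%N -> 0 <= (1 + par_u i) * (1 + par_u i * rR) <= 3 * d * (x * d).
Proof.
move=> iT; have u2 := u_le2d iT; have u0 := u_gt0 iT.
have h : 0 <= 1 + par_u i * rR by rewrite addr_ge0 // mulr_ge0 // ltW.
apply/andP; split; first by rewrite mulr_ge0 // addr_ge0 // ltW.
apply: ler_pM => //; first by rewrite addr_ge0 // ltW.
  by have := d1; lra.
have /andP[_] := reach_le iT; apply: le_trans; rewrite ler_peMl //.
by have := rR2; lra.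
Qed.

Let mu_b_ge0 : 0 <= par_mu_b.
Proof. by rewrite divr_ge0 ?(ltW D0) // exprn_ge0 // ltW. Qed.

Let zxV : z ^+ 6 * x ^+ 40 / (z ^+ 6 * x ^+ 40) = 1.
Proof. by rewrite mulfV // lt0r_neq0. Qed.

Let muC : par_mu_b * par_C = x ^+ 15 / (z ^+ 6 * x ^+ 40).
Proof.
have -> : par_mu_b * par_C = x ^+ 15 / (z ^+ 6 * x ^+ 40) * (D / D).
  by rewrite /par_mu_b /par_C; ring.
by rewrite DV mulr1.
Qed.

Let mu_b_le i : (i < T)%N ->
  2 * par_mu_b * (2 * par_C * (rR * (1 + par_u i * rR))) <= 1.
Proof.
move=> /ltnW /reach_le /andP[_ h].
apply: (@le_trans _ _ (2 * par_mu_b * (2 * par_C * (x * d)))).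
  apply: (ler_wpM2l (mulr_ge0 (ler0n _ 2) mu_b_ge0)).
  exact: (ler_wpM2l (mulr_ge0 (ler0n _ 2) C_ge0)).
have -> : 2 * par_mu_b * (2 * par_C * (x * d)) = 4 * (x * d) * (par_mu_b * par_C) by ring.
rewrite muC -[X in _ <= X]zxV mulrA ler_wpM2r ?invr_ge0 ?(ltW zx_gt0) //.
have -> : 4 * (x * d) * x ^+ 15 = 4 * (z ^+ 2 * x ^+ 16) by rewrite /d; ring.
have -> : z ^+ 6 * x ^+ 40 = x * (z ^+ 4 * x ^+ 23) * (z ^+ 2 * x ^+ 16) by ring.
apply: (ler_wpM2r (mulr_ge0 (exprn_ge0 2 (ltW z0)) (xn0 16))).
have : 1 <= z ^+ 4 * x ^+ 23 by apply: mulr_ege1 => //; apply: exprn_ege1.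
by have := x200; nra.
Qed.

Let mu_b_eta : par_mu_b * par_eta_b = x ^+ 2.
Proof.
have -> : par_mu_b * par_eta_b = x ^+ 2 * (x ^+ 13 * w ^+ 13) * (D / D).
  by rewrite /par_mu_b /par_eta_b; ring.
by rewrite xwn DV !mulr1.
Qed.

(** Reach times scope size is of order [x ^+ 2 * d ^+ 3], and [par_C] carries exactly the inverse of
    [z ^+ 6 = d ^+ 3]; the spare powers of [x] absorb the constant. *)
Let tau_b i : (i < T)%N ->
  expR (2 * par_mu_b ^+ 2 * (2 * par_C * (rR * (1 + par_u i * rR)) *
    (2 * D * ((1 + par_u i) * (1 + par_u i * rR)))) - par_mu_b * par_eta_b) <= tau.
Proof.
move=> /ltnW iT; have /andP[r0 rl] := reach_le iT; have /andP[s0 sl] := size_le iT.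
apply: tail_le; last by rewrite mu_b_eta.
apply: (@le_trans _ _ (2 * par_mu_b ^+ 2 * (2 * par_C * (x * d) * (2 * D * (3 * d * (x * d)))))).
  have C2 := mulr_ge0 (ler0n R 2) C_ge0; have D2 := mulr_ge0 (ler0n R 2) (ltW D0).
  apply: (ler_wpM2l (mulr_ge0 (ler0n _ 2) (sqr_ge0 _))); apply: ler_pM.
  - exact: mulr_ge0 C2 r0.
  - exact: mulr_ge0 D2 s0.
  - exact: (ler_wpM2l C2).
  - exact: (ler_wpM2l D2).
have -> : 2 * par_mu_b ^+ 2 * (2 * par_C * (x * d) * (2 * D * (3 * d * (x * d)))) =
  24 * par_mu_b * D * (x ^+ 2 * d ^+ 3) * (par_mu_b * par_C) by ring.
rewrite muC.
have -> : 24 * par_mu_b * D * (x ^+ 2 * d ^+ 3) * (x ^+ 15 / (z ^+ 6 * x ^+ 40)) =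
  24 * (D / D) * (z ^+ 6 * x ^+ 32 / (z ^+ 6 * x ^+ 40)).
  by rewrite /par_mu_b /d; ring.
rewrite DV mulr1.
have -> : 24 * (z ^+ 6 * x ^+ 32 / (z ^+ 6 * x ^+ 40)) =
    24 * (z ^+ 6 * x ^+ 32) / (z ^+ 6 * x ^+ 40) by ring.
rewrite ler_pdivrMr //.
have -> : 2 * (z ^+ 6 * x ^+ 40) = 2 * x ^+ 8 * (z ^+ 6 * x ^+ 32) by ring.
apply: (ler_wpM2r (mulr_ge0 (exprn_ge0 6 (ltW z0)) (xn0 32))).
have : x <= x ^+ 8 by rewrite [x ^+ 8]exprS ler_peMr // ltW.
by have := x200; lra.
Qed.

Let DB_tau i : (i < T)%N -> D * ((1 + par_u i) * (1 + par_u i * rR)) *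
  (rR * (1 + par_u i * rR) * (1 + D) * (2 * tau)) <= 1 / 4.
Proof.
move=> /ltnW iT; have /andP[r0 rl] := reach_le iT; have /andP[s0 sl] := size_le iT.
have D2 : 1 + D <= 2 * D by have := D1; lra.
have Dp : 0 <= 1 + D by have := D1; lra.
apply: (@le_trans _ _ (D * (3 * d * (x * d)) * (x * d * (2 * D) * (2 * tau)))).
  apply: ler_pM.
  - exact: mulr_ge0 (ltW D0) s0.
  - apply: mulr_ge0; first exact: mulr_ge0 r0 Dp.
    exact: mulr_ge0 (ler0n _ 2) (ltW tau0).
  - exact: (ler_wpM2l (ltW D0)).
  - apply: (ler_wpM2r (mulr_ge0 (ler0n _ 2) (ltW tau0))).
    exact: ler_pM.
have -> : D * (3 * d * (x * d)) * (x * d * (2 * D) * (2 * tau)) =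
  12 * (x ^+ 2 * z ^+ 6) * (D ^+ 2 * tau) by rewrite /d; ring.
have h : x * (12 * (x ^+ 2 * z ^+ 6)) <= D * 12.
  have -> : x * (12 * (x ^+ 2 * z ^+ 6)) = z ^+ 6 * x ^+ 3 * 12 by ring.
  apply: (ler_wpM2r (ler0n _ 12)); apply: le_trans D_ge.
  apply: (ler_wpM2l (exprn_ge0 6 (ltW z0))).
  have -> : x ^+ 40 = x ^+ 37 * x ^+ 3 by ring.
  exact: ler_peMl (xn0 3) (xn1 37).
have h3 := @Dn_tau 3 isT.
have t2 : 0 <= D ^+ 2 * tau := mulr_ge0 (sqr_ge0 _) (ltW tau0).
have : x * (12 * (x ^+ 2 * z ^+ 6)) * (D ^+ 2 * tau) <= D * 12 * (D ^+ 2 * tau).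
  exact: (ler_wpM2r t2).
have -> : D * 12 * (D ^+ 2 * tau) = 12 * (D ^+ 3 * tau) by ring.
have xz0 := mulr_ge0 (xn0 2) (exprn_ge0 6 (ltW z0)).
move: (mulr_ge0 xz0 t2) h3 => q0 h3 h4.
have h5 : x * (12 * ((x ^+ 2 * z ^+ 6) * (D ^+ 2 * tau))) <= 12.
  by have : 12 * (D ^+ 3 * tau) <= 12; [lra | move: h4; rewrite -!mulrA; lra].
have h6 : 200 * (12 * ((x ^+ 2 * z ^+ 6) * (D ^+ 2 * tau))) <= 12.
  by apply: le_trans h5; apply: (ler_wpM2r (mulr_ge0 (ler0n _ 12) q0)).
by move: h6; rewrite -!mulrA; lra.
Qed.

(** * Parameters of the sparsification and the resulting rate *)

Let s : R := d / D.

Let Ds : D * s = d. Proof. by rewrite /s mulrCA mulfV ?mulr1 // lt0r_neq0. Qed.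

Let d_le_D : d <= D.
Proof.
apply: le_trans D_ge; apply: le_trans (_ : z ^+ 6 <= _).
  by rewrite /d (_ : z ^+ 6 = z ^+ 4 * z ^+ 2) ?ler_peMl ?exprn_ge0 ?exprn_ege1 ?(ltW z0) //; ring.
by apply: ler_peMr (exprn_ge0 6 (ltW z0)) (xn1 40).
Qed.

Let s01 : 0 <= s <= 1.
Proof.
rewrite /s divr_ge0 ?(ltW d0) ?(ltW D0) //=.
by rewrite ler_pdivrMr // mul1r.
Qed.

Let Cs_le1 : par_C * s <= 1.
Proof.
have -> : par_C * s = d / (z ^+ 6 * x ^+ 40) * (D / D) by rewrite /par_C /s; ring.
rewrite DV mulr1 ler_pdivrMr // mul1r.
have -> : z ^+ 6 * x ^+ 40 = z ^+ 4 * x ^+ 40 * d by rewrite /d; ring.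
apply: ler_peMl (ltW d0) _; apply: mulr_ege1 (xn1 40); exact: exprn_ege1.
Qed.

Let mu_d01 : 0 <= par_mu_d <= 1 / 2.
Proof.
rewrite mu_d_ge0 /par_mu_d /= -[X in X <= _]mul1r ler_pdivrMr //.
have := z_big; have := xn1 2; have := rR2; move: (x ^+ 2) => t; nra.
Qed.

Let sparse_tau_d : expR (2 * par_mu_d ^+ 2 * (D * s) - par_mu_d * par_eta_d) <= tau.
Proof.
apply: tail_le; last by rewrite mu_d_eta.
rewrite Ds (_ : 2 * par_mu_d ^+ 2 * d = 2 * (z / z) ^+ 2); last by rewrite /par_mu_d /d; ring.
by rewrite zV expr1n mulr1.
Qed.

Let x2_big : 200 * x <= x ^+ 2.
Proof. by rewrite expr2; apply: (ler_wpM2r (ltW x0)). Qed.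

Let sparse_tau_K : expR (2 * (1 / 2) ^+ 2 * (par_C * s) - 1 / 2 * (x ^+ 2 - 1)) <= tau.
Proof.
rewrite /tau ler_expR (_ : 2 * (1 / 2) ^+ 2 * (par_C * s) = par_C * s / 2); last by field.
by have := Cs_le1; have := x2_big; have := x200; lra.
Qed.

Let D_sparse_tau : D * ((rR + rR ^+ 2) * (2 * tau)) <= 1 / 4.
Proof.
have h1 := @Dn_tau 2 isT; have t1 : 0 <= D * tau := mulr_ge0 (ltW D0) (ltW tau0).
have h2 : 50 * (rR + rR ^+ 2) <= D.
  apply: le_trans x_le_D; apply: le_trans x_ge; have := rR2; rewrite expr2.
  move: rR => t; nra.
have h3 : 50 * (rR + rR ^+ 2) * (D * tau) <= D * (D * tau) by apply: (ler_wpM2r t1).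
have -> : D * ((rR + rR ^+ 2) * (2 * tau)) = 2 * ((rR + rR ^+ 2) * (D * tau)) by ring.
have : D * (D * tau) <= 1 by move: h1; rewrite expr2 mulrA.
by move: h3; rewrite -mulrA; move: (_ * (D * tau)) (_ * (D * tau)) => a b; lra.
Qed.

Let q : R := 2 * (theta / (d * v)).

Let dv0 : 0 < d * v. Proof. exact: mulr_gt0. Qed.

Let q_ge0 : 0 <= q.
Proof. exact: mulr_ge0 (ler0n _ 2) (divr_ge0 (ltW theta0) (ltW dv0)). Qed.

Let q_ge i : (i < T)%N -> 2 * (theta / par_u i) <= q.
Proof.
move=> /ltnW iT; apply: (ler_wpM2l (ler0n _ 2)); apply: (ler_wpM2l (ltW theta0)).
by rewrite lef_pV2 ?posrE ?u_gt0 // u_ge.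
Qed.

(** The sparsification probability [d / D] meets [theta * y / d] from the lowest degree [d * v], so
    [d] cancels. What remains is [4 * T%:R * theta] times [y / D], with [T%:R * theta] about
    [x ^+ 4]. *)
Let rate_le : 2 * s * (T%:R * q) <= x ^+ 5 * y / D.
Proof.
have vv : y * v = 1 := yv.
have e1 : v / v = 1 by rewrite mulfV // lt0r_neq0.
have dd : d / d = 1 by rewrite mulfV // lt0r_neq0.
have -> : 2 * s * (T%:R * q) = T%:R * (4 * theta * y / D * (d / d)).
  by rewrite /q /s invfM [v^-1]invrK; ring.
rewrite dd mulr1.
have yD : 0 <= y / D by apply: divr_ge0; apply: ltW.
have -> : T%:R * (4 * theta * y / D) = 4 * (T%:R * theta) * (y / D) by ring.
have -> : x ^+ 5 * y / D = x ^+ 5 * (y / D) by rewrite mulrA.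
apply: (ler_wpM2r yD).
have : T%:R * theta <= (x ^+ 8 + 1) * theta by apply: (ler_wpM2r (ltW theta0)).
have -> : (x ^+ 8 + 1) * theta = x ^+ 4 * (x ^+ 4 * w ^+ 4) + theta by rewrite /theta; ring.
rewrite xwn mulr1 [x ^+ 5]exprS.
have := xn1 4; have := theta_small; have := theta0; have := x200.
by move: (x ^+ 4) (T%:R * theta) => t t'; nra.
Qed.

Let T_eta_b : T%:R * par_eta_b <= theta * D.
Proof.
apply: (@le_trans _ _ ((x ^+ 8 + 1) * par_eta_b)).
  apply: (ler_wpM2r _ T_x8); exact: mulr_ge0 (ltW D0) (exprn_ge0 13 (ltW w0)).
have -> : (x ^+ 8 + 1) * par_eta_b = (x ^+ 8 * w ^+ 8 * w ^+ 1 + w ^+ 9) * (theta * D).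
  by rewrite /par_eta_b /theta; ring.
rewrite xwn mul1r; apply: (ler_piMl (mulr_ge0 (ltW theta0) (ltW D0))).
by have := @theta_le 1 isT; have := @theta_le 9 isT; lra.
Qed.

(** Of the [rR + 4] units of [theta * D], [rR + 2] are waste, one is the fraction still alive at the
    end, and one is the accumulated deviation. *)
Let budget0 : par_lam 0 * D + T%:R * par_eta_b <= (rR + 4) * theta * D.
Proof.
have : par_lam 0 * D <= ((rR + 2) * theta + theta) * D.
  by apply: (ler_wpM2r (ltW D0)); rewrite /par_lam subn0 lerD2l.
have := T_eta_b.
have -> : (rR + 4) * theta * D = ((rR + 2) * theta + theta) * D + theta * D by ring.
lra.
Qed.

Lemma spread_leftover (V E W : finType) (inc : E -> {set V}) (H : {set E})
    (A : {set V}) (m : W -> V -> R) :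
  (forall e, e \in H -> #|inc e| = r) ->
  (forall v, #|star inc H v|%:R <= D) ->
  (forall a, a \in A -> D * (1 - w ^+ 15) <= #|star inc H a|%:R) ->
  (forall v w, v != w -> #|star inc H v :&: star inc H w|%:R <= par_C) ->
  (forall b a, 0 <= m b a) -> (forall b a, m b a <= par_C) ->
  (forall b, \sum_(a in A) m b a <= D) ->
  (forall b, #|[set a in A | m b a != 0]|%:R <= D) ->
  (forall a, a \in A -> #|[set b | m b a != 0]|%:R <= D) ->
  spread (fun M => [/\ M \subset H, pairwise_disjoint inc M &
    forall b, \sum_(a in A :\: cover_set inc M) m b a <= (rR + 4) * theta * D])
    (x ^+ 5 * y / D).
Proof.
move=> unifH st_le st_ge cod m0 mC mD mN mW.
have r_gt0 : (0 < r)%N by apply: leq_trans r_ge2.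
have mu_K01 : 0 <= (1 / 2 : R) <= 1 / 2 by rewrite lexx andbT divr_ge0.
have [mu [muQ muS]] := sparsify r_gt0 unifH st_le st_ge cod s01 D1 mu_d01 mu_K01
  sparse_tau_d sparse_tau_K D_sparse_tau.
have s0 : 0 <= s by case/andP: s01.
have Tq : 0 <= T%:R * q by apply: mulr_ge0.
apply: (spread_weaken _ rate_le) => [|M QM|].
- by apply: mulr_ge0 Tq; apply: mulr_ge0.
- exact: QM.
apply: (spread_restrict muQ muS Tq) => X [du dl dK].
(* The error factor [i.+1] equals 1 already at round 0: this first [d * xi] absorbs the deviation of
   the sparsified degrees and the defect [w ^+ 15] of the original ones. *)
have ed := eta_d_le (leq0n T); have e0 : 0 <= par_eta_d.
  exact: mulr_ge0 (ltW z0) (xn0 2).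
rewrite expr0 mulr1 in ed.
have st0 c : #|star inc (H :&: X) c|%:R <= par_u 0.
  by apply: le_trans (du c) _; rewrite Ds /par_u expr0 mulr1 mul1r; lra.
have sl0 a : a \in A :&: finset.setT -> par_l 0 <= #|star inc (H :&: X) a|%:R.
  rewrite finset.setIT => /dl; apply: le_trans.
  have -> : D * (1 - w ^+ 15) * s = (D * s) * (1 - w ^+ 15) by ring.
  have h1 : d * w ^+ 15 <= d * xi / 200.
    have -> : d * w ^+ 15 = d * xi * w by rewrite /xi; ring.
    by apply: (ler_wpM2l (ltW (mulr_gt0 d0 xi0))); have := w1; lra.
  have -> : par_l 0 = d - d * xi by rewrite /par_l; ring.
  rewrite Ds mulrBr mulr1; have := mulr_gt0 d0 xi0; move: ed h1.
  by move: (d * xi) (d * w ^+ 15) => t t'; lra.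
have K0 c c' : c != c' ->
    #|star inc (H :&: X) c :&: star inc (H :&: X) c'|%:R <= x ^+ 2.
  by move=> /dK h; apply: le_trans h _; have := Cs_le1; lra.
have uH e : e \in H :&: X -> #|inc e| = r by rewrite inE => /andP[/unifH].
have iT e : e \in H :&: X -> inc e \subset finset.setT by move=> _; apply: finset.subsetT.
have bud b : par_lam 0 * \sum_(a in A :&: finset.setT) m b a <= par_lam 0 * D.
  rewrite finset.setIT; apply: ler_wpM2l (mD b).
  by have /andP[] := lams_ge0 (leq0n T).
have := nibble r_gt0 m0 mC mD mN mW theta01 (xn0 2) C_ge0 D1 (ltW D0) u_ge1 us_K usS lsS
  ls_us mu_d_ge0 mu_d_le tau_d lams_ge0 lamsS lamsT mu_b_ge0 mu_b_le tau_b DB_tau q_ge0 q_ge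
  (add0n T) uH iT st0 sl0 K0 bud.
apply: (spread_weaken Tq (lexx _)) => M [MH Md Mb]; split.
  exact: MH.
split=> //; first exact: fintype.subset_trans MH (finset.subsetIl _ _).
move=> b; have := Mb b; rewrite finset.setIT => h; exact: le_trans h budget0.
Qed.

(** * Parameters of the bipartite cover *)

Lemma cover_size : 2 * D / x * (tau + 2 * (rR * ((rR + 4) * theta * D)) * (x ^+ 2 / D) ^+ 2)
  <= 1 / 4.
Proof.
have -> : 2 * D / x * (tau + 2 * (rR * ((rR + 4) * theta * D)) * (x ^+ 2 / D) ^+ 2) =
  2 * (D * tau) * w + 4 * (rR * (rR + 4) * w) * (x ^+ 4 * w ^+ 4) * (D / D) ^+ 2.
  by rewrite /theta -/w; ring.
rewrite xwn DV expr1n !mulr1.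
have h1 := @Dn_tau 1 isT; rewrite expr1 in h1.
have h2 : 2 * (D * tau) * w <= 2 * w by apply: (ler_wpM2r (ltW w0)); lra.
have h3 : rR * (rR + 4) * w <= 3 * (rR ^+ 2 * w).
  rewrite [X in _ <= X]mulrA; apply: (ler_wpM2r (ltW w0)); have := rR2; rewrite expr2.
  by move: rR => t; nra.
by move: rw; rewrite -mulrA; have := w1; lra.
Qed.

Lemma cover_prob01 : 0 <= x ^+ 2 / D <= 1.
Proof.
rewrite divr_ge0 ?(ltW D0) ?xn0 //= ler_pdivrMr // mul1r.
apply: le_trans D_ge; have -> : z ^+ 6 * x ^+ 40 = (z ^+ 6 * x ^+ 38) * x ^+ 2 by ring.
by apply: (ler_peMl (xn0 2)); apply: mulr_ege1 (xn1 38); apply: exprn_ege1.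
Qed.

Lemma cover_size_ge2 : 2 <= 2 * D / x.
Proof. by rewrite ler_pdivlMr //; apply: (ler_wpM2l (ler0n _ 2)). Qed.

Lemma cover_size_ge : D / x + 1 <= 2 * D / x.
Proof.
have -> : 2 * D / x = D / x + D / x by ring.
by rewrite lerD2l ler_pdivlMr // mul1r.
Qed.

Lemma cover_size_incident : 2 * D / x * rR <= D.
Proof.
have -> : 2 * D / x * rR = 2 * D * rR / x by ring.
rewrite ler_pdivrMr // [2 * D]mulrC -mulrA; apply: (ler_wpM2l (ltW D0)).
by have := x_big; have := rR2; lra.
Qed.

(** At least [D / x] edges, each chosen with probability [x ^+ 2 / D], give at least [x] chosen
    edges on average, hence a failure probability of at most [expR (- x)]. *)
Lemma pow_1sub_tau n : D / x <= n%:R -> (1 - x ^+ 2 / D) ^+ n <= tau.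
Proof.
move=> nD; have h : 1 - x ^+ 2 / D <= expR (- (x ^+ 2 / D)) by apply: expR_ge1Dx.
have p1 : 0 <= 1 - x ^+ 2 / D by case/andP: cover_prob01 => _ h1; rewrite subr_ge0.
apply: (@le_trans _ _ (expR (- (x ^+ 2 / D)) ^+ n)).
  by apply: lerXn2r => //; rewrite nnegrE expR_ge0.
rewrite -expRM_natl ler_expR mulrN lerN2.
have xx : x / x = 1 by rewrite mulfV // lt0r_neq0.
have e : D / x * (x ^+ 2 / D) = x.
  have -> : D / x * (x ^+ 2 / D) = x * (x / x) * (D / D) by ring.
  by rewrite xx DV !mulr1.
have p0 : 0 <= x ^+ 2 / D by case/andP: cover_prob01.
by rewrite -[X in X <= _]e; apply: (ler_wpM2r p0 nD).
Qed.

Lemma total_rate : x ^+ 5 * y / D + 2 * (x ^+ 2 / D) <= x ^+ 6 * y / D.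
Proof.
have -> : x ^+ 5 * y / D + 2 * (x ^+ 2 / D) = (x ^+ 5 * y + 2 * x ^+ 2) / D by ring.
apply: ler_wpM2r; first by rewrite invr_ge0 ltW.
have h : x ^+ 2 <= x ^+ 5 * y.
  have -> : x ^+ 5 * y = x ^+ 3 * y * x ^+ 2 by ring.
  by apply: (ler_peMl (xn0 2)); apply: mulr_ege1.
have -> : x ^+ 6 * y = x * (x ^+ 5 * y) by ring.
have := x200; have := xn0 2; move: h; move: (x ^+ 5 * y) (x ^+ 2) => t t'; nra.
Qed.

Lemma par_C_ge0 : 0 <= par_C. Proof. exact: C_ge0. Qed.
Lemma par_D_ge1 : 1 <= D. Proof. exact: D1. Qed.
End NumericalChoice.

(** * The perfect matching *)

Lemma exists_subset_card (T : finType) (S : {set T}) n : (n <= #|S|)%N ->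
  exists2 Q : {set T}, Q \subset S & #|Q| = n.
Proof.
move=> nS; exists [set x in take n (enum S)].
  by apply/fintype.subsetP => x; rewrite inE => /mem_take; rewrite mem_enum.
rewrite cardsE (card_uniqP _) ?take_uniq ?enum_uniq // size_takel //.
by rewrite -cardE.
Qed.

Section Core.
Variables (R : realType) (r : nat) (x D : R).
Hypothesis r_ge2 : (2 <= r)%N.
Hypothesis x_ge : 100 * r%:R ^+ 2 <= x.
Hypothesis D_ge : par_z r x ^+ 6 * x ^+ 40 <= D.
Hypothesis D_tau : D ^+ 8 * expR (- x) <= 1.
Variables (V E : finType) (G G1 G2 : hypergraph V E) (A B : {set V}).
Hypothesis unifG : uniform r G.
Hypothesis unionG : edge_disjoint_union G G1 G2.
Hypothesis bipG2 : bipartite G2 A B.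
Hypothesis vsetA : vset G1 :&: vset G2 = A.
Hypothesis codegG : forall u v, u \in vset G -> v \in vset G -> u != v ->
  (codeg G u v)%:R <= par_C r x D.
Hypothesis degB : forall v, v \in B -> (deg G2 v)%:R <= D.
Hypothesis degA2 : forall v, v \in A -> D / x <= (deg G2 v)%:R.
Hypothesis deg1 : forall v, v \in vset G1 -> (deg G1 v)%:R <= D.
Hypothesis degA1 : forall v, v \in A -> D * (1 - x^-1 ^+ 15) <= (deg G1 v)%:R.

Let C := par_C r x D.
Let C0 : 0 <= C. Proof. exact: par_C_ge0 r_ge2 x_ge D_ge. Qed.
Let D1 : 1 <= D. Proof. exact: par_D_ge1 r_ge2 x_ge D_ge. Qed.
Let D0 : 0 <= D. Proof. exact: le_trans D1. Qed.

Let vG : vset G = vset G1 :|: vset G2. Proof. by case: unionG. Qed.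
Let eG : eset G = eset G1 :|: eset G2. Proof. by case: unionG. Qed.
Let inc1 e : e \in eset G1 -> inc G e = inc G1 e.
Proof. by case: unionG => _ _ _ h _; apply: h. Qed.
Let inc2 e : e \in eset G2 -> inc G e = inc G2 e.
Proof. by case: unionG => _ _ _ _ h; apply: h. Qed.
Let vG2 : vset G2 = A :|: B. Proof. by case: bipG2. Qed.
Let disjAB : [disjoint A & B]. Proof. by case: bipG2. Qed.
Let one_A e : e \in eset G2 -> #|inc G e :&: A| = 1%N.
Proof. by move=> e2; rewrite inc2 //; case: bipG2 => _ _; apply. Qed.

Let eG1 e : e \in eset G1 -> e \in eset G. Proof. by rewrite eG inE => ->. Qed.
Let eG2 e : e \in eset G2 -> e \in eset G. Proof. by rewrite eG inE orbC => ->. Qed.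

Let one_A_eq e a a' : e \in eset G2 -> a \in inc G e -> a \in A ->
  a' \in inc G e -> a' \in A -> a = a'.
Proof.
move=> /one_A/eqP/cards1P[c ec] ae aA ae' aA'.
have : a \in inc G e :&: A by rewrite inE ae.
have : a' \in inc G e :&: A by rewrite inE ae'.
by rewrite ec !inE => /eqP-> /eqP->.
Qed.

Let star1 v : star (inc G) (eset G1) v = [set e in eset G1 | v \in inc G1 e].
Proof.
apply/setP => e; rewrite !inE; case: (boolP (e \in eset G1)) => //= e1.
by rewrite inc1.
Qed.

Let star2 v : star (inc G) (eset G2) v = [set e in eset G2 | v \in inc G2 e].
Proof.
apply/setP => e; rewrite !inE; case: (boolP (e \in eset G2)) => //= e2.
by rewrite inc2.
Qed.

Let star1_le v : #|star (inc G) (eset G1) v|%:R <= D.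
Proof.
have [vG1|vG1] := boolP (v \in vset G1); first by rewrite star1; apply: deg1.
rewrite (_ : star _ _ _ = set0) ?cards0 //; apply/setP => e; rewrite star1 !inE.
apply/negP => /andP[/inc_sub/fintype.subsetP h /h]; exact/negP.
Qed.

Let codeg_sub (F : {set E}) u v : F \subset eset G -> u != v ->
  #|star (inc G) F u :&: star (inc G) F v|%:R <= C.
Proof.
move=> /fintype.subsetP FG uv.
have [/andP[uG vG']|nuv] := boolP ((u \in vset G) && (v \in vset G)).
  apply: le_trans (codegG uG vG' uv); rewrite ler_nat.
  apply/subset_leq_card/fintype.subsetP => e; rewrite !inE.
  by case/andP => /andP[/FG -> ->] /andP[_ ->].
rewrite (_ : _ :&: _ = set0) ?cards0 //; apply/setP => e; rewrite !inE.
apply: contraNF nuv => /andP[/andP[/FG/inc_sub/fintype.subsetP h /h ->] /andP[_ /h ->]].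
by [].
Qed.

(** An edge of [G2] has one vertex in [A], so choices at different vertices do not interfere. The
    upper bound [2 * D / x] limits the scopes in the cover and the number of [b] seen from a vertex
    of [A]. *)
Let trim : exists F : {set E}, F \subset eset G2 /\
  forall a, a \in A -> D / x <= #|star (inc G) F a|%:R <= 2 * D / x.
Proof.
have x_gt0 : 0 < x.
  by apply: lt_le_trans x_ge; rewrite mulr_gt0 // exprn_gt0 // ltr0n; apply: leq_trans r_ge2.
have Dx0 : 0 <= D / x by rewrite divr_ge0 // ltW.
have /choice[Q QP] : forall a, exists Q : {set E}, a \in A ->
    Q \subset star (inc G) (eset G2) a /\ D / x <= #|Q|%:R <= 2 * D / x.
  move=> a; have [aA|aA] := boolP (a \in A); last by exists set0.
  set S := star _ _ _; set n := minn #|S| (Num.truncn (D / x)).+1.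
  have [Q QS Qn] := exists_subset_card (geq_minl #|S| (Num.truncn (D / x)).+1).
  exists Q => _; split=> //; rewrite Qn; apply/andP; split.
    rewrite /minn; case: ifP => _; last by apply/ltW/truncnS_gt.
    by rewrite /S star2; apply: degA2.
  apply: (@le_trans _ _ (Num.truncn (D / x)).+1%:R); first by rewrite ler_nat geq_minr.
  apply: le_trans (cover_size_ge r_ge2 x_ge D_ge); rewrite -natr1 lerD2r.
  by rewrite truncn_le.
exists [set e in eset G2 | [exists a in A, e \in Q a]]; split.
  by apply/fintype.subsetP => e; rewrite inE => /andP[].
move=> a aA; have [QS Qn] := QP a aA.
rewrite (_ : star _ _ a = Q a) //; apply/setP => e; rewrite !inE.
apply/idP/idP => [/andP[/andP[e2 /exists_inP[a' a'A eQ]] ae]|eQ].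
  have [/fintype.subsetP/(_ e eQ)] := QP a' a'A; rewrite inE => /andP[_ a'e] _.
  by rewrite (one_A_eq e2 ae aA a'e a'A).
have := fintype.subsetP QS e eQ; rewrite inE => /andP[-> ->]; rewrite andbT /=.
by apply/exists_inP; exists a.
Qed.

Lemma spread_perfect_matching :
  spread (perfect_matching_on G A) (x ^+ 6 * par_y r x / D).
Proof.
have [F [/fintype.subsetP FG2 Fdeg]] := trim.
have x4 : 4 <= x.
  apply: le_trans x_ge; have h : 2 <= r%:R :> R by rewrite (ler_nat R 2).
  by have := ler_pM (ler0n R 2) (ler0n R 2) h h; rewrite expr2 => h2; lra.
have x0 : 0 < x by apply: lt_le_trans x4.
have xV1 : x^-1 <= 1 / 2.
  by rewrite -[X in X <= _]mul1r ler_pdivrMr //; lra.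
have xV0 : 0 < x^-1 by rewrite invr_gt0.
have theta0 : 0 < x^-1 ^+ 4 by apply: exprn_gt0.
have theta2 : x^-1 ^+ 4 <= 1 / 2.
  apply: (le_trans _ xV1); rewrite exprS; apply: (ler_piMr (ltW xV0)).
  by apply: exprn_ile1; [exact: ltW | lra].
(* Restricting to [b] in [B] and [a] in [A] forces [b != a], without which the
   codegree bound [m b a <= C] would fail. *)
pose m (b a : V) : R :=
  if (b \in B) && (a \in A) then #|star (inc G) F b :&: star (inc G) F a|%:R else 0.
have FG : F \subset eset G by apply/fintype.subsetP => e /FG2 /eG2.
have m0 b a : 0 <= m b a by rewrite /m; case: ifP.
have mC b a : m b a <= C.
  rewrite /m; case: ifP => // /andP[bB aA]; apply: codeg_sub => //.
  by apply: contraTneq bB => ->; rewrite (disjointFr disjAB aA).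
have starF_le b : b \in B -> #|star (inc G) F b|%:R <= D.
  move=> bB; apply: le_trans (degB bB); rewrite ler_nat.
  have -> : deg G2 b = #|star (inc G) (eset G2) b| by rewrite star2.
  apply/subset_leq_card/fintype.subsetP => e; rewrite !inE.
  by case/andP => /FG2 -> ->.
(* Double counting: an edge at [b] is counted once, at its only vertex in [A]. *)
have mD b : \sum_(a in A) m b a <= D.
  rewrite /m; have [bB|bB] := boolP (b \in B); last by rewrite big1 // => a _.
  apply: le_trans (starF_le b bB).
  under eq_bigr => a aA do rewrite aA /= -sum1_card natr_sum big_mkcond /=.
  rewrite exchange_big /= -sum1_card natr_sum [X in _ <= X]big_mkcond /=.
  apply: ler_sum => e _; have [eb|eb] := boolP (e \in star (inc G) F b); last first.
    by rewrite big1 // => a _; rewrite inE (negbTE eb).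
  have e2 : e \in eset G2 by apply: FG2; move: eb; rewrite inE => /andP[].
  rewrite -big_mkcondr /= -natr_sum sum1_card ler_nat -(one_A e2).
  apply/subset_leq_card/fintype.subsetP => a; rewrite unfold_in /= !inE.
  by case/andP => -> /andP[_ /andP[_ ->]].
have mN b : #|[set a in A | m b a != 0]|%:R <= D.
  apply: le_trans (mD b); rewrite -sum1_card natr_sum big_mkcond [X in _ <= X]big_mkcond /=.
  apply: ler_sum => a _; rewrite inE; case: (a \in A) => //=; case: ifP => //.
  by rewrite /m; case: ifP => // _; rewrite ?eqxx // pnatr_eq0 ler1n lt0n.
have mW a : a \in A -> #|[set b | m b a != 0]|%:R <= D.
  move=> aA; have /andP[_ Fa] := Fdeg a aA.
  apply: le_trans (cover_size_incident r_ge2 x_ge D_ge).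
  apply: (@le_trans _ _ #|\bigcup_(e in star (inc G) F a) inc G e|%:R).
    rewrite ler_nat; apply/subset_leq_card/fintype.subsetP => b; rewrite inE /m.
    case: ifP => _; last by rewrite eqxx.
    rewrite pnatr_eq0 cards_eq0 => /set0Pn[e]; rewrite inE => /andP[eb ea].
    by apply/bigcupP; exists e => //; move: eb; rewrite inE => /andP[].
  apply: card_bigcup_le_mul (ler0n _ _) Fa _ => e; rewrite inE => /andP[eF _].
  by rewrite unifG //; apply: (fintype.subsetP FG).
have [T [T1 T2 T3]] : exists T : nat, [/\ T%:R <= (x^-1 ^+ 4) ^- 2 + 1 :> R,
    (1 - x^-1 ^+ 4) ^+ T <= x^-1 ^+ 4 & (x^-1 ^+ 4) ^+ 2 <= (1 - x^-1 ^+ 4) ^+ T].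
  by apply: geometric_stop.
have unif1 e : e \in eset G1 -> #|inc G e| = r by move=> /eG1 /unifG.
have deg1' a : a \in A -> D * (1 - x^-1 ^+ 15) <= #|star (inc G) (eset G1) a|%:R.
  by move=> aA; rewrite star1; apply: degA1.
have cod1 u v : u != v ->
    #|star (inc G) (eset G1) u :&: star (inc G) (eset G1) v|%:R <= C.
  by apply: codeg_sub; apply/fintype.subsetP => e /eG1.
have [mu [muQ muS]] := spread_leftover r_ge2 x_ge D_ge D_tau T1 T2 T3 unif1 star1_le
  deg1' cod1 m0 mC mD mN mW.
have psi0 := cover_prob01 r_ge2 x_ge D_ge.
have rate0 : 0 <= 2 * (x ^+ 2 / D) by case/andP: psi0 => h _; apply: mulr_ge0.
apply: (spread_weaken _ (total_rate r_ge2 x_ge D_ge) (fun M QM => QM)).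
  by apply: addr_ge0 rate0; rewrite divr_ge0 // mulr_ge0 ?exprn_ge0 ?exprn_ge0 // ltW.
apply: (spread_union muQ (m := id)) => // M1 [M1G M1d M1load].
set L := A :\: cover_set (inc G) M1 in M1load.
have LA : L \subset A by apply: finset.subsetDl.
have unifF e : e \in F -> #|inc G e| = r by move=> /(fintype.subsetP FG) /unifG.
have oneF e : e \in F -> #|inc G e :&: A| = 1%N by move=> /FG2 /one_A.
have Fdelta a : a \in L -> (1 - x ^+ 2 / D) ^+ #|star (inc G) F a| <= expR (- x).
  move=> /(fintype.subsetP LA) /Fdeg /andP[h _].
  exact: pow_1sub_tau r_ge2 x_ge D_ge _ h.
have FN a : a \in L -> #|star (inc G) F a|%:R <= 2 * D / x.
  by move=> /(fintype.subsetP LA) /Fdeg /andP[_].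
have Lam0 : 0 <= (r%:R + 4) * x^-1 ^+ 4 * D.
  by apply: mulr_ge0 D0; apply: mulr_ge0 (ltW theta0); apply: addr_ge0.
(* Each counted edge at [b] contains a leftover vertex [a] and so contributes to [m b a]; the nibble
   has bounded the total over [L]. A vertex outside [A] and [B] lies on no edge of [F]. *)
have FLam b : b \notin A -> #|star (inc G) [set e in F | ~~ [disjoint inc G e & L]] b|%:R <=
    (r%:R + 4) * x^-1 ^+ 4 * D.
  move=> bA; have [bB|bB] := boolP (b \in B); last first.
    rewrite (_ : star _ _ _ = set0) ?cards0 //.
    apply/setP => e; rewrite !inE; apply/negP => /andP[/andP[/FG2 e2 _] be].
    have := fintype.subsetP (inc_sub e2) b; rewrite -inc2 // be vG2 inE (negbTE bA) (negbTE bB).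
    by move=> /(_ isT).
  apply: le_trans (M1load b).
  apply: (@le_trans _ _ (\sum_(a in L) #|star (inc G) F b :&: star (inc G) F a|)%:R).
    rewrite ler_nat.
    apply: (@leq_trans #|\bigcup_(a in L) (star (inc G) F b :&: star (inc G) F a)|).
      apply/subset_leq_card/fintype.subsetP => e; rewrite !inE.
      case/andP => /andP[eF /pred0Pn[a /= /andP[ae aL]]] be.
      by apply/bigcupP; exists a; rewrite // !inE eF be ae.
    exact: card_bigcup_le.
  rewrite natr_sum; apply: ler_sum => a aL.
  by rewrite /m bB (fintype.subsetP LA _ aL).
have cov := bipartite_cover LA unifF oneF psi0 Fdelta FN FLam
  (cover_size_ge2 r_ge2 x_ge D_ge) (cover_size r_ge2 x_ge D_ge D_tau) (expR_ge0 _) Lam0.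
apply: (spread_weaken rate0 (lexx _) _ cov) => M2 [M2F M2d LM2].
have FLF e : e \in M2 -> e \in F /\ ~~ [disjoint inc G e & L].
  by move=> /(fintype.subsetP M2F); rewrite inE => /andP[].
(* A common vertex lies in both [vset G1] and [vset G2], hence in [A]. It is then the unique vertex
   of [f] in [A], which belongs to [L] and is uncovered by [M1]. *)
have cross e f : e \in M1 -> f \in M2 -> [disjoint inc G e & inc G f].
  move=> eM1 /FLF[fF /pred0Pn[a /= /andP[af aL]]].
  have e1 := fintype.subsetP M1G _ eM1; have f2 := FG2 _ fF.
  apply/pred0P => c /=; apply/negP => /andP[ce cf].
  have cA : c \in A.
    rewrite -vsetA inE; apply/andP; split.
      by apply: (fintype.subsetP (inc_sub e1)); rewrite -inc1.
    by apply: (fintype.subsetP (inc_sub f2)); rewrite -inc2.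
  have aA := fintype.subsetP LA _ aL.
  move: aL; rewrite (one_A_eq f2 af aA cf cA) inE => /andP[/negP nc _].
  by apply: nc; apply/bigcupP; exists e.
split; first split.
- rewrite finset.subUset (fintype.subset_trans M1G) /=; last first.
    by apply/fintype.subsetP => e /eG1.
  by apply/fintype.subsetP => e /FLF[/(fintype.subsetP FG)].
- move=> e f; rewrite !inE => /orP[eM|eM] /orP[fM|fM] ef.
  + exact: M1d.
  + exact: cross.
  + by rewrite disjoint_sym; apply: cross.
  + exact: M2d.
- move=> a aA; have [ac|ac] := boolP (a \in cover_set (inc G) M1).
    by move: ac => /bigcupP[e eM ae]; exists e; rewrite // inE eM.
  have : a \in L by rewrite inE ac.
  move=> /(fintype.subsetP LM2) /bigcupP[e eM ae].
  by exists e; rewrite // inE eM orbT.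
Qed.
End Core.

(** * From powers of [x] to powers of [D] *)

Lemma exp_dominates_power (R : realType) (n : nat) (x : R) :
  n.+1%:R ^+ n.+1 <= x -> x ^+ n <= expR x.
Proof.
move=> nx; have n0 : 0 < n.+1%:R :> R by rewrite ltr0n.
have x0 : 0 < x by apply: lt_le_trans nx; rewrite exprn_gt0.
(* Splitting the exponential into [n.+1] factors, each at least [x / n.+1%:R], gains one power of
   [x] to pay for the constant. *)
have -> : expR x = expR (x / n.+1%:R) ^+ n.+1.
  by rewrite -expRM_natl mulrCA mulfV ?mulr1 // lt0r_neq0.
apply: (@le_trans _ _ ((x / n.+1%:R) ^+ n.+1)); last first.
  apply: lerXn2r; rewrite ?nnegrE ?expR_ge0 ?divr_ge0 ?(ltW x0) ?(ltW n0) //.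
  by apply: le_trans (expR_ge1Dx _); rewrite lerDr.
rewrite expr_div_n ler_pdivlMr ?exprn_gt0 // [X in _ <= X]exprSr.
by apply: ler_wpM2l nx; apply/exprn_ge0/ltW.
Qed.

Theorem theorem6p1 (R : realType) (r : nat) (gamma beta : R)
    (hr : (2 <= r)%N) (hgamma : 0 < gamma) (hbeta : 0 < beta) :
  exists D0 alpha0 : R, 0 < alpha0 /\
  forall D alpha : R, D0 <= D -> 0 < alpha -> alpha <= alpha0 ->
  forall (V E : finType) (G G1 G2 : hypergraph V E) (A B : {set V}),
  uniform r G ->
  edge_disjoint_union G G1 G2 ->
  bipartite G2 A B ->
  vset G1 :&: vset G2 = A ->
  (forall u v : V, u \in vset G -> v \in vset G -> u != v ->
     (codeg G u v)%:R <= D `^ (1 - beta)) ->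
  (forall v : V, v \in B -> (deg G2 v)%:R <= D) ->
  (forall v : V, v \in A -> D `^ (1 - alpha) <= (deg G2 v)%:R) ->
  (forall v : V, v \in vset G1 -> (deg G1 v)%:R <= D) ->
  (forall v : V, v \in A -> D * (1 - D `^ (- beta)) <= (deg G1 v)%:R) ->
  exists p : {set E} -> R,
    distribution_on (perfect_matching_on G A) p /\
    forall S : {set E}, S \subset eset G ->
      prob p (fun M : {set E} => S \subset M) <=
        (D `^ (- (1 - gamma))) ^+ #|S|.
Proof.
(* [n1] is the exponent of [x] in [par_z r x ^+ 6 * x ^+ 40] and [n2] that in [x ^+ 6 * par_y r x].
   [N] is chosen so that [n1 / N <= beta] and [n2 / N <= gamma]. *)
pose n1 := ((8 * r.-1 + 20) * 6 + 40)%N; pose n2 := (6 + 8 * r.-1)%N.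
pose N := (n1 + Num.truncn (n1%:R / beta) + Num.truncn (n2%:R / gamma)).+1%N.
have N0 : 0 < N%:R :> R by rewrite ltr0n.
have n1N : (n1 <= N)%N by rewrite /N; lia.
have n1b : n1%:R / N%:R <= beta.
  rewrite ler_pdivrMr // mulrC -ler_pdivrMr //.
  by apply/ltW/(lt_le_trans (truncnS_gt _)); rewrite ler_nat ltnS addnAC leq_addl.
have n2g : n2%:R / N%:R <= gamma.
  rewrite ler_pdivrMr // mulrC -ler_pdivrMr //.
  by apply/ltW/(lt_le_trans (truncnS_gt _)); rewrite ler_nat ltnS leq_addl.
pose x0 : R := 100 * r%:R ^+ 2 + (8 * N).+1%:R ^+ (8 * N).+1.
have r2 : 0 <= 100 * r%:R ^+ 2 :> R by rewrite mulr_ge0 ?exprn_ge0.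
have N1 : 1 <= (8 * N).+1%:R ^+ (8 * N).+1 :> R.
  by apply: exprn_ege1; rewrite (ler_nat R 1).
(* [D >= x0 ^+ N] makes [x = D ^ (1 / N)] at least [x0], which meets both lower bounds on [x]; the
   one with [8 * N] serves [D ^+ 8 = x ^+ (8 * N)]. [alpha <= 1 / N] turns the degree bound on [A]
   in [G2] into [D / x]. *)
exists (x0 ^+ N), (N%:R^-1); split; first by rewrite invr_gt0.
move=> D alpha hD alpha0 alphaN V E G G1 G2 A B unifG unionG bipG2 vsetA codegG degB degA2
  deg1 degA1.
have x01 : 1 <= x0 by apply: (le_trans N1); rewrite lerDr.
have D1 : 1 <= D by apply: le_trans hD; apply: exprn_ege1.
have D0 : 0 < D by apply: lt_le_trans D1.
pose x : R := D `^ (N%:R^-1).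
have xE j : x ^+ j = D `^ (j%:R / N%:R).
  by rewrite -powR_mulrn ?powR_ge0 // -powRrM mulrC.
have xN : x ^+ N = D by rewrite xE divff ?powRr1 ?ltW // lt0r_neq0.
have x_ge0 : 0 <= x by apply: powR_ge0.
have xx0 : x0 <= x.
  have := hD; rewrite -xN ler_pXn2r ?nnegrE //; exact: le_trans x01.
have x1 : 1 <= x := le_trans x01 xx0.
have xV j : D `^ (- (j%:R / N%:R)) = (x ^+ j)^-1 by rewrite powRN xE.
have Dmono (a b : R) : a <= b -> D `^ a <= D `^ b by apply: ler_powR.
have small j : (j <= n1)%N -> D `^ (- beta) <= (x ^+ j)^-1.
  move=> jn; rewrite -xV; apply: Dmono; rewrite lerN2; apply: le_trans n1b.
  by rewrite ler_wpM2r ?invr_ge0 ?(ltW N0) // ler_nat.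
have zE : par_z r x ^+ 6 * x ^+ 40 = x ^+ n1.
  by rewrite /par_z /par_y -exprD -exprM -exprD.
have Dsplit (a : R) : D `^ (1 + a) = D * D `^ a.
  by rewrite powRD ?powRr1 ?ltW // lt0r_neq0 ?implybT.
have := @spread_perfect_matching R r x D hr _ _ _ V E G G1 G2 A B unifG unionG bipG2
  vsetA _ degB _ deg1 _.
case.
- by apply: (le_trans _ xx0); rewrite lerDl (le_trans ler01).
- by rewrite zE -[X in _ <= X]xN; apply: ler_weXn2l.
- rewrite expRN -xN -exprM mulnC ler_pdivrMr ?expR_gt0 // mul1r.
  by apply: exp_dominates_power; apply: (le_trans _ xx0); rewrite lerDr.
- move=> u v uG vG uv; apply: le_trans (codegG u v uG vG uv) _.
  by rewrite Dsplit /par_C zE ler_wpM2l ?(ltW D0) // small.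
- move=> v vA; apply: le_trans (degA2 v vA).
  have -> : D / x = D `^ (1 + - (1%:R / N%:R)) by rewrite Dsplit xV expr1.
  by apply: Dmono; rewrite lerD2l lerN2 mul1r.
- move=> v vA; apply: le_trans (degA1 v vA); rewrite ler_wpM2l ?(ltW D0) //.
  by rewrite lerD2l lerN2 exprVn; apply: small; apply: (leq_trans _ (leq_addl _ 40)).
move=> p [pP pS]; exists p; split=> // S _; apply: le_trans (pS S) _.
have -> : x ^+ 6 * par_y r x / D = D `^ (n2%:R / N%:R) / D.
  by rewrite -xE /par_y -exprD.
have -> : D `^ (- (1 - gamma)) = D `^ gamma / D.
  rewrite opprB powRD ?(lt0r_neq0 D0) ?implybT //.
  by rewrite powRN powRr1 // ltW.
apply: lerXn2r; rewrite ?nnegrE.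
- by apply: divr_ge0 (powR_ge0 _ _) (ltW D0).
- by apply: divr_ge0 (powR_ge0 _ _) (ltW D0).
by apply: ler_wpM2r (Dmono _ _ n2g); rewrite invr_ge0 ltW.
Qed.
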